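(* Let $(X,\mathsf d,\mathfrak m)$ be an $RCD(K,\infty)$ metric measure space, $K\in\mathbb R$. For all $f\in H^{1,2}(X,\mathsf d,\mathfrak m)$, $|\nabla f|$ is the ($\mathfrak m$-)essential supremum of the family $\langle\nabla f,\nabla v\rangle$ as $v$ runs in the family of $1$-Lipschitz functions in $H^{1,2}(X,\mathsf d,\mathfrak m)$. Moreover, for all $g:X\to[0,\infty)$ lower semicontinuous, one has $$\int_X|\nabla f|\,g\,d\mathfrak m=\sup\sum_k\int_X\langle\nabla f,\nabla v_k\rangle\,w_k\,d\mathfrak m,$$ where the supremum runs among all finite collections of $1$-Lipschitz functions $v_k\in H^{1,2}(X,\mathsf d,\mathfrak m)$ and all $w_k\in C_{\rm bs}(X)$ with $\sum_k|w_k|\le g$.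
   Context: A metric measure space is $(X,\mathsf d,\mathfrak m)$ with $(X,\mathsf d)$ complete separable metric and $\mathfrak m$ a nonnegative Borel measure finite on bounded sets (no assumption $\operatorname{supp}\mathfrak m=X$). $C_{\rm bs}(X)$: bounded continuous functions with bounded support; $\mathrm{Lip}_b(X)$: bounded Lipschitz functions. Cheeger energy and gradients: $\mathrm{Lip}_af(x)=\lim_{r\downarrow0}\mathrm{Lip}(f|_{B_r(x)})$; $\mathsf{Ch}(f)=\inf\{\liminf_n\frac12\int\mathrm{Lip}_a^2(f_n)\,d\mathfrak m:\ f_n\in\mathrm{Lip}_b(X)\cap L^2,\ f_n\to f\text{ in }L^2\}$; $H^{1,2}(X,\mathsf d,\mathfrak m)=\{f\in L^2(X,\mathfrak m):\mathsf{Ch}(f)<\infty\}$. For $f\in H^{1,2}$, $|\nabla f|$ (minimal relaxed slope) is the element of least $L^2$ norm in the closed convex set of $g\in L^2$ with $g\ge$ some weak $L^2$ limit of $\mathrm{Lip}_a(f_n)$, $f_n\in\mathrm{Lip}_b(X)\cap L^2$, $f_n\to f$ in $L^2$. When $\mathsf{Ch}$ is quadratic, $\langle\nabla f,\nabla g\rangle=\lim_{\epsilon\to0}\frac{|\nabla(f+\epsilon g)|^2-|\nabla f|^2}{2\epsilon}$ in $L^1$. $RCD(K,\infty)$: $\mathfrak m(B_r(\bar x))\le c_1e^{c_2r^2}$ for all $r>0$ (some $\bar x,c_1,c_2$); $\mathsf{Ch}$ is quadratic; and the relative entropy $\mathrm{Ent}(\rho\mathfrak m)=\int\rho\log\rho\,d\mathfrak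 m$ ($+\infty$ off absolutely continuous measures) is $K$-convex on probability measures with finite second moment: for all $\mu_0,\mu_1$ with finite entropy some constant speed $W_2$-geodesic $\mu_t$ satisfies $\mathrm{Ent}(\mu_t)\le(1-t)\mathrm{Ent}(\mu_0)+t\,\mathrm{Ent}(\mu_1)-\frac K2t(1-t)W_2^2(\mu_0,\mu_1)$. *)

(* Defs.v *)
From HB Require Import structures.
From mathcomp Require Import all_boot all_order all_algebra.
From mathcomp Require Import all_classical all_reals all_analysis.
From mathcomp Require Import measurable_realfun.

Set Implicit Arguments.
Unset Strict Implicit.
Unset Printing Implicit Defensive.

Import Order.TTheory GRing.Theory Num.Theory.
Import numFieldNormedType.Exports.

Local Open Scope classical_set_scope.
Local Open Scope ring_scope.

(* Library completeness is stated for pointed spaces, so X is nonempty. This is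
   no restriction below: the volume growth condition in [RCD] provides a point. *)
#[short(type="completeMetricType")]
HB.structure Definition CompleteMetric (R : numDomainType) :=
  {T of Metric R T & Complete T}.

Notation borel X := (g_sigma_algebraType (@open X)).

Section metric_notions.
Context {R : realType} {X : completeMetricType R}.
Implicit Types (f : X -> R) (A : set X).

Definition separable_space := exists2 A : set X, countable A & dense A.

Definition metric_bounded A := exists x r, A `<=` ball x r.

Definition k_lipschitz (k : R) f := forall x y, `|f x - f y| <= k * mdist x y.

Definition lip_b f := bounded_fun f /\ exists k, k_lipschitz k f.

(* Continuous, bounded, with bounded support. *)
Definition C_bs f :=
  [/\ continuous f, bounded_fun f & metric_bounded (closure [set x | f x != 0])].

(* Diagonal pairs contribute 0 / 0 = 0. *)
Definition lip_const f A : \bar R :=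
  ereal_sup [set (`|f p.1 - f p.2| / mdist p.1 p.2)%:E | p in A `*` A].

(* Asymptotic Lipschitz constant; it is finite when f is Lipschitz. *)
Definition lip_a f (x : X) : \bar R := lim (lip_const f (ball x r) @[r --> 0^'+]).

End metric_notions.
Arguments separable_space {R} X.

(* Elements of L^p(m) are represented by functions: Ch, H12, slope and grad_prod
   depend on f, g only through their classes modulo m-a.e. equality. In contrast,
   the Lipschitz condition in lip_approx is on the function itself, at all points
   of X and not only on the support of m. *)
Section sobolev.
Context {R : realType} {X : completeMetricType R}.
Variable m : {measure set (borel X) -> \bar R}.
Implicit Types (f g h : borel X -> R).

Definition cvg_L2 (u_ : nat -> borel X -> R) f :=
  ('N[m]_2%:E[EFin \o (fun x => u_ n x - f x)%R])%E @[n --> \oo] --> 0%E.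

Definition weak_cvg_L2 (u_ : nat -> borel X -> R) h :=
  [/\ forall n, u_ n \in Lfun m 2%:E, h \in Lfun m 2%:E &
    forall phi : borel X -> R, phi \in Lfun m 2%:E ->
      (\int[m]_x (u_ n x * phi x)%:E)%E @[n --> \oo]
        --> (\int[m]_x (h x * phi x)%:E)%E].

Definition lip_approx (u_ : nat -> borel X -> R) f :=
  (forall n, lip_b (u_ n) /\ u_ n \in Lfun m 2%:E) /\ cvg_L2 u_ f.

Definition Ch f : \bar R :=
  ereal_inf [set limn_einf
      (fun n => (2^-1)%:E * \int[m]_x (lip_a (u_ n) x ^+ 2))%E
    | u_ in [set u_ | lip_approx u_ f]].

Definition H12 f := f \in Lfun m 2%:E /\ (Ch f < +oo)%E.

(* The parallelogram law on all of L^2(m), with value +oo allowed. *)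
Definition Ch_quadratic := forall f g,
  f \in Lfun m 2%:E -> g \in Lfun m 2%:E ->
  (Ch (fun x => f x + g x)%R + Ch (fun x => f x - g x)%R
    = 2%:E * Ch f + 2%:E * Ch g)%E.

Definition relaxed_slope f g :=
  g \in Lfun m 2%:E /\
  exists u_ h, [/\ lip_approx u_ f,
    weak_cvg_L2 (fun n => fine \o lip_a (u_ n)) h &
    \forall x \ae m, h x <= g x].

Definition is_minimal_slope f g :=
  relaxed_slope f g /\
  forall g', relaxed_slope f g' ->
    ('N[m]_2%:E[EFin \o g] <= 'N[m]_2%:E[EFin \o g'])%E.

(* |grad f|, as a representative of its class in L^2(m): for f in H12 a minimal
   slope exists and is unique modulo m-a.e. equality. *)
Definition slope f : borel X -> R := xget (cst 0) [set g | is_minimal_slope f g].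

Definition is_grad_prod f g h :=
  h \in Lfun m 1%:E /\
  ('N[m]_1%:E[EFin \o (fun x =>
      (slope (fun y => f y + e * g y) x ^+ 2 - slope f x ^+ 2) / (2 * e) - h x)%R])%E
    @[e --> 0^'] --> 0%E.

(* <grad f, grad g>, as a representative of its class in L^1(m): for f, g in H12
   the limit exists when Ch is quadratic. *)
Definition grad_prod f g : borel X -> R := xget (cst 0) [set h | is_grad_prod f g h].

(* The essential supremum of a possibly uncountable family of functions: the
   least measurable upper bound in the m-a.e. order. (The library's [ess_sup] is
   the essential supremum of a single function.) *)
Definition is_ess_sup_family (F : set (borel X -> \bar R)) (s : borel X -> \bar R) :=
  [/\ measurable_fun setT s,
    forall u, F u -> \forall x \ae m, (u x <= s x)%E &
    forall s', measurable_fun setT s' ->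
      (forall u, F u -> \forall x \ae m, (u x <= s' x)%E) ->
      \forall x \ae m, (s x <= s' x)%E].

End sobolev.

Section wasserstein.
Context {R : realType} {X : completeMetricType R}.
Implicit Types mu nu : probability (borel X) R.

Definition P2 mu :=
  exists x0 : X, (\int[mu]_x ((mdist (x : X) x0) ^+ 2)%:E < +oo)%E.

(* On a separable X the product of the Borel sigma-algebras is the Borel
   sigma-algebra of the product. *)
Definition coupling mu nu (pi : probability (borel X * borel X)%type R) :=
  forall A : set (borel X), measurable A ->
    pi (fst @^-1` A) = mu A /\ pi (snd @^-1` A) = nu A.

Definition W2 mu nu : \bar R :=
  sqrte (ereal_inf
    [set (\int[pi]_p ((mdist (p.1 : X) (p.2 : X)) ^+ 2)%:E)%E
      | pi in [set pi | coupling mu nu pi]]).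

Definition W2_geodesic (gam : R -> probability (borel X) R) mu nu :=
  [/\ forall t, 0 <= t <= 1 -> P2 (gam t),
    forall A, measurable A -> gam 0 A = mu A,
    forall A, measurable A -> gam 1 A = nu A &
    forall s t, 0 <= s <= 1 -> 0 <= t <= 1 ->
      W2 (gam s) (gam t) = (`|s - t|%:E * W2 mu nu)%E].

Variable m : {measure set (borel X) -> \bar R}.

Definition is_density mu (rho : borel X -> R) :=
  [/\ measurable_fun setT rho, forall x, 0 <= rho x &
    forall A, measurable A -> mu A = (\int[m]_(x in A) (rho x)%:E)%E].

(* Densities are m-a.e. unique, so the infimum is over at most one value, and it
   is +oo if mu has no density. Here rho * ln rho = 0 where rho = 0. For mu with
   finite second moment, the volume growth condition in [RCD] makes the negative
   part of rho * ln rho integrable, so no +oo - oo occurs. *)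
Definition entropy mu : \bar R :=
  ereal_inf [set (\int[m]_x (rho x * ln (rho x))%:E)%E
    | rho in [set rho | is_density mu rho]].

Definition entropy_K_convex (K : R) := forall mu0 mu1, P2 mu0 -> P2 mu1 ->
  entropy mu0 \is a fin_num -> entropy mu1 \is a fin_num ->
  exists2 gam, W2_geodesic gam mu0 mu1 & forall t, 0 <= t <= 1 ->
    (entropy (gam t) <= (1 - t)%:E * entropy mu0 + t%:E * entropy mu1
                        - (K / 2 * t * (1 - t))%:E * W2 mu0 mu1 ^+ 2)%E.

End wasserstein.

Section rcd.
Context {R : realType} {X : completeMetricType R}.

Definition metric_measure_space (m : {measure set (borel X) -> \bar R}) :=
  separable_space X /\
  forall A : set (borel X), measurable A -> metric_bounded (A : set X) ->
    (m A < +oo)%E.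

Definition RCD (K : R) (m : {measure set (borel X) -> \bar R}) :=
  [/\ metric_measure_space m,
    exists (x0 : X) (c1 c2 : R), forall r, 0 < r ->
      (m (ball x0 r) <= (c1 * expR (c2 * r ^+ 2))%:E)%E,
    Ch_quadratic m &
    entropy_K_convex m K].

End rcd.

(* Main.v *)
Require Import Defs.
From HB Require Import structures.
From mathcomp Require Import all_boot all_order all_algebra.
From mathcomp Require Import all_classical all_reals all_analysis.
From mathcomp Require Import measurable_realfun ring lra.
Import Order.TTheory GRing.Theory Num.Theory.
Import numFieldNormedType.Exports.
Local Open Scope classical_set_scope.
Local Open Scope ring_scope.

(** Write |Df| for [slope m f] and <Df, Dv> for [grad_prod m f v].

    Upper bound. For 1-Lipschitz [v], |<Df, Dv>| <= |Df| |Dv| <= |Df| almost everywhere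
    ([grad_prod_le], [slope_lip_le1]).

    Lower bound. There are bounded Lipschitz functions [u_n] converging to [f] in L^2 whose
    asymptotic Lipschitz constants converge strongly to |Df| ([slope_optimal]). On a small
    ball where [u_n] is [L]-Lipschitz, with [L] slightly above its asymptotic Lipschitz
    constant, [u_n / L] agrees with a globally 1-Lipschitz function [v] of bounded support
    ([mcshane]), and locality and sublinearity of the slope give there
    <Df, Dv> >= (|Df|^2 - |Df| |D(u_n - f)|) / L ([grad_prod_ge_ball]). The parallelogram
    law for [Ch] and its lower semicontinuity force |D(u_n - f)| to 0 in L^2
    ([optimal_cvg_slope]), so along a subsequence the right-hand side comes arbitrarily
    close to |Df|. Balls with centres in a dense sequence, radii [1 / (l + 1)] and rational
    [L] suffice, which yields a sequence [v_i] of admissible functions with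
    |Df| = sup_i <Df, Dv_i> almost everywhere ([slope_countable_sup]); the statement on the
    essential supremum follows at once.

    Calculus of slopes. Every pointwise property of |Df| is read off from its minimality.
    If [h] is the strong limit of the slopes of an optimal sequence and [g] is a weak limit
    of upper bounds for the slopes of any other Lipschitz approximation of [f], then
    [h^2] has at most the integral of [h * g] ([optimal_relax]). Gluing an approximation
    known only on a ball to an optimal sequence with a Lipschitz cutoff [s] turns this
    into an integral inequality tested against [s]; Lipschitz cutoffs are dense enough
    ([cutoff_dense], [ae_ge0_cutoff]) to make it pointwise ([slope_le_local]). Sublinearity,
    locality and the bound by the Lipschitz constant are three instances.

    Existence of <Df, Dv>. By convexity the quotients (|D(f + e v)|^2 - |Df|^2) / (2 e) are
    nondecreasing in [e], and the parallelogram law bounds the integral of the gap between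
    the quotients at [e] and [- e] by [2 e Ch(v)] ([I_slope_quot_gap]): they converge in L^1
    and the limit lies between them ([grad_prod_squeeze]).

    Duality formula. Let [F_N] be the maximum of 0 and the first [N] functions <Df, Dv_i>,
    and let [gam_N] be weights in [C_bs] below [g] converging to [g] ([C_bs_approx]). An
    induction on [N] splits the weight [gam_N] among the [v_i], by continuous cutoffs, so as
    to realise the integral of [F_N * gam_N] up to any [e] ([run_max_split]); Fatou's lemma
    passes to the limit in [N]. *)

Set Implicit Arguments.
Unset Strict Implicit.
Unset Printing Implicit Defensive.

(** * Integrable and square integrable functions *)

Section L2.
Context d (T : measurableType d) (R : realType).
Variable mu : {measure set T -> \bar R}.
Implicit Types (u v w : T -> R) (us vs : nat -> T -> R).

Local Notation L1 u := (mu.-integrable setT (EFin \o u)).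
Local Notation I u := (Rintegral mu setT u).

Lemma ae_and (P Q : T -> Prop) : {ae mu, forall x, P x} -> {ae mu, forall x, Q x} ->
  {ae mu, forall x, P x /\ Q x}.
Proof. exact: filterI. Qed.

Lemma L1_measurable u : L1 u -> measurable_fun setT u.
Proof. by move=> /measurable_int /measurable_EFinP. Qed.

Lemma L1_lin a b u v : L1 u -> L1 v -> L1 (fun x => a * u x + b * v x).
Proof.
move=> hu hv.
have := integrableD measurableT (integrableZl measurableT a hu)
  (integrableZl measurableT b hv).
by apply: eq_integrable => //= x _.
Qed.

Lemma I_lin a b u v : L1 u -> L1 v ->
  I (fun x => a * u x + b * v x) = a * I u + b * I v.
Proof.
move=> hu hv; rewrite (RintegralD measurableT).
- by congr (_ + _); apply: RintegralZl.
- exact: (integrableZl measurableT a hu).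
- exact: (integrableZl measurableT b hv).
Qed.

Lemma L1D u v : L1 u -> L1 v -> L1 (fun x => u x + v x).
Proof.
move=> hu hv; have := L1_lin 1 1 hu hv.
by apply: eq_integrable => // x _ /=; rewrite !mul1r.
Qed.

Lemma L1B u v : L1 u -> L1 v -> L1 (fun x => u x - v x).
Proof.
move=> hu hv; have := L1_lin 1 (-1) hu hv.
by apply: eq_integrable => // x _ /=; rewrite mul1r mulN1r.
Qed.

Lemma L1Z a u : L1 u -> L1 (fun x => a * u x).
Proof. by move=> hu; exact: (integrableZl measurableT a hu). Qed.

Lemma L1_le u v : measurable_fun setT u -> L1 v -> (forall x, `|u x| <= v x) ->
  L1 u.
Proof.
move=> mu' hv uv; apply: (le_integrable measurableT _ _ hv) => /=.
  exact/measurable_EFinP.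
by move=> x _; rewrite lee_fin (le_trans (uv x))// ler_norm.
Qed.

Lemma L1_norm u : L1 u -> L1 (fun x => `|u x|).
Proof. exact: (@integrable_norm _ _ _ mu setT u). Qed.

Lemma I_ge0_ae u : {ae mu, forall x, 0 <= u x} -> L1 u -> 0 <= I u.
Proof.
move=> u0 hu.
have -> : I u = I (fun x => `|u x|).
  congr fine; apply: ae_eq_integral => //.
  - exact/measurable_EFinP/L1_measurable.
  - exact/measurable_EFinP/L1_measurable/L1_norm.
  - by apply: filterS u0 => x u0 _ /=; rewrite ger0_norm.
by apply: Rintegral_ge0.
Qed.

Lemma I_le_ae u v : L1 u -> L1 v -> {ae mu, forall x, u x <= v x} -> I u <= I v.
Proof.
move=> hu hv uv; rewrite -subr_ge0 -(RintegralB measurableT)//.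
apply: I_ge0_ae; last exact: L1B.
by apply: filterS uv => x; rewrite subr_ge0.
Qed.

Lemma I_eq_ae u v : L1 u -> L1 v -> {ae mu, forall x, u x = v x} -> I u = I v.
Proof.
by move=> hu hv uv; apply/eqP; rewrite eq_le; apply/andP; split; apply: I_le_ae => //;
  apply: filterS uv => x ->.
Qed.

Lemma I_eq0_ae u : L1 u -> (forall x, 0 <= u x) -> I u <= 0 ->
  {ae mu, forall x, u x = 0}.
Proof.
move=> hu u0 Iu.
have mE : measurable_fun setT (EFin \o u) by exact: measurable_int hu.
have : (\int[mu]_x `|(EFin \o u) x| = 0)%E.
  have fu := integrable_fin_num measurableT hu.
  under eq_integral => x _ do rewrite gee0_abs ?lee_fin//.
  apply/eqP; rewrite eq_le; apply/andP; split.
    by rewrite -(fineK fu) lee_fin.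
  by apply: integral_ge0 => x _; rewrite lee_fin.
move/(ae_eq_integral_abs mu measurableT mE).
by apply: filterS => x /(_ Logic.I) /= [].
Qed.

Lemma L1_ae_eq u v : measurable_fun setT v -> {ae mu, forall x, u x = v x} ->
  L1 u -> L1 v.
Proof.
move=> mv uv /integrableP[mE iu]; apply/integrableP; split.
  exact/measurable_EFinP.
rewrite -(@ae_eq_integral _ _ _ mu _ _ (fun x => `|(EFin \o u) x|%E))//.
- exact: measurableT_comp.
- by apply: measurableT_comp => //; exact/measurable_EFinP.
- by apply: filterS uv => x uv _ /=; rewrite uv.
Qed.

Definition square_integrable u := measurable_fun setT u /\ L1 (fun x => u x * u x).
Definition inner u v := I (fun x => u x * v x).
Definition sqnorm u := inner u u.

Local Notation L2 := square_integrable.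
Local Notation ip := inner.
Local Notation nsq := sqnorm.

Lemma L2_mul u v : L2 u -> L2 v -> L1 (fun x => u x * v x).
Proof.
move=> [mu1 iu] [mv iv].
apply: (L1_le _ (L1_lin 1 1 iu iv)); first exact: measurable_funM.
move=> x; rewrite ler_norml; apply/andP; split.
  by rewrite -subr_ge0; have := sqr_ge0 (u x + v x); nra.
by have := sqr_ge0 (u x - v x); nra.
Qed.

Lemma L2_lin a b u v : L2 u -> L2 v -> L2 (fun x => a * u x + b * v x).
Proof.
move=> hu hv; split.
  by apply: measurable_funD; apply: measurable_funM => //; [case: hu|case: hv].
have h1 := L1_lin (a ^+ 2) (2 * a * b) hu.2 (L2_mul hu hv).
have := L1_lin 1 (b ^+ 2) h1 hv.2.
by apply: eq_integrable => // x _ /=; congr (_%:E); ring.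
Qed.

Lemma L2_ext u v : u =1 v -> L2 u -> L2 v.
Proof. by move=> /funext ->. Qed.

Lemma L2D u v : L2 u -> L2 v -> L2 (fun x => u x + v x).
Proof. by move=> hu hv; apply: L2_ext (L2_lin 1 1 hu hv) => x; rewrite !mul1r. Qed.

Lemma L2B u v : L2 u -> L2 v -> L2 (fun x => u x - v x).
Proof. by move=> hu hv; apply: L2_ext (L2_lin 1 (-1) hu hv) => x; ring. Qed.

Lemma L2Z a u : L2 u -> L2 (fun x => a * u x).
Proof. by move=> hu; apply: L2_ext (L2_lin a 0 hu hu) => x; ring. Qed.

Lemma L2_0 : L2 (fun=> 0).
Proof.
split; first exact: measurable_cst.
by have := @integrable0 _ _ R mu setT; apply: eq_integrable => // x _ /=; rewrite mulr0.
Qed.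

Lemma L2_le u v : measurable_fun setT u -> L2 v -> (forall x, `|u x| <= `|v x|) ->
  L2 u.
Proof.
move=> mu1 [mv hv] uv; split => //; apply: (L1_le _ hv); first exact: measurable_funM.
by move=> x; rewrite normrM -[leRHS]ger0_norm ?sqr_ge0// normrM ler_pM.
Qed.

Lemma ipC u v : ip u v = ip v u.
Proof. by congr fine; apply: eq_integral => x _; rewrite mulrC. Qed.

Lemma ip_lin a b u v w : L2 u -> L2 v -> L2 w ->
  ip w (fun x => a * u x + b * v x) = a * ip w u + b * ip w v.
Proof.
move=> hu hv hw; rewrite -I_lin; [|exact: L2_mul..].
by apply: eq_Rintegral => x _; ring.
Qed.

Lemma ipB u v w : L2 u -> L2 v -> L2 w ->
  ip w (fun x => u x - v x) = ip w u - ip w v.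
Proof.
move=> hu hv hw; have := ip_lin 1 (-1) hu hv hw; rewrite mul1r mulN1r => <-.
by congr ip; apply/funext => x; ring.
Qed.

Lemma nsq_lin a b u v : L2 u -> L2 v ->
  nsq (fun x => a * u x + b * v x) =
  a ^+ 2 * nsq u + 2 * a * b * ip u v + b ^+ 2 * nsq v.
Proof.
move=> hu hv; rewrite /sqnorm ip_lin//; last exact: L2_lin.
rewrite (ipC _ u) (ipC _ v) !ip_lin// (ipC v u); ring.
Qed.

Lemma nsqB u v : L2 u -> L2 v ->
  nsq (fun x => u x - v x) = nsq u - 2 * ip u v + nsq v.
Proof.
move=> hu hv; have := nsq_lin 1 (-1) hu hv.
rewrite (_ : (fun x => _) = (fun x => u x - v x)); last by apply/funext => x; ring.
by move=> ->; ring.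
Qed.

Lemma nsqD u v : L2 u -> L2 v ->
  nsq (fun x => u x + v x) = nsq u + 2 * ip u v + nsq v.
Proof.
move=> hu hv; have := nsq_lin 1 1 hu hv.
rewrite (_ : (fun x => _) = (fun x => u x + v x)); last by apply/funext => x; ring.
by move=> ->; ring.
Qed.

Lemma nsqZ a u : L2 u -> nsq (fun x => a * u x) = a ^+ 2 * nsq u.
Proof.
move=> hu; have := nsq_lin a 0 hu hu.
rewrite (_ : (fun x => _) = (fun x => a * u x)); last by apply/funext => x; ring.
by move=> ->; ring.
Qed.

Lemma nsq_ge0 u : 0 <= nsq u.
Proof. by apply: Rintegral_ge0 => x _; rewrite -expr2 sqr_ge0. Qed.

Lemma nsq0 : nsq (fun=> 0) = 0.
Proof.
rewrite /sqnorm /inner /Rintegral; under eq_integral do rewrite mulr0.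
by rewrite integral0.
Qed.

Lemma nsq_eq0 u : L2 u -> nsq u <= 0 -> {ae mu, forall x, u x = 0}.
Proof.
move=> hu h; have := I_eq0_ae hu.2 (fun x => sqr_ge0 _) h.
by apply: filterS => x /eqP; rewrite mulf_eq0 orbb => /eqP.
Qed.

Lemma ip_le_ae w u v : L2 u -> L2 v -> L2 w -> {ae mu, forall x, 0 <= w x} ->
  {ae mu, forall x, u x <= v x} -> ip w u <= ip w v.
Proof.
move=> hu hv hw w0 uv; apply: I_le_ae; [exact: L2_mul..|].
by apply: filterS2 w0 uv => x w0 uv; rewrite ler_wpM2l.
Qed.

Lemma nsq_le u v : L2 u -> L2 v -> {ae mu, forall x, `|u x| <= `|v x|} -> nsq u <= nsq v.
Proof.
move=> hu hv uv; apply: I_le_ae; [exact: hu.2|exact: hv.2|].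
apply: filterS uv => x uv.
by rewrite -[leLHS]ger0_norm ?sqr_ge0// -[leRHS]ger0_norm ?sqr_ge0// !normrM ler_pM.
Qed.

Lemma nsq_ae_eq u v : L2 u -> L2 v -> {ae mu, forall x, u x = v x} -> nsq u = nsq v.
Proof.
by move=> hu hv uv; apply: I_eq_ae; [exact: hu.2|exact: hv.2|apply: filterS uv => x ->].
Qed.

Lemma nsqD_le u v : L2 u -> L2 v -> nsq (fun x => u x + v x) <= 2 * nsq u + 2 * nsq v.
Proof.
by move=> hu hv; rewrite nsqD//; have := nsq_ge0 (fun x => u x - v x); rewrite nsqB//; lra.
Qed.

Lemma cauchy_schwarz u v : L2 u -> L2 v -> ip u v ^+ 2 <= nsq u * nsq v.
Proof.
move=> hu hv.
have h t s : 0 <= t ^+ 2 * nsq u + 2 * t * s * ip u v + s ^+ 2 * nsq v.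
  by rewrite -nsq_lin// nsq_ge0.
have [v0|] := eqVneq (nsq v) 0.
  have [->|n0] := eqVneq (ip u v) 0; first by rewrite v0; lra.
  have := h 1 (- ((nsq u + 1) / (2 * ip u v))); rewrite v0.
  have -> : 2 * 1 * - ((nsq u + 1) / (2 * ip u v)) * ip u v = - (nsq u + 1).
    by field.
  by lra.
move=> vn0; have vp : 0 < nsq v by rewrite lt_def vn0 nsq_ge0.
have := h (nsq v) (- ip u v).
have -> : nsq v ^+ 2 * nsq u + 2 * nsq v * - ip u v * ip u v + (- ip u v) ^+ 2 * nsq v
  = nsq v * (nsq u * nsq v - ip u v ^+ 2) by ring.
by rewrite pmulr_rge0// subr_ge0.
Qed.

Definition cvgL2 (us : nat -> T -> R) u :=
  nsq (fun x => us n x - u x) @[n --> \oo] --> (0 : R).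

Local Notation cvL2 := cvgL2.

Lemma cvL2P us u : cvL2 us u <->
  forall e, 0 < e -> exists N, forall n, (N <= n)%N -> nsq (fun x => us n x - u x) < e.
Proof.
split.
  move=> /cvgrPdist_lt h e /h [N _ hN]; exists N => n /hN /=.
  by rewrite sub0r normrN ger0_norm ?nsq_ge0.
move=> h; apply/cvgrPdist_lt => e /h [N hN]; exists N => // n /= /hN.
by rewrite sub0r normrN ger0_norm ?nsq_ge0.
Qed.

Lemma cvL2_squeeze us u (a : nat -> R) :
  (forall n, nsq (fun x => us n x - u x) <= a n) -> a n @[n --> \oo] --> (0:R) ->
  cvL2 us u.
Proof.
move=> h a0; apply: (squeeze_cvgr _ (cvg_cst 0) a0).
by apply: nearW => n; rewrite nsq_ge0 h.
Qed.

Lemma cvL2_cst u : cvL2 (fun=> u) u.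
Proof.
apply: (@cvL2_squeeze _ _ (fun=> 0)); last exact: cvg_cst.
move=> n; rewrite (_ : (fun x => _) = fun=> 0) ?nsq0//.
by apply/funext => x; rewrite subrr.
Qed.

Lemma cvL2_lin a b us u vs v :
  (forall n, L2 (us n)) -> L2 u -> (forall n, L2 (vs n)) -> L2 v ->
  cvL2 us u -> cvL2 vs v ->
  cvL2 (fun n x => a * us n x + b * vs n x) (fun x => a * u x + b * v x).
Proof.
move=> hus hu hvs hv cu cv.
apply: (@cvL2_squeeze _ _ (fun n => 2 * (a ^+ 2 * nsq (fun x => us n x - u x))
  + 2 * (b ^+ 2 * nsq (fun x => vs n x - v x)))).
  move=> n; have hU := L2B (hus n) hu; have hV := L2B (hvs n) hv.
  rewrite -(nsqZ a hU).
  rewrite -(nsqZ b hV).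
  rewrite (_ : (fun x => _) = fun x => a * (us n x - u x) + b * (vs n x - v x)).
    by apply: nsqD_le; exact: L2Z.
  by apply/funext => x; ring.
rewrite (_ : 0 = 2 * (a ^+ 2 * 0) + 2 * (b ^+ 2 * 0)); last by ring.
by apply: cvgD; do 2 (apply: cvgM; first exact: cvg_cst).
Qed.

Lemma cvL2_mul us u (c : T -> R) (C : R) :
  (forall n, L2 (us n)) -> L2 u -> measurable_fun setT c -> (forall x, `|c x| <= C) ->
  cvL2 us u -> cvL2 (fun n x => c x * us n x) (fun x => c x * u x).
Proof.
move=> hus hu mc hc cu.
have C0 (x : T) : 0 <= C by rewrite (le_trans (normr_ge0 (c x))).

apply: (@cvL2_squeeze _ _ (fun n => C ^+ 2 * nsq (fun x => us n x - u x))).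
  move=> n; have hU := L2B (hus n) hu.
  rewrite -(nsqZ C hU).
  have le x : `|c x * us n x - c x * u x| <= `|C * (us n x - u x)|.
    by rewrite -mulrBr !normrM ler_wpM2r// (ger0_norm (C0 x)).
  apply: nsq_le; last exact: aeW.
  - apply: (L2_le _ (L2Z C hU)) => //.
    by apply: measurable_funB; apply: measurable_funM => //; [case: (hus n)|case: hu].
  - exact: L2Z.
by rewrite -(mulr0 (C ^+ 2)); apply: cvgM; [exact: cvg_cst|].
Qed.

Lemma cvL2_ip us u v : (forall n, L2 (us n)) -> L2 u -> L2 v -> cvL2 us u ->
  ip v (us n) @[n --> \oo] --> ip v u.
Proof.
move=> hus hu hv cu.
have h n : `|ip v (us n) - ip v u| <=
    Num.sqrt (nsq v * nsq (fun x => us n x - u x)).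
  rewrite -ipB// -sqrtr_sqr ler_wsqrtr// cauchy_schwarz//; exact: L2B.
apply/subr_cvg0/norm_cvg0P.
apply: (@squeeze_cvgr _ _ _ _ (fun=> 0) (fun n => Num.sqrt (nsq v * nsq (fun x => us n x - u x)))).
- by apply: nearW => n; rewrite normr_ge0 h.
- exact: cvg_cst.
- rewrite -[X in _ --> X](@sqrtr0 R); apply: continuous_cvg; first exact: sqrt_continuous.
  by rewrite -(mulr0 (nsq v)); apply: cvgM; [exact: cvg_cst|].
Qed.

Lemma cvL2_nsq us u : (forall n, L2 (us n)) -> L2 u -> cvL2 us u ->
  nsq (us n) @[n --> \oo] --> nsq u.
Proof.
move=> hus hu cu.
have -> : (fun n => nsq (us n)) =
  (fun n => nsq (fun x => us n x - u x) + 2 * ip u (us n) - nsq u).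
  by apply/funext => n; rewrite nsqB// (ipC u); ring.
rewrite [X in _ --> X](_ : _ = 0 + 2 * ip u u - nsq u); last by rewrite /sqnorm; ring.
apply: cvgB; last exact: cvg_cst.
by apply: cvgD => //; apply: cvgM; [exact: cvg_cst|exact: cvL2_ip].
Qed.

End L2.

(** * Completeness of L^2 and elements of least norm *)

Section L2complete.
Context d (T : measurableType d) (R : realType).
Variable mu : {measure set T -> \bar R}.
Implicit Types (u v w : T -> R) (us vs : nat -> T -> R).
Local Notation L1 u := (mu.-integrable setT (EFin \o u)).
Local Notation I u := (Rintegral mu setT u).
Local Notation L2 := (square_integrable mu).
Local Notation nsq := (sqnorm mu).
Local Notation ip := (inner mu).
Local Notation cvL2 := (cvgL2 mu).

Lemma EFin_I u : L1 u -> ((I u)%:E = \int[mu]_x (u x)%:E)%E.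
Proof. by move=> hu; rewrite fineK//; exact: integrable_fin_num. Qed.

Lemma L1_of_integral_le u (c : R) : measurable_fun setT u -> (forall x, 0 <= u x) ->
  (\int[mu]_x (u x)%:E <= c%:E)%E -> L1 u /\ I u <= c.
Proof.
move=> mu0 u0 uc.
have hu : L1 u.
  apply/integrableP; split; first exact/measurable_EFinP.
  rewrite (le_lt_trans _ (ltry c))// (le_trans _ uc)//.
  by rewrite (_ : (fun x => `|_|%E) = EFin \o u)//; apply/funext => x /=; rewrite ger0_norm.
by split=> //; rewrite -lee_fin EFin_I.
Qed.

Lemma cvg_EFinr (f : nat -> R) (l : R) : f n @[n --> \oo] --> l ->
  ((f n)%:E @[n --> \oo] --> l%:E)%E.
Proof. by move=> fl; apply/fine_cvgP; split; [exact: nearW|]. Qed.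

(** Monotone convergence: the sum of the series has finite integral, hence is finite almost
    everywhere. The passages to almost everywhere convergent subsequences rest on this. *)
Lemma ae_summable (a : nat -> T -> R) (c : nat -> R) :
  (forall n x, 0 <= a n x) -> (forall n, L1 (a n)) -> (forall n, I (a n) <= c n) ->
  cvgn (series c) -> {ae mu, forall x, cvgn (series (a ^~ x))}.
Proof.
move=> a0 ha ac sc.
have c0 n : 0 <= c n by rewrite (le_trans _ (ac n))//; exact: Rintegral_ge0.
have mS : measurable_fun setT (fun x => \sum_(n <oo) (a n x)%:E)%E.
  apply: ge0_emeasurable_sum => [n x _ _|n _]; first by rewrite lee_fin.
  exact: measurable_int (ha n).
have S0 x : (0 <= \sum_(n <oo) (a n x)%:E)%E.
  by apply: nneseries_ge0 => n _ _; rewrite lee_fin.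
have hS : mu.-integrable setT (fun x => \sum_(n <oo) (a n x)%:E)%E.
  apply/integrableP; split => //.
  under eq_integral => x _ do rewrite gee0_abs//.
  rewrite integral_nneseries//; last 2 first.
  - by move=> n; exact: measurable_int (ha n).
  - by move=> n x _; rewrite lee_fin.
  apply: (@le_lt_trans _ _ (\sum_(n <oo) (c n)%:E)%E).
    apply: lee_nneseries => [n _|n _]; last by rewrite -EFin_I// lee_fin.
    by move=> _; apply: integral_ge0 => x _; rewrite lee_fin.
  rewrite (_ : (\sum_(n <oo) _)%E = (limn (series c))%:E) ?ltry//.
  apply/cvg_lim => //; under eq_fun do rewrite sumEFin.
  exact: cvg_EFinr sc.
have := integrable_ae measurableT hS.
apply: filterS => x /(_ Logic.I) fS.
apply: nondecreasing_is_cvgn.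
  by apply/nondecreasing_seqP => n; rewrite /series/= big_nat_recr//= lerDl.
exists (fine (\sum_(n <oo) (a n x)%:E)%E) => _ [n _ <-].
rewrite -lee_fin fineK// /series /= -sumEFin.
by apply: nneseries_lim_ge => k _; rewrite lee_fin.
Qed.

Lemma ae_cvg0_fast us : (forall n, L2 (us n)) ->
  (forall n, nsq (us n) <= geometric 1 2^-1 n) ->
  {ae mu, forall x, us n x @[n --> \oo] --> (0 : R)}.
Proof.
move=> hus h.
have := @ae_summable (fun n x => us n x * us n x) (geometric 1 2^-1)
  (fun n x => sqr_ge0 _) (fun n => (hus n).2) h.
have h12 : `|2^-1 : R| < 1 by rewrite ger0_norm; lra.
move=> /(_ (is_cvg_geometric_series h12)).
apply: filterS => x /cvg_series_cvg_0 s0.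
apply/norm_cvg0P.
rewrite (_ : (fun n => _) = fun n => Num.sqrt (us n x * us n x)); last first.
  by apply/funext => n; rewrite -expr2 sqrtr_sqr.
rewrite -[X in _ --> X](@sqrtr0 R); apply: continuous_cvg => //.
exact: sqrt_continuous.
Qed.

Lemma ae_cvg_fast us : (forall n, L2 (us n)) ->
  (forall n, nsq (fun x => us n.+1 x - us n x) <= geometric 1 4^-1 n) ->
  {ae mu, forall x, cvgn (us ^~ x)}.
Proof.
move=> hus h.
(* The squared increments are summable even after multiplication by [2 ^+ n], and
   [2 |D| <= 2 ^- n + 2 ^+ n * D ^+ 2] makes the increments themselves summable. *)
have hD n : L2 (fun x => us n.+1 x - us n x) by exact: L2B.
have h12 : `|2^-1 : R| < 1 by rewrite ger0_norm; lra.
have sg : cvgn (series (geometric 1 (2^-1 : R))) by exact: is_cvg_geometric_series.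
have := @ae_summable
  (fun n x => 2 ^+ n * ((us n.+1 x - us n x) * (us n.+1 x - us n x)))
  (geometric 1 2^-1) _ _ _ sg.
have p2 n : 0 < (2 : R) ^+ n by rewrite exprn_gt0.
case=> [n x|n|n|N [mN N0 hN]].
- by rewrite mulr_ge0 ?sqr_ge0// ltW.
- by apply: L1Z; exact: (hD n).2.
- rewrite (@RintegralZl _ _ _ mu _ _ _ measurableT (hD n).2).
  rewrite (le_trans (ler_wpM2l (ltW (p2 n)) (h n)))//= !mul1r.
  have -> : (4^-1 : R) = 2^-1 * 2^-1 by lra.
  by rewrite exprMn mulrA -exprMn mulfV// expr1n mul1r.
exists N; split => //; apply: subset_trans hN; apply: subsetC => x /= sx.
have sD : cvgn (series (fun n => us n.+1 x - us n x)).
  apply: normed_cvg.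
  have sb : cvgn (series (fun n => geometric 1 2^-1 n
     + 2 ^+ n * ((us n.+1 x - us n x) * (us n.+1 x - us n x)))).
    by apply: is_cvg_seriesD.
  apply: (series_le_cvg _ _ _ sb) => n /=; first exact: normr_ge0.
    by apply: addr_ge0; rewrite mulr_ge0 ?sqr_ge0 ?exprn_ge0.
  rewrite mul1r exprVn.
  set p := 2 ^+ n; set D := us n.+1 x - us n x.
  have pp : 0 < p by exact: p2.
  have -> : D * D = `|D| * `|D| by rewrite -normrM ger0_norm ?sqr_ge0.
  have -> : p^-1 + p * (`|D| * `|D|) = p^-1 * (1 + (p * `|D|) ^+ 2).
    by field; rewrite gt_eqF.
  rewrite -(ler_pM2l pp) mulrA mulfV ?gt_eqF// mul1r.
  have := sqr_ge0 (p * `|D| - 1); have : 0 <= p * `|D| by rewrite mulr_ge0// ltW.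
  nra.
have -> : us ^~ x = (fun n => us 0 x + series (fun n => us n.+1 x - us n x) n).
  by apply/funext => n; rewrite /series/= telescope_sumr// addrC subrK.
by apply: is_cvgD => //; exact: is_cvg_cst.
Qed.

Lemma limn_einf_le (f : nat -> \bar R) (c : \bar R) :
  (\forall n \near \oo, (f n <= c)%E) -> (limn_einf f <= c)%E.
Proof.
move=> fc; rewrite limn_einf_lim; apply: lime_le; first exact: is_cvg_einfs.
apply: filterS fc => n fn; apply: ereal_inf_le.
by exists (f n) => //; exists n => /=.
Qed.

Lemma measurable_limn_einf (F : nat -> T -> \bar R) :
  (forall n, measurable_fun setT (F n)) ->
  measurable_fun setT (fun x => limn_einf (F^~ x)).
Proof.
move=> mF; apply: measurableT_comp => //.
by apply: measurable_fun_limn_esup => n; exact: measurableT_comp.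
Qed.

Lemma limn_einf_ge0 (f : nat -> \bar R) :
  (forall n, 0 <= f n)%E -> (0 <= limn_einf f)%E.
Proof.
move=> f0; rewrite limn_einf_lim; apply: lime_ge; first exact: is_cvg_einfs.
by apply: nearW => n; apply: le_ereal_inf_tmp => _ [k _ <-].
Qed.

(** Riesz-Fischer: a subsequence with summable increments converges almost everywhere, and
    Fatou's lemma carries the Cauchy estimate over to the limit. *)
Lemma L2_complete us : (forall n, L2 (us n)) ->
  (forall e, 0 < e -> exists N, forall n k, (N <= n)%N -> (N <= k)%N ->
     nsq (fun x => us n x - us k x) < e) ->
  exists2 u, L2 u & cvL2 us u.
Proof.
move=> hus cus.
have g0 n : 0 < geometric 1 (4^-1 : R) n.
  by rewrite /= mul1r exprn_gt0// invr_gt0.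
have [M hM] := choice (fun n => cus _ (g0 n)).
(* [M n <= phi n] gives fast increments, [n <= phi n] a subsequence. *)
pose phi := fix phi n := if n is k.+1 then maxn (phi k) (maxn (M k.+1) k.+1) else M 0%N.
have phiM n : (M n <= phi n)%N.
  by case: n => //= n; rewrite !leq_max leqnn orbT.
have phin n : (n <= phi n)%N by case: n => //= n; rewrite !leq_max leqnn !orbT.
have phiS n : (phi n <= phi n.+1)%N by rewrite /= leq_max leqnn.
pose v n := us (phi n).
have hv n : L2 (v n) by exact: hus.
have cv : {ae mu, forall x, cvgn (v ^~ x)}.
  apply: ae_cvg_fast => // n; apply/ltW/hM; last exact: phiM.
  exact: leq_trans (phiM n) (phiS n).
(* The lower limit is measurable everywhere and is the limit wherever that exists. *)
pose u x := fine (limn_einf (fun n => (v n x)%:E)).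
have mue : measurable_fun setT u.
  apply: measurableT_comp => //; apply: measurable_limn_einf => n.
  by apply/measurable_EFinP; case: (hv n).
have vu : {ae mu, forall x, v n x @[n --> \oo] --> u x}.
  apply: filterS cv => x cv.
  have : (v n x)%:E @[n --> \oo] --> (limn (v ^~ x))%:E by exact: cvg_EFinr cv.
  by move=> /cvg_limn_einf_sup [h _]; rewrite /u h.
have key n e : (forall k, (n <= k)%N -> nsq (fun x => us n x - us k x) <= e) ->
    L1 (fun x => (us n x - u x) * (us n x - u x)) /\
    nsq (fun x => us n x - u x) <= e.
  move=> hn; apply: L1_of_integral_le => //.
  - by apply: measurable_funM; apply: measurable_funB => //; case: (hus n).
  - by move=> x; exact: sqr_ge0.
  pose F k x := ((us n x - v k x) * (us n x - v k x))%:E.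
  have mF k : measurable_fun setT (F k).
    apply/measurable_EFinP.
    by apply: measurable_funM; apply: measurable_funB => //; [case: (hus n)|case: (hv k)..|case: (hus n)|case: (hv k)].
  have F0 k x : (0 <= F k x)%E by rewrite lee_fin sqr_ge0.
  apply: (@le_trans _ _ (\int[mu]_x limn_einf (F^~ x))%E).
    apply: ae_ge0_le_integral => //.
    - by move=> x _; rewrite lee_fin sqr_ge0.
    - apply/measurable_EFinP.
      by apply: measurable_funM; apply: measurable_funB => //; case: (hus n).
    - by move=> x _; apply: limn_einf_ge0.
    - exact: measurable_limn_einf.
    apply: filterS vu => x vu _.
    suff /cvg_limn_einf_sup [-> _] : F k x @[k --> \oo] --> ((us n x - u x) * (us n x - u x))%:E by [].
    apply: cvg_EFinr.
    by apply: cvgM; apply: cvgB => //; exact: cvg_cst.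
  apply: (le_trans (fatou mu measurableT mF (fun k x _ => F0 k x))).
  apply: limn_einf_le; exists n => // k /= nk.
  rewrite -EFin_I ?lee_fin; first by apply: hn; exact: leq_trans nk (phin k).
  exact: (L2B (hus n) (hv k)).2.
have hu : L2 u.
  have [N hN] := cus 1 ltr01.
  have [h _] := key N 1 (fun k Nk => ltW (hN _ _ (leqnn N) Nk)).
  have hB : L2 (fun x => us N x - u x).
    by split => //; apply: measurable_funB => //; case: (hus N).
  by apply: (L2_ext _ (L2B (hus N) hB)) => x; ring.
exists u => //; apply/cvL2P => e e0.
have [N hN] := cus (e / 2) ltac:(lra); exists N => n Nn.
have [_] := key n (e / 2) (fun k nk => ltW (hN _ _ Nn (leq_trans Nn nk))).
lra.
Qed.

Lemma cvL2_ae_subseq us u : (forall n, L2 (us n)) -> L2 u -> cvL2 us u ->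
  exists phi : nat -> nat, {ae mu, forall x, us (phi n) x @[n --> \oo] --> u x}.
Proof.
move=> hus hu /cvL2P cu.
have g0 n : 0 < geometric 1 (2^-1 : R) n.
  by rewrite /= mul1r exprn_gt0// invr_gt0.
have [phi hphi] := choice (fun n => cu _ (g0 n)).
exists phi.
have := @ae_cvg0_fast (fun n x => us (phi n) x - u x) (fun n => L2B (hus _) hu)
  (fun n => ltW (hphi n _ (leqnn _))).
by apply: filterS => x /subr_cvg0.
Qed.

Lemma nsq_midpoint u v : L2 u -> L2 v ->
  nsq (fun x => u x - v x) =
  2 * nsq u + 2 * nsq v - 4 * nsq (fun x => 2^-1 * u x + 2^-1 * v x).
Proof.
move=> hu hv; rewrite nsqB// nsq_lin//.
by field.
Qed.

(** The parallelogram law makes a sequence Cauchy as soon as its norms and the norms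
    of its midpoints approach the same value. *)
Lemma minimizing_cvL2 us (D : R) : (forall n, L2 (us n)) ->
  (forall e, 0 < e -> exists N, forall n, (N <= n)%N -> nsq (us n) < D + e) ->
  (forall e, 0 < e -> exists N, forall n k, (N <= n)%N -> (N <= k)%N ->
    D - e < nsq (fun x => 2^-1 * us n x + 2^-1 * us k x)) ->
  exists u, [/\ L2 u, cvL2 us u & nsq u = D].
Proof.
move=> hus up low.
have [|u hu cu] := L2_complete hus.
  move=> e e0; have [N1 h1] := up (e / 8) ltac:(lra).
  have [N2 h2] := low (e / 8) ltac:(lra).
  exists (maxn N1 N2) => n k; rewrite !geq_max => /andP[n1 n2] /andP[k1 k2].
  rewrite nsq_midpoint//; have := h1 n n1; have := h1 k k1; have := h2 _ _ n2 k2.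
  lra.
exists u; split => //.
apply: cvg_unique (cvL2_nsq hus hu cu) _ => //.
apply/cvgrPdist_lt => e e0.
have [N1 h1] := up e e0; have [N2 h2] := low e e0.
exists (maxn N1 N2) => // n /=; rewrite geq_max => /andP[n1 n2].
have := h1 n n1; have := h2 n n n2 n2.
rewrite (_ : (fun x => _) = us n); last by apply/funext => x; lra.
by rewrite ltr_norml => *; apply/andP; split; lra.
Qed.

(** The projection of 0 onto the closure of a convex set, obtained as the limit of a
    minimizing sequence; the last inequality is its variational characterisation. *)
Lemma min_norm (C : set (T -> R)) : C !=set0 -> (forall u, C u -> L2 u) ->
  (forall u v t, C u -> C v -> 0 <= t <= 1 -> C (fun x => (1 - t) * u x + t * v x)) ->
  exists p, [/\ L2 p, (exists2 ps, (forall n, C (ps n)) & cvL2 ps p) &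
    forall g, C g -> nsq p <= ip p g].
Proof.
move=> [c0 Cc0] CL2 cvx.
pose D := inf [set nsq u | u in C].
have hD : has_inf [set nsq u | u in C].
  by split; [exists (nsq c0), c0|exists 0 => _ [u _ <-]; exact: nsq_ge0].
have lb u : C u -> D <= nsq u by move=> Cu; apply: (ge_inf hD.2); exists u.
have ex n : exists u, C u /\ nsq u < D + n.+1%:R^-1.
  have [_ [u Cu <-] h] := inf_adherent (ltac:(by rewrite invr_gt0) : 0 < n.+1%:R^-1 :> R) hD.
  by exists u.
have [us hus] := choice ex.
have CL n : L2 (us n) by apply: CL2; case: (hus n).
have [|e e0|p [hp cp np]] := @minimizing_cvL2 us D CL.
- move=> e e0; have [N _ hN] := near_infty_natSinv_lt (PosNum e0).
  by exists N => n Nn; apply: lt_trans (hus n).2 _; rewrite ltrD2l; exact: hN.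
- exists 0%N => n k _ _; rewrite ltrBlDr (le_lt_trans (lb (fun x => 2^-1 * us n x + 2^-1 * us k x) _)) ?ltrDl//.
  have := cvx _ _ 2^-1 (hus n).1 (hus k).1; rewrite (_ : 1 - 2^-1 = 2^-1 :> R); last lra.
  by apply; apply/andP; split; lra.
exists p; split => //; first by exists us => // n; case: (hus n).
move=> g Cg; have hg := CL2 _ Cg.
(* The segment from [p] to [g] lies in the closure of [C]; the case of small [t] gives the claim. *)
have q t : 0 < t -> t <= 1 -> 0 <= 2 * (1 - t) * ip p g + t * nsq g - (2 - t) * nsq p.
  move=> t0 t1.
  have lim := cvL2_lin (1 - t) t CL hp (fun=> hg) hg cp (@cvL2_cst _ _ _ mu g).
  have cvn := cvL2_nsq (fun n => L2_lin (1 - t) t (CL n) hg) (L2_lin (1 - t) t hp hg) lim.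
  have : D <= nsq (fun x => (1 - t) * p x + t * g x).
    rewrite -(cvg_lim _ cvn)//; apply: limr_ge; first exact: cvgP cvn.
    by apply: nearW => n; apply/lb/cvx; [case: (hus n)| |rewrite ltW].
  rewrite nsq_lin// -np => h.
  rewrite -(pmulr_rge0 _ t0); nra.
rewrite leNgt; apply/negP => lt.
have g0 := nsq_ge0 mu g; have p0 := nsq_ge0 mu p.
pose a := nsq p - ip p g; have a0 : 0 < a by rewrite subr_gt0.
pose t := Num.min 1 (a / (nsq g + nsq p + 2 * `|ip p g| + 1)).
have den : 0 < nsq g + nsq p + 2 * `|ip p g| + 1 by have := normr_ge0 (ip p g); lra.
have t0 : 0 < t by rewrite lt_min ltr01 divr_gt0.
have t1 : t <= 1 by rewrite ge_min lexx.
have ta : t * (nsq g + nsq p + 2 * `|ip p g| + 1) <= a.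
  by rewrite -ler_pdivlMr// ge_min lexx orbT.
have := q t t0 t1; rewrite -/a.
have : - `|ip p g| <= ip p g by rewrite lerNl -normrN ler_norm.
rewrite /a in ta a0; nra.
Qed.

End L2complete.

(** * Asymptotic Lipschitz constants *)

Section lipschitz.
Context {R : realType} {X : completeMetricType R}.
Implicit Types (u v w : X -> R) (x y z : X).

Local Notation dist := (@mdist R X).

Lemma ballE x (r : R) y : ball x r y = (dist x y < r) :> Prop.
Proof. by rewrite ballEmdist. Qed.

Definition lip_on u (A : set X) (c : R) :=
  forall y z, A y -> A z -> `|u y - u z| <= c * dist y z.

Lemma lip_const_le u (A : set X) c : 0 <= c -> lip_on u A c ->
  (lip_const u A <= c%:E)%E.
Proof.
move=> c0 uc; apply: ge_ereal_sup => _ [[y z] /= [Ay Az] <-].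
rewrite lee_fin; have [->|yz] := eqVneq y z; first by rewrite mdistxx invr0 mulr0.
by rewrite ler_pdivrMr ?mdist_gt0// uc.
Qed.

Lemma lip_on_const u (A : set X) c : (lip_const u A <= c%:E)%E -> lip_on u A c.
Proof.
move=> uc y z Ay Az; have [->|yz] := eqVneq y z.
  by rewrite mdistxx subrr normr0 mulr0.
rewrite -ler_pdivrMr ?mdist_gt0// -lee_fin; apply: le_trans uc.
by apply: ereal_sup_ubound; exists (y, z).
Qed.

Lemma lip_const_mono u (A B : set X) : A `<=` B -> (lip_const u A <= lip_const u B)%E.
Proof.
move=> AB; apply: ge_ereal_sup => _ [p [A1 A2] <-].
by apply: ereal_sup_ubound; exists p => //; split; exact: AB.
Qed.

(** The Lipschitz constant on [ball x r] is nondecreasing in [r], so that the limit exists and is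
    the infimum. *)
Lemma lip_aE u x :
  lip_a u x = ereal_inf [set lip_const u (ball x r) | r in `]0%R, +oo[%classic].
Proof.
apply/cvg_lim => //.
apply: (nondecreasing_at_right_cvge (BInfty R false)) => //= r s r0 s0 rs.
by apply/lip_const_mono/le_ball.
Qed.

Lemma lip_a_lt u x c : (lip_a u x < c%:E)%E ->
  exists r, 0 < r /\ lip_on u (ball x r) c.
Proof.
rewrite lip_aE => /ereal_inf_lt [_ [r r0 <-] h]; exists r.
by split; [move: r0; rewrite /= in_itv/= andbT|exact/lip_on_const/ltW].
Qed.

Lemma lip_a_le u x c r : 0 < r -> 0 <= c -> lip_on u (ball x r) c ->
  (lip_a u x <= c%:E)%E.
Proof.
move=> r0 c0 h; rewrite lip_aE; apply: (@le_trans _ _ (lip_const u (ball x r))).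
  by apply: ereal_inf_lbound; exists r => //=; rewrite in_itv/= r0.
exact: lip_const_le.
Qed.

Lemma lip_a_ge0 u x : (0 <= lip_a u x)%E.
Proof.
rewrite lip_aE; apply: le_ereal_inf_tmp => _ [r /= r0 <-].
have {}r0 : 0 < r by move: r0; rewrite in_itv/= andbT.
apply: ereal_sup_ubound; exists (x, x) => /=; first by split; exact: ballxx.
by rewrite subrr normr0 mul0r.
Qed.

Definition lipf u := exists k, k_lipschitz k u.

(** [lip_a] is finite on Lipschitz functions ([alipE]); the real-valued version lives in L^2. *)
Definition alip u x : R := fine (lip_a u x).

Lemma k_lipschitzW (k k' : R) u : k <= k' -> k_lipschitz k u -> k_lipschitz k' u.
Proof. by move=> kk h x y; rewrite (le_trans (h x y))// ler_wpM2r ?mdist_ge0. Qed.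

Lemma lipf_pos u : lipf u -> exists2 k, 0 < k & k_lipschitz k u.
Proof.
move=> [k h]; exists (Num.max k 1); first by rewrite lt_max ltr01 orbT.
by apply: k_lipschitzW h; rewrite le_max lexx.
Qed.

Lemma alip_ge0 u x : 0 <= alip u x.
Proof. by apply: fine_ge0; exact: lip_a_ge0. Qed.

Lemma alipE u x : lipf u -> ((alip u x)%:E = lip_a u x)%E.
Proof.
move=> /lipf_pos[k k0 h]; rewrite fineK// ge0_fin_numE ?lip_a_ge0//.
apply: (@le_lt_trans _ _ k%:E); last exact: ltry.
by apply: (@lip_a_le _ _ _ 1) => //; exact: ltW.
Qed.

Lemma alip_lt u x c : lipf u -> alip u x < c -> exists r, 0 < r /\ lip_on u (ball x r) c.
Proof. by move=> hu h; apply: lip_a_lt; rewrite -alipE// lte_fin. Qed.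

Lemma alip_le u x c r : lipf u -> 0 < r -> 0 <= c -> lip_on u (ball x r) c -> alip u x <= c.
Proof. by move=> hu r0 c0 h; rewrite -lee_fin alipE//; exact: lip_a_le h. Qed.

Lemma alip_le_k u (k : R) : 0 <= k -> k_lipschitz k u -> forall x, alip u x <= k.
Proof.
move=> k0 h x; by apply: (@alip_le _ _ _ 1) => //; exists k.
Qed.

Lemma alip_eq_on u v x r : lipf u -> lipf v -> 0 < r ->
  (forall y, ball x r y -> u y = v y) -> alip u x <= alip v x.
Proof.
move=> hu hv r0 uv; apply/ler_addgt0Pr => e e0.
have [s [s0 hs]] := @alip_lt v x (alip v x + e) hv ltac:(by rewrite ltrDl).
apply: (@alip_le _ _ _ (Num.min r s)) => //; first by rewrite lt_min r0.
  by rewrite addr_ge0 ?alip_ge0// ltW.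
move=> y z; rewrite !ballE !lt_min => /andP[yr ys] /andP[zr zs].
by rewrite !uv ?ballE//; apply: hs; rewrite ballE.
Qed.

Lemma k_lipschitz_lin a b u v (k l : R) : k_lipschitz k u -> k_lipschitz l v ->
  k_lipschitz (`|a| * k + `|b| * l) (fun x => a * u x + b * v x).
Proof.
move=> hu hv y z.
have -> : a * u y + b * v y - (a * u z + b * v z) = a * (u y - u z) + b * (v y - v z).
  by ring.
rewrite (le_trans (ler_normD _ _))// !normrM mulrDl -!mulrA.
by apply: lerD; apply: ler_wpM2l.
Qed.

Lemma lipf_lin a b u v : lipf u -> lipf v -> lipf (fun x => a * u x + b * v x).
Proof. by move=> [k hu] [l hv]; eexists; exact: k_lipschitz_lin hu hv. Qed.

Lemma alip_lin a b u v x : lipf u -> lipf v ->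
  alip (fun x => a * u x + b * v x) x <= `|a| * alip u x + `|b| * alip v x.
Proof.
move=> hu hv; apply/ler_addgt0Pr => e e0.
pose e' := e / (`|a| + `|b| + 1).
have ab : 0 < `|a| + `|b| + 1 by rewrite ltr_wpDl// addr_ge0.
have e'0 : 0 < e' by rewrite divr_gt0.
have [r [r0 hr]] := @alip_lt u x (alip u x + e') hu ltac:(by rewrite ltrDl).
have [s [s0 hs]] := @alip_lt v x (alip v x + e') hv ltac:(by rewrite ltrDl).
have le : `|a| * (alip u x + e') + `|b| * (alip v x + e') <= `|a| * alip u x + `|b| * alip v x + e.
  have : e' * (`|a| + `|b| + 1) = e by rewrite mulfVK// gt_eqF.
  by nra.
apply: le_trans le; apply: (@alip_le _ _ _ (Num.min r s)).
- exact: lipf_lin.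
- by rewrite lt_min r0.
- by rewrite addr_ge0// mulr_ge0// addr_ge0 ?alip_ge0// ltW.
move=> y z; rewrite !ballE !lt_min => /andP[yr ys] /andP[zr zs].
have -> : a * u y + b * v y - (a * u z + b * v z) = a * (u y - u z) + b * (v y - v z).
  by ring.
rewrite (le_trans (ler_normD _ _))// !normrM mulrDl -!mulrA.
by apply: lerD; apply: ler_wpM2l => //; [apply: hr|apply: hs]; rewrite ballE.
Qed.

Lemma lip_b_lipf u : lip_b u -> lipf u. Proof. by case. Qed.

Lemma bounded_fun_normP u : bounded_fun u <-> exists M, forall x, `|u x| <= M.
Proof.
split.
  move=> [M [_ hM]]; exists (M + 1) => x; apply: (hM (M + 1)) => //.
  by rewrite ltrDl.
move=> [M hM]; exists M; split; first exact: num_real.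
by move=> N MN x _ /=; rewrite (le_trans (hM x))// ltW.
Qed.

Lemma lip_b_lin a b u v : lip_b u -> lip_b v -> lip_b (fun x => a * u x + b * v x).
Proof.
move=> [/bounded_fun_normP[M hM] hu] [/bounded_fun_normP[N hN] hv]; split; last exact: lipf_lin.
apply/bounded_fun_normP; exists (`|a| * M + `|b| * N) => x.
by rewrite (le_trans (ler_normD _ _))// !normrM lerD// ler_wpM2l.
Qed.

Lemma lip_b0 : lip_b ((fun=> 0) : X -> R).
Proof.
split; first by apply/bounded_fun_normP; exists 0 => x; rewrite normr0.
by exists 0 => x y; rewrite subrr normr0 mul0r.
Qed.

Lemma lip_b_cut (s : X -> R) (L : R) u v : k_lipschitz L s ->
  (forall x, 0 <= s x <= 1) -> lip_b u -> lip_b v ->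
  lip_b (fun x => s x * v x + (1 - s x) * u x).
Proof.
move=> hs s01 [/bounded_fun_normP[M hM] /lipf_pos[k k0 hu]] [/bounded_fun_normP[N hN] /lipf_pos[l l0 hv]].
have sn x : `|s x| <= 1 by rewrite ger0_norm; case/andP: (s01 x).
have sn' x : `|1 - s x| <= 1.
  by case/andP: (s01 x) => *; rewrite ger0_norm; lra.
have M0 x : 0 <= M by rewrite (le_trans _ (hM x)).
have N0 x : 0 <= N by rewrite (le_trans _ (hN x)).
split.
  apply/bounded_fun_normP; exists (N + M) => x.
  rewrite (le_trans (ler_normD _ _))// !normrM; apply: lerD.
    by rewrite -[N]mul1r ler_pM.
  by rewrite -[M]mul1r ler_pM.
exists (l + k + L * (N + M)) => y z.
have -> : s y * v y + (1 - s y) * u y - (s z * v z + (1 - s z) * u z) =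
  s y * (v y - v z) + (1 - s y) * (u y - u z) + (s y - s z) * (v z - u z) by ring.
rewrite (le_trans (ler_normD _ _))// (le_trans (lerD (ler_normD _ _) (lexx _)))//.
rewrite !normrM !mulrDl; apply: lerD; first apply: lerD.
- by rewrite -[leRHS]mul1r ler_pM.
- by rewrite -[leRHS]mul1r ler_pM.
- rewrite -mulrA [_ * dist _ _]mulrC mulrA; apply: ler_pM => //.
  by rewrite (le_trans (ler_normB _ _))// lerD.
Qed.

(** Gluing [v] into [u] along a cutoff [s]. The increment of the glued function splits as
    [s y * (v y - v z) + (1 - s y) * (u y - u z) + (s y - s z) * (v z - u z)]; the margin between
    [r'] and [r] makes the last term vanish near every point outside the open ball. *)
Lemma alip_cut (s : X -> R) (L : R) u v x0 r r' : k_lipschitz L s ->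
  (forall x, 0 <= s x <= 1) -> 0 <= L -> lip_b u -> lip_b v -> r' < r ->
  (forall x, r' <= dist x0 x -> s x = 0) -> forall x,
  alip (fun x => s x * v x + (1 - s x) * u x) x <=
  s x * alip v x + (1 - s x) * alip u x + L * (\1_(ball x0 r) x * `|v x - u x|).
Proof.
move=> hs s01 L0 hu hv rr s0 x.
have hw := lip_b_cut hs s01 hu hv.
have fu := lip_b_lipf hu; have fv := lip_b_lipf hv; have fw := lip_b_lipf hw.
have [k k0 ku] := lipf_pos fu; have [l l0 kv] := lipf_pos fv.
have /andP[sx0 sx1] := s01 x.
have [xB|xB] := pselect (ball x0 r x); last first.
  rewrite indicE memNset// mul0r mulr0 addr0.
  have xr : r <= dist x0 x by rewrite leNgt; apply/negP => h; apply: xB; rewrite ballE.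
  have near0 y : ball x (r - r') y -> s y = 0.
    rewrite ballE => xy; apply: s0.
    by have := metric_triangle x0 y x; rewrite (metric_sym y x); lra.
  rewrite s0; last lra.
  rewrite mul0r add0r subr0 mul1r; apply: (@alip_eq_on _ _ _ (r - r')) => //; first lra.
  by move=> y /near0 ->; rewrite mul0r add0r subr0 mul1r.
rewrite indicE mem_set// mul1r; apply/ler_addgt0Pr => e e0.
have [a [a0 ha]] := @alip_lt u x (alip u x + e / 2) fu ltac:(lra).
have [b [b0 hb]] := @alip_lt v x (alip v x + e / 2) fv ltac:(lra).
have lu := alip_ge0 u x; have lv := alip_ge0 v x.
set cu := alip u x + e / 2 in ha; set cv := alip v x + e / 2 in hb.
pose Q := L * (cu + cv + k + l) + 1.
have Q0 : 0 < Q.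
  by rewrite /Q ltr_pwDr// mulr_ge0// !addr_ge0 ?(ltW k0) ?(ltW l0)//; lra.
(* [Q * t] bounds the oscillation on [ball x t] of the three coefficients of the splitting. *)
pose t := Num.min (Num.min a b) (e / (2 * Q)).
have t0 : 0 < t by rewrite !lt_min a0 b0 divr_gt0// mulr_gt0.
have tQ : t * Q <= e / 2.
  have -> : e / 2 = e / (2 * Q) * Q by field; rewrite gt_eqF.
  by rewrite ler_wpM2r ?(ltW Q0)// ge_min lexx orbT.
apply: (@alip_le _ _ _ t) => //.
  rewrite addr_ge0 ?(ltW e0)// !addr_ge0 ?mulr_ge0 ?alip_ge0//; lra.
move=> y z; rewrite !ballE => yt zt.
have ya : dist x y < a by rewrite (lt_le_trans yt)// !ge_min lexx.
have za : dist x z < a by rewrite (lt_le_trans zt)// !ge_min lexx.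
have yb : dist x y < b by rewrite (lt_le_trans yt)// !ge_min lexx orbT.
have zb : dist x z < b by rewrite (lt_le_trans zt)// !ge_min lexx orbT.
have h1 : `|u y - u z| <= cu * dist y z by apply: ha; rewrite ballE.
have h2 : `|v y - v z| <= cv * dist y z by apply: hb; rewrite ballE.
have d0 : 0 <= dist y z by exact: mdist_ge0.
have -> : s y * v y + (1 - s y) * u y - (s z * v z + (1 - s z) * u z) =
  s y * (v y - v z) + (1 - s y) * (u y - u z) + (s y - s z) * (v z - u z) by ring.
have /andP[sy0 sy1] := s01 y.
rewrite (le_trans (ler_normD _ _))// (le_trans (lerD (ler_normD _ _) (lexx _)))//.
rewrite !normrM (ger0_norm sy0) (@ger0_norm _ (1 - s y)); last lra.
have sxy : `|s y - s x| <= L * t.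
  rewrite (le_trans (hs _ _))// ler_wpM2l// metric_sym; exact: ltW.
have vux : `|v z - u z| <= `|v x - u x| + (k + l) * t.
  have -> : v z - u z = (v x - u x) + ((v z - v x) + (u x - u z)) by ring.
  rewrite (le_trans (ler_normD _ _))// lerD2l (le_trans (ler_normD _ _))//.
  rewrite addrC mulrDl; apply: lerD.
    by rewrite (le_trans (ku _ _))// ler_wpM2l ?(ltW k0)// ltW.
  by rewrite (le_trans (kv _ _))// ler_wpM2l ?(ltW l0)// metric_sym ltW.
have [sxy1 sxy2] : s y <= s x + L * t /\ s x <= s y + L * t.
  by move: sxy; rewrite ler_norml => /andP[]; lra.
apply: (@le_trans _ _ ((s y * cv + (1 - s y) * cu + L * `|v z - u z|) * dist y z)).
  have -> : (s y * cv + (1 - s y) * cu + L * `|v z - u z|) * dist y z =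
    s y * (cv * dist y z) + (1 - s y) * (cu * dist y z) + L * dist y z * `|v z - u z|.
    by ring.
  apply: lerD; first apply: lerD.
  - exact: ler_wpM2l.
  - by apply: ler_wpM2l => //; lra.
  - exact: ler_wpM2r.
apply: ler_wpM2r => //.
have Lvu : L * `|v z - u z| <= L * `|v x - u x| + L * ((k + l) * t).
  by rewrite -mulrDr ler_wpM2l.
have c1 : s y * cv <= s x * cv + L * t * cv.
  by rewrite -mulrDl ler_wpM2r//; rewrite /cv; lra.
have c2 : (1 - s y) * cu <= (1 - s x) * cu + L * t * cu.
  by rewrite -mulrDl ler_wpM2r//; rewrite /cu; lra.
have -> : s x * alip v x + (1 - s x) * alip u x = s x * cv + (1 - s x) * cu - e / 2.
  by rewrite /cu /cv; ring.
have : L * t * cv + L * t * cu + L * ((k + l) * t) <= e / 2.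
  apply: le_trans tQ; rewrite /Q.
  have : t * (L * (cu + cv + k + l) + 1) = L * t * cv + L * t * cu + L * ((k + l) * t) + t by ring.
  by move=> ->; lra.
lra.
Qed.

Lemma lsc_measurable u : (forall c, open [set x | c < u x]) ->
  measurable_fun setT (u : borel X -> R).
Proof.
move=> h; apply: (measurability _ (RGenOInfty.measurableE R)) => _ /= [_ [c ->] <-].
apply: sub_sigma_algebra; rewrite setTI.
rewrite (_ : _ @^-1` _ = [set x | c < u x]); first exact: h.
by apply/seteqP; split => x /=; rewrite in_itv/= andbT.
Qed.

Lemma continuous_measurable u : continuous u -> measurable_fun setT (u : borel X -> R).
Proof.
move=> cu; apply: lsc_measurable => c.
by move/continuousP: cu => /(_ _ (@open_gt R c)).
Qed.

Lemma openP (A : set X) : (forall x, A x -> exists r, 0 < r /\ ball x r `<=` A) -> open A.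
Proof.
rewrite openE => h x /h [r [r0 rA]].
by apply/nbhs_ballP; exists r.
Qed.

Lemma lipf_continuous u : lipf u -> continuous u.
Proof.
move=> /lipf_pos[k k0 h] x; apply/cvgrPdist_lt => e e0.
apply/nbhs_ballP; exists (e / k); first exact: divr_gt0.
move=> y; rewrite ballE => xy; rewrite (le_lt_trans (h _ _))//.
by rewrite mulrC -ltr_pdivlMr.
Qed.

Lemma measurable_lipf u : lipf u -> measurable_fun setT (u : borel X -> R).
Proof. by move=> /lipf_continuous; exact: continuous_measurable. Qed.

(** The asymptotic Lipschitz constant is upper semicontinuous: a Lipschitz bound on a ball
    bounds it at all points of the ball. *)
Lemma measurable_alip u : lipf u -> measurable_fun setT (alip u : borel X -> R).
Proof.
move=> hu; rewrite (_ : alip u = fun x => - (- alip u x)); last first.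
  by apply/funext => x; rewrite opprK.
apply: (@measurable_funN _ (borel X)); apply: lsc_measurable => c; apply: openP => x /= xc.
have [d [d1 d2]] : exists d, alip u x < d /\ d < - c.
  by exists ((alip u x - c) / 2); split; lra.
have [r [r0 hr]] := alip_lt hu d1.
exists r; split => // y; rewrite ballE /= => xy.
rewrite ltrNr (le_lt_trans _ d2)//.
apply: (@alip_le _ _ _ (r - dist x y)) => //; first by rewrite subr_gt0.
  by rewrite (le_trans (alip_ge0 u x))// ltW.
move=> a b; rewrite !ballE => ya yb; apply: hr; rewrite ballE.
  by have := metric_triangle x y a; lra.
by have := metric_triangle x y b; lra.
Qed.

Lemma measurable_mball (x : X) r : measurable (ball x r : set (borel X)).
Proof.
apply: sub_sigma_algebra; apply: openP => y; rewrite ballE => xy.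
exists (r - dist x y); split; first by rewrite subr_gt0.
move=> z; rewrite !ballE => yz; have := metric_triangle x y z; lra.
Qed.

Lemma k_lipschitz1_cst (c : R) : k_lipschitz 1 ((fun=> c) : X -> R).
Proof. by move=> x y; rewrite subrr normr0 mul1r mdist_ge0. Qed.

Lemma k_lipschitz1P u : (forall x y, u x - u y <= dist x y) -> k_lipschitz 1 u.
Proof.
move=> h x y; rewrite mul1r ler_norml h andbT lerNl opprB metric_sym; exact: h.
Qed.

Lemma k_lipschitz1_max u v : k_lipschitz 1 u -> k_lipschitz 1 v ->
  k_lipschitz 1 (fun x => Num.max (u x) (v x)).
Proof.
move=> hu hv; apply: k_lipschitz1P => x y.
have := hu x y; have := hv x y; rewrite !mul1r !ler_norml => /andP[_ h1] /andP[_ h2].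
rewrite lerBlDr ge_max; apply/andP; split.
  by apply: (@le_trans _ _ (dist x y + u y)); [lra|rewrite lerD2l le_max lexx].
by apply: (@le_trans _ _ (dist x y + v y)); [lra|rewrite lerD2l le_max lexx orbT].
Qed.

Lemma k_lipschitz1N u : k_lipschitz 1 u -> k_lipschitz 1 (fun x => - u x).
Proof. by move=> hu x y; rewrite -opprD normrN; exact: hu. Qed.

Lemma k_lipschitz1_min u v : k_lipschitz 1 u -> k_lipschitz 1 v ->
  k_lipschitz 1 (fun x => Num.min (u x) (v x)).
Proof.
move=> hu hv.
have := k_lipschitz1N (k_lipschitz1_max (k_lipschitz1N hu) (k_lipschitz1N hv)).
by congr k_lipschitz; apply/funext => x; rewrite -oppr_min opprK.
Qed.

End lipschitz.

(** * Density of Lipschitz cutoffs *)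

Section I_dominated.
Context d (T : measurableType d) (R : realType).
Variable mu : {measure set T -> \bar R}.
Local Notation L1 u := (mu.-integrable setT (EFin \o u)).
Local Notation I u := (Rintegral mu setT u).

Lemma I_dominated (us : nat -> T -> R) (u g : T -> R) :
  (forall n, measurable_fun setT (us n)) -> measurable_fun setT u -> L1 g ->
  (forall n x, `|us n x| <= g x) ->
  {ae mu, forall x, us n x @[n --> \oo] --> u x} ->
  I (us n) @[n --> \oo] --> I u.
Proof.
move=> mus mu0 hg ug cu.
have mE (v : T -> R) : measurable_fun setT v -> measurable_fun setT (fun x => (v x)%:E).
  by move=> ?; exact/measurable_EFinP.
have [hu _ cI] := @dominated_convergence _ _ _ mu _ measurableT
  (fun n x => (us n x)%:E) (fun x => (u x)%:E) (fun x => (g x)%:E)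
  (fun n => mE _ (mus n)) (mE _ mu0)
  (filterS (fun x h _ => cvg_EFinr h) cu) hg
  (aeW _ (fun x n _ => ug n x)).
apply: fine_cvg; rewrite EFin_I//; exact: cI.
Qed.

End I_dominated.

Section inf_conv.
Context {R : realType} {X : completeMetricType R}.
Implicit Types (g u v : X -> R) (x y z : X).
Local Notation dist := (@mdist R X).

(** The inf-convolution of [min g n] with the cone of slope [n]; for [g >= 0], the largest
    [n]-Lipschitz minorant of [min g n]. *)
Definition inf_conv g (n : nat) x : R :=
  inf [set Num.min (g y) n%:R + n%:R * dist x y | y in [set: X]].

Lemma inf_conv_has_inf g n x : (forall y, 0 <= g y) ->
  has_inf [set Num.min (g y) n%:R + n%:R * dist x y | y in [set: X]].
Proof.
move=> g0; split; first by exists (Num.min (g x) n%:R + n%:R * dist x x), x.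
exists 0 => _ [y _ <-].
by rewrite addr_ge0 ?mulr_ge0 ?mdist_ge0// le_min g0 ler0n.
Qed.

Lemma inf_conv_le_at g n x y : (forall y, 0 <= g y) ->
  inf_conv g n x <= Num.min (g y) n%:R + n%:R * dist x y.
Proof. by move=> g0; apply: (ge_inf (inf_conv_has_inf n x g0).2); exists y. Qed.

Lemma inf_conv_ge g n x c :
  (forall y, c <= Num.min (g y) n%:R + n%:R * dist x y) -> c <= inf_conv g n x.
Proof.
move=> h; apply: lb_le_inf; last by move=> _ [y _ <-].
by exists (Num.min (g x) n%:R + n%:R * dist x x), x.
Qed.

Lemma inf_conv_ge0 g n x : (forall y, 0 <= g y) -> 0 <= inf_conv g n x.
Proof.
move=> g0; apply: inf_conv_ge => y.
by rewrite addr_ge0 ?mulr_ge0 ?mdist_ge0// le_min g0 ler0n.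
Qed.

Lemma inf_conv_le g n x : (forall y, 0 <= g y) -> inf_conv g n x <= Num.min (g x) n%:R.
Proof. by move=> g0; have := inf_conv_le_at n x x g0; rewrite mdistxx mulr0 addr0. Qed.

Lemma inf_conv_lip g n : (forall y, 0 <= g y) -> k_lipschitz n%:R (inf_conv g n).
Proof.
move=> g0.
have h x y : inf_conv g n x - inf_conv g n y <= n%:R * dist x y.
  rewrite lerBlDr -lerBlDl; apply: inf_conv_ge => z.
  rewrite lerBlDl (le_trans (inf_conv_le_at n x z g0))// addrCA lerD2l -mulrDr.
  by rewrite ler_wpM2l// metric_triangle.
move=> x y; rewrite ler_norml; apply/andP; split; last exact: h.
by rewrite lerNl opprB metric_sym.
Qed.

Lemma inf_conv_cvg g x : (forall y, 0 <= g y) ->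
  (forall a, a < g x -> exists r, 0 < r /\ forall y, ball x r y -> a < g y) ->
  inf_conv g n x @[n --> \oo] --> g x.
Proof.
move=> g0 lsc; apply/cvgrPdist_le => e e0.
have [r [r0 hr]] := lsc (g x - e) ltac:(lra).
set a := g x - e in hr.
pose N := (Num.truncn (`|a| + `|a| / r)).+1.
have Na : `|a| + `|a| / r < N%:R by exact: truncnS_gt.
exists N => // n /= Nn.
have nN : N%:R <= n%:R :> R by rewrite ler_nat.
have ar : 0 <= `|a| / r by rewrite divr_ge0// ltW.
have aa : a <= `|a| by exact: ler_norm.
have a0 : 0 <= `|a| by [].
have h1 : a <= inf_conv g n x.
  apply: inf_conv_ge => y; have [xy|xy] := ltP (dist x y) r.
    have ay : a < g y by apply: hr; rewrite ballEmdist.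
    apply: (@le_trans _ _ (Num.min (g y) n%:R)).
      by rewrite le_min (ltW ay); lra.
    by rewrite lerDl mulr_ge0 ?mdist_ge0.
  apply: (@le_trans _ _ (n%:R * dist x y)); last first.
    by rewrite lerDr le_min g0 ler0n.
  apply: (@le_trans _ _ (n%:R * r)); last by rewrite ler_wpM2l.
  by rewrite -ler_pdivrMr//; have := ler_wpM2r (ltW (ltac:(by rewrite invr_gt0) : 0 < r^-1)) aa; lra.
have h2 : inf_conv g n x <= g x by rewrite (le_trans (inf_conv_le n x g0))// ge_min lexx.
by rewrite ler_norml; apply/andP; split; move: h1; rewrite /a; lra.
Qed.

End inf_conv.

Section density.
Context {R : realType} {X : completeMetricType R}.
Variable m : {measure set (borel X) -> \bar R}.
Implicit Types (u v s : X -> R) (phi psi : borel X -> R).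
Local Notation L1 u := (m.-integrable setT (EFin \o u)).
Local Notation I u := (Rintegral m setT u).

Definition cutoff (s : X -> R) := lipf s /\ forall x, 0 <= s x <= 1.

Let approx psi : set (set (borel X)) := [set A | measurable A /\
  forall e, 0 < e -> exists2 s, cutoff s & I (fun x => psi x * `|s x - \1_A x|) < e].

Lemma max_dist (a b c d : R) : `|Num.max a b - Num.max c d| <= `|a - c| + `|b - d|.
Proof.
have [h1 h2] : a - c <= `|a - c| /\ c - a <= `|a - c|.
  by rewrite ler_norm distrC ler_norm.
have [h3 h4] : b - d <= `|b - d| /\ d - b <= `|b - d|.
  by rewrite ler_norm distrC ler_norm.
have := normr_ge0 (a - c); have := normr_ge0 (b - d).
by case: (leP a b) => ?; case: (leP c d) => ?; rewrite ler_norml => *; apply/andP; split; lra.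
Qed.

(** Maxima of cutoffs approximate unions. *)
Lemma cutoff_max u v : cutoff u -> cutoff v -> cutoff (fun x => Num.max (u x) (v x)).
Proof.
move=> [[k hu] u01] [[l hv] v01]; split.
  exists (k + l) => x y; rewrite (le_trans (max_dist _ _ _ _))// mulrDl.
  by apply: lerD.
by move=> x; rewrite le_max ge_max; case/andP: (u01 x) => -> ->; case/andP: (v01 x) => _ ->.
Qed.

Lemma cutoffC u : cutoff u -> cutoff (fun x => 1 - u x).
Proof.
move=> [[k hu] u01]; split.
  by exists k => x y; rewrite (_ : _ - _ = u y - u x) ?(metric_sym x)//; ring.
by move=> x; case/andP: (u01 x) => *; apply/andP; split; lra.
Qed.

Lemma cutoff_indic_le u (A : set X) x : cutoff u -> `|u x - \1_A x| <= 1.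
Proof.
move=> [_ /(_ x) /andP[u0 u1]]; rewrite indicE; case: (_ \in _) => /=;
  by rewrite ler_norml; apply/andP; split; lra.
Qed.

Lemma measurable_cutoff u : cutoff u -> measurable_fun setT (u : borel X -> R).
Proof. by move=> [hu _]; exact: measurable_lipf. Qed.

Section approx_class.
Variable psi : borel X -> R.
Hypotheses (psi0 : forall x, 0 <= psi x) (hpsi : L1 psi).

Let mpsi : measurable_fun setT psi := L1_measurable hpsi.

Let L1_err u (A : set (borel X)) : cutoff u -> measurable A ->
  L1 (fun x => psi x * `|u x - \1_A x|).
Proof.
move=> cu mA; apply: (L1_le _ hpsi).
  apply: measurable_funM => //; apply: measurableT_comp => //.
  by apply: measurable_funB; [exact: measurable_cutoff|exact: measurable_indic].
move=> x; rewrite normrM normr_id (ger0_norm (psi0 x)) -[leRHS]mulr1.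
by apply: ler_wpM2l => //; exact: cutoff_indic_le.
Qed.

Let approx_setC A : approx psi A -> approx psi (~` A).
Proof.
move=> [mA hA]; split; first exact: measurableC.
move=> e /hA[s cs hs]; exists (fun x => 1 - s x); first exact: cutoffC.
rewrite (_ : (fun x => _) = (fun x => psi x * `|s x - \1_A x|))//.
apply/funext => x; congr (_ * _); rewrite -normrN; congr `|_|.
by rewrite !indicE in_setC; case: (x \in A) => /=; ring.
Qed.

Let approx_setU A B : approx psi A -> approx psi B -> approx psi (A `|` B).
Proof.
move=> [mA hA] [mB hB]; split; first exact: measurableU.
move=> e e0; have [s cs hs] := hA (e / 2) ltac:(lra).
have [t ct ht] := hB (e / 2) ltac:(lra).
exists (fun x => Num.max (s x) (t x)); first exact: cutoff_max.
have i1 := L1_err cs mA; have i2 := L1_err ct mB.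
apply: (@le_lt_trans _ _ (I (fun x => psi x * `|s x - \1_A x| + psi x * `|t x - \1_B x|))).
  apply: I_le_ae; [apply: L1_err; [exact: cutoff_max|exact: measurableU]|exact: L1D|].
  apply: aeW => x; rewrite -mulrDr ler_wpM2l//.
  rewrite (_ : \1_(A `|` B) x = Num.max (\1_A x) (\1_B x)) ?max_dist//.
  rewrite !indicE in_setU; case: (x \in A); case: (x \in B) => //=;
  by rewrite ?maxxx// /Num.max ?ltr01// ltr10.
by rewrite (RintegralD measurableT)//; lra.
Qed.

Let approx0 : approx psi set0.
Proof.
split; first exact: measurable0.
move=> e e0; exists (fun=> 0).
  by split; [exists 0 => x y; rewrite subrr normr0 mul0r|move=> x; rewrite lexx ler01].
rewrite (_ : (fun x => _) = fun=> 0).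
  by rewrite /Rintegral integral0.
by apply/funext => x; rewrite indic0 subrr normr0 mulr0.
Qed.

Let approx_bigcup (A : nat -> set (borel X)) : (forall n, approx psi (A n)) ->
  approx psi (\bigcup_n A n).
Proof.
move=> hA; split; first by apply: bigcup_measurable => n _; case: (hA n).
have mU : measurable (\bigcup_n A n) by apply: bigcup_measurable => n _; case: (hA n).
pose B n := \big[setU/set0]_(k < n) A k.
have hB n : approx psi (B n).
  rewrite /B; elim: n => [|n IH]; first by rewrite big_ord0.
  by rewrite big_ord_recr /=; exact: approx_setU.
have mB n : measurable (B n) by case: (hB n).
move=> e e0.
have : I (fun x => psi x * `|\1_(B n) x - \1_(\bigcup_n A n) x|) @[n --> \oo] --> I (fun=> 0).
  apply: (@I_dominated _ _ _ m _ _ psi) => //.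
  - move=> n; apply: measurable_funM => //; apply: measurableT_comp => //.
    by apply: measurable_funB; exact: measurable_indic.
  - move=> n x; rewrite normrM normr_id (ger0_norm (psi0 x)) -[leRHS]mulr1.
    apply: ler_wpM2l => //; rewrite !indicE.
    by case: (_ \in _); case: (_ \in _); rewrite ?subrr ?subr0 ?sub0r ?normrN ?normr0 ?normr1.
  apply: aeW => x; apply: cvg_near_cst.
  have [[k _ Akx]|nx] := pselect ((\bigcup_n A n) x).
    exists k.+1 => // n /= kn; rewrite !indicE !mem_set ?subrr ?normr0 ?mulr0//.
      by exists k.
    by rewrite /B -bigcup_mkord; exists k.
  exists 0%N => // n _ /=; rewrite !indicE !memNset ?subrr ?normr0 ?mulr0//.
  by rewrite /B -bigcup_mkord => -[k _ Akx]; apply: nx; exists k.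
rewrite {2}/Rintegral integral0 => /cvgrPdist_lt /(_ (e / 2) ltac:(lra)) [N _ /(_ N (leqnn N))].
rewrite /= sub0r normrN ger0_norm; last first.
  by apply: Rintegral_ge0 => x _; rewrite mulr_ge0.
move=> hN; have [s cs hs] := (hB N).2 (e / 2) ltac:(lra).
exists s => //.
have i1 := L1_err cs (mB N).
have i2 : L1 (fun x => psi x * `|\1_(B N) x - \1_(\bigcup_n A n) x|).
  apply: (L1_le _ hpsi).
    apply: measurable_funM => //; apply: measurableT_comp => //.
    by apply: measurable_funB; exact: measurable_indic.
  move=> x; rewrite normrM normr_id (ger0_norm (psi0 x)) -[leRHS]mulr1.
  apply: ler_wpM2l => //; rewrite !indicE.
  by case: (_ \in _); case: (_ \in _); rewrite ?subrr ?subr0 ?sub0r ?normrN ?normr0 ?normr1.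
apply: (@le_lt_trans _ _ (I (fun x => psi x * `|s x - \1_(B N) x| +
    psi x * `|\1_(B N) x - \1_(\bigcup_n A n) x|))).
  apply: I_le_ae; [exact: L1_err|exact: L1D|].
  by apply: aeW => x; rewrite -mulrDr ler_wpM2l// ler_distD.
by rewrite (RintegralD measurableT)//; lra.
Qed.

Let approx_open (A : set X) : open A -> approx psi A.
Proof.
move=> oA; have mA : measurable (A : set (borel X)) by exact: sub_sigma_algebra.
split => //; move=> e e0.
have g0 : forall y : X, 0 <= \1_A y :> R by move=> y; rewrite indicE ler0n.
pose s (n : nat) x := inf_conv (\1_A : X -> R) n.+1 x.
have cs n : cutoff (s n).
  split; first by exists n.+1%:R; exact: inf_conv_lip.
  move=> x; rewrite inf_conv_ge0//= (le_trans (inf_conv_le _ _ g0))// ge_min indicE.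
have : I (fun x => psi x * `|s n x - \1_A x|) @[n --> \oo] --> I (fun=> 0).
  apply: (@I_dominated _ _ _ m _ _ psi) => //.
  - by move=> n; exact: L1_measurable (L1_err (cs n) mA).
  - move=> n x; rewrite normrM normr_id (ger0_norm (psi0 x)) -[leRHS]mulr1.
    by apply: ler_wpM2l => //; exact: cutoff_indic_le.
  apply: aeW => x; rewrite -(mulr0 (psi x)); apply: cvgM; first exact: cvg_cst.
  apply/norm_cvg0P/subr_cvg0.
  rewrite (cvg_shiftS (fun n => inf_conv (\1_A : X -> R) n x)).
  apply: inf_conv_cvg => // a; rewrite {1}indicE; case: (boolP (x \in A)) => [/set_mem Ax|xA] /= ha.
    move: oA; rewrite openE => /(_ x Ax) /nbhs_ballP [r /= r0 rA].
    by exists r; split => // y /rA Ay; rewrite indicE mem_set.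
  by exists 1; split => // y _; rewrite (lt_le_trans ha).
rewrite {2}/Rintegral integral0 => /cvgrPdist_lt /(_ e e0) [N _ /(_ N (leqnn N))].
rewrite /= sub0r normrN ger0_norm; last first.
  by apply: Rintegral_ge0 => x _; rewrite mulr_ge0.
by move=> ?; exists (s N).
Qed.

(** Lipschitz cutoffs approximate any Borel set in [L^1(psi m)]: the sets for which
    this holds form a sigma-algebra containing the open sets. *)
Lemma cutoff_dense (A : set (borel X)) : measurable A ->
  forall e, 0 < e -> exists2 s, cutoff s & I (fun x => psi x * `|s x - \1_A x|) < e.
Proof.
suff : @measurable _ (borel X) `<=` approx psi by move=> h /h [].
apply: smallest_sub; last by move=> B oB; exact: approx_open.
split; [exact: approx0| |exact: approx_bigcup].
by move=> B hB; rewrite setTD; exact: approx_setC.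
Qed.

End approx_class.

(** Take for [s] an approximation of the indicator function of [phi > 0]. *)
Lemma cutoff_pos_part phi e : L1 phi -> 0 < e ->
  exists2 s, cutoff s & I (fun x => Num.max (phi x) 0) - e <= I (fun x => phi x * s x).
Proof.
move=> hphi e0; have mphi := L1_measurable hphi.
pose A : set (borel X) := phi @^-1` `]0, +oo[.
have mA : measurable A by rewrite -[A]setTI; apply: mphi => //; exact: measurable_itv.
have hn := L1_norm hphi.
have [s cs hs] := cutoff_dense (fun x => normr_ge0 (phi x)) hn mA e0.
exists s => //.
have ms := measurable_cutoff cs.
have s01 x : `|s x| <= 1 by case: cs => _ /(_ x) /andP[? ?]; rewrite ger0_norm.
have i1 : L1 (fun x => phi x * s x).
  apply: (L1_le _ hn); first exact: measurable_funM.
  by move=> x; rewrite normrM -[leRHS]mulr1 ler_wpM2l.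
have i2 : L1 (fun x => `|phi x| * `|s x - \1_A x|).
  apply: (L1_le _ hn).
    apply: measurable_funM; first exact: measurableT_comp.
    by apply: measurableT_comp => //; apply: measurable_funB => //; exact: measurable_indic.
  by move=> x; rewrite normrM !normr_id -[leRHS]mulr1 ler_wpM2l// cutoff_indic_le.
have i3 : L1 (fun x => Num.max (phi x) 0).
  apply: (L1_le _ hn); first by apply: measurable_maxr.
  move=> x; rewrite ger0_norm ?le_max ?lexx ?orbT//.
  by rewrite ge_max ler_norm normr_ge0.
rewrite lerBlDr (@le_trans _ _ (I (fun x => phi x * s x) + I (fun x => `|phi x| * `|s x - \1_A x|)))//; last first.
  by rewrite lerD2l ltW.
rewrite -(RintegralD measurableT)//; apply: I_le_ae; [by []|exact: L1D|].
apply: aeW => x; have -> : Num.max (phi x) 0 = phi x * \1_A x.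
  rewrite indicE; have [p0|p0] := ltP 0 (phi x).
    by rewrite mem_set ?mulr1// /A /= in_itv/= p0.
  by rewrite memNset ?mulr0// /A /= in_itv/= andbT ltNge p0.
rewrite -lerBlDl -mulrBr -normrM -normrN -mulrN opprB; exact: ler_norm.
Qed.

(** By [cutoff_pos_part] applied to [- phi], the negative part of [phi] has integral at most
    [e] for every [e > 0]. This turns integral inequalities into pointwise ones. *)
Lemma ae_ge0_cutoff phi : L1 phi -> (forall s, cutoff s -> 0 <= I (fun x => phi x * s x)) ->
  {ae m, forall x, 0 <= phi x}.
Proof.
move=> hphi h.
have hN : L1 (fun x => - phi x).
  by have := L1Z (-1) hphi; apply: eq_integrable => // x _ /=; rewrite mulN1r.
have i3 : L1 (fun x => Num.max (- phi x) 0).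
  apply: (L1_le _ (L1_norm hN)); first by apply: measurable_maxr => //; exact: L1_measurable hN.
  move=> x; rewrite ger0_norm ?le_max ?lexx ?orbT//.
  by rewrite ge_max ler_norm normr_ge0.
have : I (fun x => Num.max (- phi x) 0) <= 0.
  apply/ler_addgt0Pr => e e0; rewrite add0r.
  have [s cs hs] := cutoff_pos_part hN e0.
  have E : I (fun x => - phi x * s x) = - I (fun x => phi x * s x).
    have i1 : L1 (fun x => phi x * s x).
      apply: (L1_le _ (L1_norm hphi)).
        by apply: measurable_funM; [exact: L1_measurable hphi|exact: measurable_cutoff].
      move=> x; rewrite normrM -[leRHS]mulr1 ler_wpM2l//.
      by case: cs => _ /(_ x) /andP[? ?]; rewrite ger0_norm.
    rewrite -mulN1r -(@RintegralZl _ _ _ m _ _ (-1) measurableT i1).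
    by apply: eq_Rintegral => x _; ring.
  by move: hs (h s cs); rewrite E; lra.
move=> /(I_eq0_ae i3 (fun x => ltac:(by rewrite le_max lexx orbT))).
by apply: filterS => x h0; rewrite -oppr_le0 -h0 le_max lexx.
Qed.

End density.

(** * The Cheeger energy and its optimal sequences *)

Section Lnorms.
Context d (T : measurableType d) (R : realType).
Variable mu : {measure set T -> \bar R}.
Implicit Types (u v : T -> R).
Local Notation L1 u := (mu.-integrable setT (EFin \o u)).
Local Notation I u := (Rintegral mu setT u).

Lemma Lfun2E u : u \in Lfun mu 2%:E <-> square_integrable mu u.
Proof.
split.
  move=> h; split; last exact: Lfun2_integrable_sqr h.
  by move: h; rewrite inE => /andP[+ _]; rewrite inE.
move=> [mu0 hu]; rewrite inE; apply/andP; split; first by rewrite inE.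
rewrite inE/= /finite_norm unlock; apply: poweR_lty.
rewrite (_ : (fun x => _) = (fun x => (u x * u x)%:E)); last first.
  by apply/funext => x; rewrite /comp abse_EFin poweR_EFin powR_mulrn// -normrX ger0_norm ?sqr_ge0.
by rewrite -EFin_I// ltry.
Qed.

Lemma Lnorm2E u : square_integrable mu u -> ('N[mu]_2%:E[EFin \o u] = (Num.sqrt (sqnorm mu u))%:E)%E.
Proof.
move=> [mu0 hu]; rewrite unlock.
rewrite (_ : (fun x => _) = (fun x => (u x * u x)%:E)); last first.
  by apply/funext => x; rewrite /comp abse_EFin poweR_EFin powR_mulrn// -normrX ger0_norm ?sqr_ge0.
by rewrite -EFin_I// poweR_EFin powR12_sqrt// nsq_ge0.
Qed.

Lemma Lnorm1E u : L1 u -> ('N[mu]_1%:E[EFin \o u] = (I (fun x => `|u x|))%:E)%E.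
Proof. by move=> hu; rewrite Lnorm1 EFin_I//; exact: L1_norm. Qed.

Lemma sqrt_cvg0 (a : nat -> R) : (forall n, 0 <= a n) ->
  (Num.sqrt (a n) @[n --> \oo] --> (0 : R)) <-> (a n @[n --> \oo] --> (0 : R)).
Proof.
move=> a0; split => h.
  rewrite (_ : a = fun n => Num.sqrt (a n) * Num.sqrt (a n)); last first.
    by apply/funext => n; rewrite -expr2 sqr_sqrtr.
  by rewrite -(mulr0 0); apply: cvgM.
by rewrite -[X in _ --> X](@sqrtr0 R); apply: continuous_cvg => //; exact: sqrt_continuous.
Qed.

End Lnorms.

Section liminf.
Context {R : realType}.
Lemma limn_einf_ge (f : nat -> \bar R) (c : \bar R) N :
  (forall n, (N <= n)%N -> (c <= f n)%E) -> (c <= limn_einf f)%E.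
Proof.
move=> fc; rewrite limn_einf_lim; apply: lime_ge; first exact: is_cvg_einfs.
exists N => // n /= Nn; apply: le_ereal_inf_tmp => _ [k /= nk <-].
exact/fc/(leq_trans Nn).
Qed.

Lemma limn_einf_lt (f : nat -> \bar R) (c : \bar R) N : (limn_einf f < c)%E ->
  exists n, (N <= n)%N /\ (f n < c)%E.
Proof.
move=> fc; apply: contrapT => h; move: fc; apply/negP; rewrite -leNgt.
apply: (@limn_einf_ge _ _ N) => n Nn; rewrite leNgt; apply/negP => fn.
by apply: h; exists n.
Qed.

Lemma convex_lt (a p q c : R) : 0 <= a <= 1 -> p < c -> q < c -> (1 - a) * p + a * q < c.
Proof.
move=> /andP[a0 a1] pc qc; pose M := Num.max p q.
have Mc : M < c by rewrite gt_max pc.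
have E : (1 - a) * M + a * M = M by ring.
apply: le_lt_trans Mc; rewrite -E.
by apply: lerD; apply: ler_wpM2l; rewrite ?subr_ge0// le_max lexx ?orbT.
Qed.

Lemma invSn_gt0 n : 0 < n.+1%:R^-1 :> R. Proof. by rewrite invr_gt0. Qed.

Lemma invSn_lt (e : R) : 0 < e -> exists N, forall n, (N <= n)%N -> n.+1%:R^-1 < e.
Proof.
by move=> e0; have [N _ hN] := near_infty_natSinv_lt (PosNum e0); exists N.
Qed.

End liminf.

Section slope.
Context {R : realType} {X : completeMetricType R}.
Variable m : {measure set (borel X) -> \bar R}.
Implicit Types (f g h u v w : borel X -> R) (us vs ws gs : nat -> borel X -> R).
Local Notation L1 u := (m.-integrable setT (EFin \o u)).
Local Notation I u := (Rintegral m setT u).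
Local Notation L2 := (square_integrable m).
Local Notation nsq := (sqnorm m).
Local Notation ip := (inner m).
Local Notation cvL2 := (cvgL2 m).

Lemma cvg_L2E us f : (forall n, L2 (us n)) -> L2 f -> cvg_L2 m us f <-> cvL2 us f.
Proof.
move=> hus hf; rewrite /cvg_L2.
rewrite (_ : (fun n => _) = (fun n => (Num.sqrt (nsq (fun x => us n x - f x)))%:E)).
  rewrite /cvgL2 -sqrt_cvg0; last by move=> n; exact: nsq_ge0.
  by split => [/fine_cvgP[_]//|h]; apply/fine_cvgP; split => //; exact: nearW.
by apply/funext => n; rewrite -Lnorm2E//; exact: L2B.
Qed.

(** The competitors of finite energy in the definition of [Ch]. *)
Definition lipL2 u := [/\ lip_b (u : X -> R), L2 u & L2 (alip u)].

Lemma norm_alip_le (w : X -> R) (c : R) x : alip w x <= c -> `|alip w x| <= `|c|.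
Proof. by move=> h; rewrite ger0_norm ?alip_ge0// (le_trans h)// ler_norm. Qed.

Lemma lip_energyE u : lip_b (u : X -> R) ->
  (\int[m]_x (lip_a u x ^+ 2) = \int[m]_x (alip u x * alip u x)%:E)%E.
Proof.
move=> [_ hu]; apply: eq_integral => x _.
by rewrite -(alipE x hu) expe2 EFinM.
Qed.

Lemma lip_energy_fin u (c : R) : lip_b (u : X -> R) ->
  (\int[m]_x (lip_a u x ^+ 2) <= c%:E)%E -> L2 (alip u) /\ nsq (alip u) <= c.
Proof.
move=> hu; rewrite lip_energyE// => h.
have ml := measurable_alip (lip_b_lipf hu).
have [h1 h2] := L1_of_integral_le (measurable_funM ml ml) (fun x => sqr_ge0 _) h.
by split.
Qed.

Lemma Ch_ge0 f : (0 <= Ch m f)%E.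
Proof.
apply: le_ereal_inf_tmp => _ [us _ <-]; apply: limn_einf_ge0 => n.
by rewrite mule_ge0// integral_ge0// => x _; exact: sqre_ge0.
Qed.

Definition cheeger f := fine (Ch m f).

Lemma H12_L2 f : H12 m f -> L2 f. Proof. by move=> [/Lfun2E]. Qed.

Lemma cheegerE f : H12 m f -> ((cheeger f)%:E = Ch m f)%E.
Proof. by move=> [_ h]; rewrite fineK// ge0_fin_numE// Ch_ge0. Qed.

Lemma cheeger_ge0 f : 0 <= cheeger f. Proof. by apply: fine_ge0; exact: Ch_ge0. Qed.

Lemma Ch_le f ws gs g : L2 f -> (forall n, lip_b (ws n : X -> R) /\ L2 (ws n)) ->
  cvL2 ws f -> (forall n, L2 (gs n)) -> L2 g -> cvL2 gs g ->
  (forall n x, alip (ws n) x <= gs n x) -> (Ch m f <= (2^-1 * nsq g)%:E)%E.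
Proof.
move=> hf hws cws hgs hg cgs le; apply/lee_addgt0Pr => e e0.
have cn := cvL2_nsq hgs hg cgs.
apply: (@le_trans _ _ (limn_einf (fun n => ((2^-1)%:E * \int[m]_x (lip_a (ws n) x ^+ 2))%E))).
  apply: ereal_inf_lbound; exists ws => //=; split; last first.
    by apply/cvg_L2E => // n; case: (hws n).
  by move=> n; case: (hws n) => ? ?; split => //; apply/Lfun2E.
apply: limn_einf_le.
move/cvgrPdist_lt : cn => /(_ (2 * e) ltac:(lra)); apply: filterS => n.
rewrite ltr_norml => /andP[h _].
have ln x : `|alip (ws n) x| <= `|gs n x|.
  exact: norm_alip_le.
have [lb _] := hws n.
have hl : L2 (alip (ws n)) by apply: (L2_le (measurable_alip (lip_b_lipf lb)) (hgs n)) => x.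
rewrite lip_energyE// -EFin_I ?hl.2// -EFinM -EFinD lee_fin.
have : nsq (alip (ws n)) <= nsq (gs n) by apply: nsq_le => //; exact: aeW.
by rewrite /sqnorm /inner in h *; lra.
Qed.

Lemma H12_lipL2 u : lipL2 u -> H12 m u /\ cheeger u <= 2^-1 * nsq (alip u).
Proof.
move=> [lu hu hl].
have le : (Ch m u <= (2^-1 * nsq (alip u))%:E)%E.
  by apply: (@Ch_le _ (fun=> u) (fun=> alip u)) => //; exact: cvL2_cst.
have hH : H12 m u by split; [exact/Lfun2E|exact: le_lt_trans le (ltry _)].
by split => //; rewrite -lee_fin cheegerE.
Qed.

(** Otherwise Lipschitz functions converging to [f] would have energies at most [c], against
    the definition of [Ch f]. With [Ch_approx] this replaces lower limits of sequences by
    neighbourhoods of [f]. *)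
Lemma Ch_lower f (c : R) : L2 f -> (c%:E < Ch m f)%E -> exists2 de, 0 < de &
  forall w, lipL2 w -> nsq (fun x => w x - f x) < de -> 2 * c < nsq (alip w).
Proof.
move=> hf cf; apply: contrapT => H.
have ex n : exists w, [/\ lipL2 w, nsq (fun x => w x - f x) < n.+1%:R^-1 & nsq (alip w) <= 2 * c].
  apply: contrapT => h; apply: H; exists n.+1%:R^-1; first exact: invSn_gt0.
  move=> w hw ww; rewrite ltNge; apply/negP => le; apply: h.
  by exists w.
have [ws hws] := choice ex.
have : (Ch m f <= c%:E)%E; last by rewrite leNgt cf.
apply: (@le_trans _ _ (limn_einf (fun n => ((2^-1)%:E * \int[m]_x (lip_a (ws n) x ^+ 2))%E))).
  have hws2 n : L2 (ws n) by case: (hws n) => -[].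
  apply: ereal_inf_lbound; exists ws => //=; split.
    by move=> n; case: (hws n) => -[? ? _] _ _; split => //; apply/Lfun2E.
  apply/cvg_L2E => //; apply/cvL2P => e /invSn_lt[N hN]; exists N => n /hN.
  by apply: lt_trans; case: (hws n).
apply: limn_einf_le; apply: nearW => n; case: (hws n) => -[lb _ hl] _ le.
rewrite lip_energyE// -EFin_I ?hl.2// -EFinM lee_fin.
by rewrite /sqnorm /inner in le *; lra.
Qed.

Lemma Ch_approx f (c : R) : L2 f -> (Ch m f < c%:E)%E -> forall de, 0 < de ->
  exists w, [/\ lipL2 w, nsq (fun x => w x - f x) < de & nsq (alip w) < 2 * c].
Proof.
move=> hf /ereal_inf_lt [_ [us [hus cus] <-] lt] de de0.
have hu n : L2 (us n) by apply/Lfun2E; case: (hus n).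
have /cvL2P /(_ de de0) [N hN] : cvL2 us f by apply/cvg_L2E.
have [n [Nn hn]] := limn_einf_lt N lt.
have [lb _] := hus n.
have E : ((2^-1)%:E * \int[m]_x (lip_a (us n) x ^+ 2) < (2^-1)%:E * (2 * c)%:E)%E.
  by rewrite -EFinM mulrA mulVf// mul1r.
have {}E : (\int[m]_x (lip_a (us n) x ^+ 2) < (2 * c)%:E)%E.
  by move: E; rewrite lte_pmul2l// lte_fin invr_gt0.
have [hl _] := lip_energy_fin lb (ltW E).
exists (us n); split => //; first exact: hN.
by rewrite -lte_fin EFin_I ?hl.2// -lip_energyE.
Qed.

Lemma cheeger_lower f e : H12 m f -> 0 < e -> exists2 de, 0 < de &
  forall w, lipL2 w -> nsq (fun x => w x - f x) < de -> 2 * cheeger f - e < nsq (alip w).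
Proof.
move=> hf e0; have [|de de0 h] := @Ch_lower f (cheeger f - e / 2) (H12_L2 hf).
  by rewrite -cheegerE// lte_fin; lra.
by exists de => // w hw /(h w hw); lra.
Qed.

Lemma cheeger_approx f e de : H12 m f -> 0 < e -> 0 < de ->
  exists w, [/\ lipL2 w, nsq (fun x => w x - f x) < de & nsq (alip w) < 2 * cheeger f + e].
Proof.
move=> hf e0 de0; have [|w [h1 h2 h3]] := @Ch_approx f (cheeger f + e / 2) (H12_L2 hf) _ _ de0.
  by rewrite -cheegerE// lte_fin; lra.
by exists w; split => //; lra.
Qed.

Lemma lipL2_lin a b u v : lipL2 u -> lipL2 v -> lipL2 (fun x => a * u x + b * v x).
Proof.
move=> [lu hu hlu] [lv hv hlv]; have hl := lip_b_lin a b lu lv.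
split => //; first exact: L2_lin.
apply: (L2_le (measurable_alip (lip_b_lipf hl)) (L2_lin `|a| `|b| hlu hlv)) => x.
by apply/norm_alip_le/alip_lin; exact: lip_b_lipf.
Qed.

Lemma nsq_alip_lin a b u v : lipL2 u -> lipL2 v ->
  nsq (alip (fun x => a * u x + b * v x)) <= nsq (fun x => `|a| * alip u x + `|b| * alip v x).
Proof.
move=> hu hv; have [_ _ h] := lipL2_lin a b hu hv.
case: hu hv => lu hu hlu [lv hv hlv]; apply: nsq_le => //; first exact: L2_lin.
apply: aeW => x; by apply/norm_alip_le/alip_lin; exact: lip_b_lipf.
Qed.

Lemma nsq_convex t u v : 0 <= t <= 1 -> L2 u -> L2 v ->
  nsq (fun x => (1 - t) * u x + t * v x) <= (1 - t) * nsq u + t * nsq v.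
Proof.
move=> /andP[t0 t1] hu hv; rewrite nsq_lin// -subr_ge0.
have := nsq_ge0 m (fun x => u x - v x); rewrite nsqB// => h.
have -> : (1 - t) * nsq u + t * nsq v - ((1 - t) ^+ 2 * nsq u +
  2 * (1 - t) * t * ip u v + t ^+ 2 * nsq v) = t * (1 - t) * (nsq u - 2 * ip u v + nsq v).
  by ring.
by rewrite !mulr_ge0// subr_ge0.
Qed.

Definition optimal f us h := [/\ forall n, lipL2 (us n), cvL2 us f, L2 h,
  cvL2 (fun n => alip (us n)) h & nsq h = 2 * cheeger f].

Lemma optimal_ge0 f us h : optimal f us h -> {ae m, forall x, 0 <= h x}.
Proof.
move=> [hus _ hh cl _].
have [|phi cphi] := cvL2_ae_subseq _ hh cl; first by move=> n; case: (hus n).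
apply: filterS cphi => x c.
by rewrite -(cvg_lim _ c)//; apply: limr_ge; [exact: cvgP c|apply: nearW => n; exact: alip_ge0].
Qed.

(** Midpoints of a sequence minimizing the energy are again competitors, and by sublinearity
    their slopes lie below the midpoints of the slopes. So the latter have asymptotically at
    least the minimal norm, and the parallelogram law makes the slopes Cauchy. *)
Lemma optimal_exists f : H12 m f -> exists us h, optimal f us h.
Proof.
move=> hf; have hf2 := H12_L2 hf.
have ex n : exists w, [/\ lipL2 w, nsq (fun x => w x - f x) < n.+1%:R^-1 &
    nsq (alip w) < 2 * cheeger f + n.+1%:R^-1].
  by apply: cheeger_approx => //; exact: invSn_gt0.
have [us hus] := choice ex.
have hu n : lipL2 (us n) by case: (hus n).
have hu2 n : L2 (us n) by case: (hu n).
have hl2 n : L2 (alip (us n)) by case: (hu n).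
have cu : cvL2 us f.
  apply/cvL2P => e /invSn_lt[N hN]; exists N => n /hN.
  by apply: lt_trans; case: (hus n).
have [| |h [hh ch nh]] := @minimizing_cvL2 _ _ _ m (fun n => alip (us n)) (2 * cheeger f) hl2.
- move=> e /invSn_lt[N hN]; exists N => n /hN ne.
  by case: (hus n) => _ _ h; rewrite (lt_trans h)// ltrD2l.
- move=> e e0; have [de de0 hde] := cheeger_lower hf e0.
  move/cvL2P : (cu) => /(_ de de0) [N hN]; exists N => n k Nn Nk.
  apply: (@lt_le_trans _ _ (nsq (alip (fun x => 2^-1 * us n x + 2^-1 * us k x)))).
    apply: hde; first exact: lipL2_lin.
    have t01 : 0 <= (2^-1 : R) <= 1 by apply/andP; split; lra.
    have := nsq_convex t01 (L2B (hu2 n) hf2) (L2B (hu2 k) hf2).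
    rewrite (_ : (fun x => _) = fun x => 2^-1 * us n x + 2^-1 * us k x - f x).
      by have := hN n Nn; have := hN k Nk; lra.
    by apply/funext => x; lra.
  have := nsq_alip_lin 2^-1 2^-1 (hu n) (hu k).
  by rewrite (@ger0_norm _ (2^-1 : R)).
by exists us, h.
Qed.

(** Minimality, tested against any relaxation: in the closure of the convex set of upper
    bounds for slopes of Lipschitz functions near [f], the element [p] of least norm is
    close to [h], and [ip p g >= nsq p] passes to weak limits. *)
Lemma optimal_relax f us h ws gs g : H12 m f -> optimal f us h ->
  (forall n, lip_b (ws n : X -> R) /\ L2 (ws n)) -> cvL2 ws f ->
  (forall n, L2 (gs n)) -> L2 g ->
  (forall n x, alip (ws n) x <= gs n x) ->
  (forall p, L2 p -> ip p (gs n) @[n --> \oo] --> ip p g) ->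
  nsq h <= ip h g.
Proof.
move=> hf [hus cus hh ch nh] hws cws hgs hg le wg; have hf2 := H12_L2 hf.
have hus2 n : L2 (us n) by case: (hus n).
have hl2 n : L2 (alip (us n)) by case: (hus n).
have hL n : lipL2 (ws n).
  case: (hws n) => lb h2; split => //.
  apply: (L2_le (measurable_alip (lip_b_lipf lb)) (hgs n)) => x.
  exact: norm_alip_le.
apply/ler_addgt0Pr => e e0.
pose s := Num.sqrt (nsq g); have s0 : 0 <= s by exact: sqrtr_ge0.
(* Chosen so that the total error [t ^+ 2 + s * t] below is at most [e]. *)
pose t := Num.min 1 (e / (1 + s)).
have ps : 0 < 1 + s by lra.
have t0 : 0 < t by rewrite lt_min ltr01 divr_gt0.
have t1 : t <= 1 by rewrite ge_min lexx.
have te : t * (1 + s) <= e by rewrite -ler_pdivlMr// ge_min lexx orbT.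
have [de de0 hde] := cheeger_lower hf (exprn_gt0 2 t0).
pose U : set (borel X -> R) := [set g' | L2 g' /\ exists w, [/\ lipL2 w,
  nsq (fun x => w x - f x) < de & forall x, alip w x <= g' x]].
have [N1 hN1] : exists N, forall n, (N <= n)%N -> nsq (fun x => us n x - f x) < de.
  by move/cvL2P : cus; exact.
have [N2 hN2] : exists N, forall n, (N <= n)%N -> nsq (fun x => ws n x - f x) < de.
  by move/cvL2P : cws; exact.
have U1 n : (N1 <= n)%N -> U (alip (us n)).
  by move=> /hN1 ?; split => //; exists (us n).
have U2 n : (N2 <= n)%N -> U (gs n).
  by move=> /hN2 ?; split => //; exists (ws n).
have UD g' : U g' -> 2 * cheeger f - t ^+ 2 < nsq g'.
  move=> [hg' [w [hw wf lw]]]; apply: lt_le_trans (hde _ hw wf) _.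
  have [_ _ hlw] := hw; apply: nsq_le => //; apply: aeW => x.
  exact: norm_alip_le.
have [| | |p [hp [ps' Ups cps] pU]] := @min_norm _ _ _ m U.
- by exists (alip (us N1)); exact: U1.
- by move=> u [].
- move=> u v a [hu [w [hw wf lw]]] [hv [w' [hw' wf' lw']]] a01.
  split; first exact: L2_lin.
  exists (fun x => (1 - a) * w x + a * w' x); split; first exact: lipL2_lin.
    have [[_ hw2 _] [_ hw2' _]] := (hw, hw').
    have := nsq_convex a01 (L2B hw2 hf2) (L2B hw2' hf2).
    rewrite (_ : (fun x => _) = (fun x => (1 - a) * w x + a * w' x - f x)).
      by move=> /le_lt_trans; apply; exact: convex_lt.
    by apply/funext => x; ring.
  case/andP: a01 => a0 a1 x.
  apply: (le_trans (alip_lin _ _ _ _ _)); [by case: hw => /lip_b_lipf|by case: hw' => /lip_b_lipf|].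
  by rewrite !ger0_norm ?subr_ge0//; apply: lerD; apply: ler_wpM2l => //; rewrite subr_ge0.
have hps n : L2 (ps' n) by case: (Ups n).
have np : 2 * cheeger f - t ^+ 2 <= nsq p.
  have c := cvL2_nsq hps hp cps.
  rewrite -(cvg_lim _ c)//; apply: limr_ge; first exact: cvgP c.
  by apply: nearW => n; apply/ltW/UD.
have ph : nsq p <= ip p h.
  have c := cvL2_ip hl2 hh hp ch.
  rewrite -(cvg_lim _ c)//; apply: limr_ge; first exact: cvgP c.
  by exists N1 => // n /= /U1 /pU.
have pg : nsq p <= ip p g.
  have c := wg p hp.
  rewrite -(cvg_lim _ c)//; apply: limr_ge; first exact: cvgP c.
  by exists N2 => // n /= /U2 /pU.
have hp_close : nsq (fun x => h x - p x) <= t ^+ 2.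
  by rewrite nsqB// (ipC _ h) nh; lra.
have : `|ip g (fun x => h x - p x)| <= s * t.
  rewrite -(@ger0_norm _ (s * t)) ?mulr_ge0 ?(ltW t0)// -ler_sqr ?qualifE/=// real_normK ?num_real//.
  rewrite real_normK ?num_real// exprMn sqr_sqrtr ?nsq_ge0//.
  apply: le_trans (cauchy_schwarz hg (L2B hh hp)) _.
  by rewrite ler_wpM2l ?nsq_ge0.
rewrite ipB// ler_norml (ipC _ g h) (ipC _ g p) nh => /andP[h1 _].
have : t ^+ 2 <= t by rewrite expr2 -[leRHS]mulr1 ler_wpM2l ?(ltW t0).
by lra.
Qed.

(** Every relaxed slope [g] satisfies [nsq h <= ip h g] for the limit [h] of an optimal
    sequence, so that [h] has least norm; a relaxed slope of the same norm satisfies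
    [nsq (g - h) <= 0]. Hence minimal slopes are exactly the functions equal to [h] almost
    everywhere, and the representative chosen by [slope] is one of them. *)
Lemma slope_optimal f : H12 m f -> exists us, optimal f us (slope m f).
Proof.
move=> hf; have [us [h ho]] := optimal_exists hf.
have h0 := optimal_ge0 ho; have [hus cus hh ch nh] := ho.
have rel g : relaxed_slope m f g -> L2 g /\ nsq h <= ip h g.
  move=> [/Lfun2E hg [ws [h' [[hws cws] [wl /Lfun2E hh' wh'] hg']]]].
  have hws2 n : L2 (ws n) by apply/Lfun2E; case: (hws n).
  have hla n : L2 (alip (ws n)) by apply/Lfun2E; exact: wl.
  split => //.
  apply: (@le_trans _ _ (ip h h')); last exact: ip_le_ae.
  apply: (@optimal_relax f us h ws (fun n => alip (ws n)) h') => //.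
  - by move=> n; split => //; case: (hws n).
  - by apply/cvg_L2E => //; exact: H12_L2.
  - move=> p hp; have := wh' p ((Lfun2E m p).2 hp).
    rewrite (ipC _ p h') /inner.
    rewrite -(EFin_I (L2_mul hh' hp)).
    rewrite (_ : (fun n => _) = (fun n => (I (fun x => alip (ws n) x * p x))%:E)); last first.
      by apply/funext => n; rewrite (EFin_I (L2_mul (hla n) hp)).
    move=> /fine_cvgP [_]; rewrite /=.
    by under [X in _ -> X @ _ --> _]eq_fun do rewrite -/(inner m p (alip (ws _))) ipC.
have cs g : L2 g -> nsq h <= ip h g -> nsq h <= nsq g.
  move=> hg le; have := cauchy_schwarz hh hg.
  have := nsq_ge0 m h; have := nsq_ge0 m g.
  have [->//|hn] := eqVneq (nsq h) 0.
  move=> g0 hp0 CS; have hp : 0 < nsq h by rewrite lt_def hn.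
  by rewrite -(ler_pM2l hp) (le_trans _ CS)// expr2 ler_pM.
have minh : is_minimal_slope m f h.
  split.
    split; first exact/Lfun2E.
    exists us, h; split; last exact: aeW.
      split; first by move=> n; case: (hus n) => ? ? _; split => //; apply/Lfun2E.
      by apply/cvg_L2E => //; [move=> n; case: (hus n)|exact: H12_L2].
    have hl n : L2 (alip (us n)) by case: (hus n).
    split; [by move=> n; apply/Lfun2E; exact: hl|exact/Lfun2E|].
    move=> p /Lfun2E hp; rewrite -(EFin_I (L2_mul hh hp)).
    rewrite (_ : (fun n => _) = (fun n => (ip p (alip (us n)))%:E)).
      by rewrite -/(inner m h p) ipC; apply: cvg_EFinr; exact: cvL2_ip.
    by apply/funext => n; rewrite ipC (EFin_I (L2_mul (hl n) hp)).
  move=> g rg; have [hg le] := rel g rg.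
  by rewrite !Lnorm2E// lee_fin ler_wsqrtr// cs.
have [rs ms] : is_minimal_slope m f (slope m f).
  by apply: (@xgetPex _ (cst 0) [set g | is_minimal_slope m f g]); exists h.
have [hs le] := rel _ rs.
have sh : nsq (slope m f) <= nsq h.
  have := ms h minh.1; rewrite !Lnorm2E// lee_fin.
  by rewrite ler_sqrt ?nsq_ge0.
have hB : L2 (fun x => slope m f x - h x) by exact: L2B.
have sz : nsq (fun x => slope m f x - h x) <= 0.
  by rewrite nsqB// (ipC _ (slope m f)); lra.
have ae0 := nsq_eq0 hB sz.
have ns : nsq (slope m f) = nsq h.
  by apply: nsq_ae_eq => //; apply: filterS ae0 => x /subr0_eq.
exists us; split => //; last by rewrite ns.
have hl n : L2 (alip (us n)) by case: (hus n).
apply/cvL2P => e e0; move/cvL2P : ch => /(_ e e0) [N hN]; exists N => n /hN.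
apply: le_lt_trans; apply: nsq_le; [exact: L2B|exact: L2B|].
by apply: filterS ae0 => x /subr0_eq ->.
Qed.

End slope.

(** * Pointwise calculus of minimal slopes *)

Section local.
Context {R : realType} {X : completeMetricType R}.
Variable m : {measure set (borel X) -> \bar R}.
Implicit Types (f g h u v w : borel X -> R) (us vs ws gs : nat -> borel X -> R).
Implicit Types (s : X -> R) (x y z : X) (r : R).
Local Notation L1 u := (m.-integrable setT (EFin \o u)).
Local Notation I u := (Rintegral m setT u).
Local Notation L2 := (square_integrable m).
Local Notation nsq := (sqnorm m).
Local Notation ip := (inner m).
Local Notation cvL2 := (cvgL2 m).
Local Notation dist := (@mdist R X).

Lemma cutoff_mul (s t : X -> R) : cutoff s -> cutoff t -> cutoff (fun x => s x * t x).
Proof.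
move=> [[k hs] s01] [[l ht] t01]; split.
  exists (k + l) => x y.
  have -> : s x * t x - s y * t y = (s x - s y) * t x + s y * (t x - t y) by ring.
  rewrite (le_trans (ler_normD _ _))// !normrM mulrDl; apply: lerD.
    rewrite -[leRHS]mulr1; apply: ler_pM => //.
    by case/andP: (t01 x) => *; rewrite ger0_norm.
  rewrite -[leRHS]mul1r; apply: ler_pM => //.
  by case/andP: (s01 y) => *; rewrite ger0_norm.
move=> x; case/andP: (s01 x) => s0 s1; case/andP: (t01 x) => t0 t1.
by rewrite mulr_ge0//= -[leRHS]mul1r ler_pM.
Qed.

Definition tent (x0 : X) (r : R) x : R := Num.max 0 (Num.min 1 (r - dist x0 x)).

Lemma tent_cutoff x0 r : cutoff (tent x0 r).
Proof.
split.
  exists 1; apply: k_lipschitz1_max; first exact: k_lipschitz1_cst.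
  apply: k_lipschitz1_min; first exact: k_lipschitz1_cst.
  by apply: k_lipschitz1P => x y; have := metric_triangle x0 x y; lra.
move=> x; rewrite le_max lexx/= ge_max ler01/= ge_min lexx//.
Qed.

Lemma tent0 x0 r x : r <= dist x0 x -> tent x0 r x = 0.
Proof. by move=> h; rewrite /tent; apply/max_idPl; rewrite ge_min; apply/orP; right; lra. Qed.

Lemma tent_gt0 x0 r x : dist x0 x < r -> 0 < tent x0 r x.
Proof. by move=> h; rewrite /tent lt_max; apply/orP; right; rewrite lt_min ltr01 subr_gt0. Qed.

Definition finite_on_bounded := forall A : set (borel X), measurable A ->
  metric_bounded (A : set X) -> (m A < +oo)%E.

Lemma L1_cutoff_mul u (s : X -> R) : L1 u -> cutoff s -> L1 (fun x => u x * s x).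
Proof.
move=> hu cs; apply: (L1_le _ (L1_norm hu)).
  by apply: measurable_funM; [exact: L1_measurable hu|exact: measurable_cutoff].
move=> x; rewrite normrM -[leRHS]mulr1 ler_wpM2l//.
by case: cs => _ /(_ x) /andP[? ?]; rewrite ger0_norm.
Qed.

(** Comparison of the minimal slope of [f] on a ball with the slopes of Lipschitz
    functions that approximate [f] on that ball only: gluing them with an optimal sequence
    by a cutoff [s] supported in the ball gives a relaxation of [f], and minimality
    yields [0 <= ip (slope f) (s * (G - slope f))]. *)
Lemma slope_le_local f vs gs G x0 r : H12 m f ->
  (forall n, lip_b (vs n : X -> R) /\ L2 (vs n)) ->
  cvL2 (fun n x => \1_(ball x0 r) x * (vs n x - f x)) (fun=> 0) ->
  (forall n, L2 (gs n)) -> L2 G -> cvL2 gs G ->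
  (forall n x, ball x0 r x -> alip (vs n) x <= gs n x) ->
  {ae m, forall x : borel X, ball x0 r x -> 0 <= G x} ->
  {ae m, forall x : borel X, ball x0 r x -> slope m f x <= G x}.
Proof.
move=> hf hvs cvs hgs hG cgs le G0.
have hf2 := H12_L2 hf; have [us ou] := slope_optimal hf.
have h0 := optimal_ge0 ou; have [hus cus hh ch nh] := ou.
set h := slope m f in h0 ou hh ch nh *.
have hus2 n : L2 (us n) by case: (hus n).
have hvs2 n : L2 (vs n) by case: (hvs n).
have hl n : L2 (alip (us n)) by case: (hus n).
pose B := ball x0 r : set (borel X).
have mB : measurable B by exact: measurable_mball.
have m1 : measurable_fun setT (\1_B : borel X -> R) by exact: measurable_indic.
have b1 x : `|\1_B x : R| <= 1 by rewrite indicE; case: (_ \in _); rewrite /= ?normr0 ?normr1.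
have L2B' u : L2 u -> L2 (fun x => \1_B x * u x).
  move=> hu; apply: (L2_le _ hu) => [|x]; first by apply: measurable_funM => //; case: hu.
  by rewrite normrM -[leRHS]mul1r ler_wpM2r.
have L2s s u : cutoff s -> L2 u -> L2 (fun x => s x * u x).
  move=> cs hu; apply: (L2_le _ hu) => [|x].
    by apply: measurable_funM; [exact: measurable_cutoff|case: hu].
  rewrite normrM -[leRHS]mul1r ler_wpM2r//.
  by case: cs => _ /(_ x) /andP[? ?]; rewrite ger0_norm.
have cs1 s : cutoff s -> forall x, `|s x| <= 1.
  by move=> [_ s01] x; case/andP: (s01 x) => ? ?; rewrite ger0_norm.
(* Minimality tested on the glued sequence [ws], whose slopes are bounded by [g']. *)
have key r' s : r' < r -> cutoff s -> (forall x, r' <= dist x0 x -> s x = 0) ->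
    0 <= ip h (fun x => s x * (G x - h x)).
  move=> rr cs s0; have [ls s01] := cs; have [k k0' hk] := lipf_pos ls.
  have csC := cutoffC cs.
  have sB x : s x * \1_B x = s x.
    rewrite indicE; have [xB|xB] := boolP (x \in B); first by rewrite mulr1.
    rewrite s0 ?mul0r//; move: xB; rewrite notin_setE /B ballEmdist /= => /negP.
    by rewrite -leNgt; exact/le_trans/ltW.
  pose ws n x := s x * vs n x + (1 - s x) * us n x.
  pose g' n x := (s x * gs n x + (1 - s x) * alip (us n) x) + k * (\1_B x * `|vs n x - us n x|).
  pose g x := s x * G x + (1 - s x) * h x.
  have vu : cvL2 (fun n x => \1_B x * `|vs n x - us n x|) (fun=> 0).
    apply: (@cvL2_squeeze _ _ _ m _ _ (fun n => 2 * nsq (fun x => \1_B x * (vs n x - f x) - 0)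
        + 2 * nsq (fun x => us n x - f x))).
      move=> n; have hA : L2 (fun x => \1_B x * (vs n x - f x)) by apply/L2B'/L2B.
      have hA0 : L2 (fun x => \1_B x * (vs n x - f x) - 0) by apply: L2_ext hA => x; rewrite subr0.
      have hC : L2 (fun x => (-1) * (us n x - f x)) by apply/L2Z/L2B.
      have E : nsq (fun x => us n x - f x) = nsq (fun x => (-1) * (us n x - f x)).
        by rewrite nsqZ ?sqrrN ?expr1n ?mul1r//; exact: L2B.
      rewrite E; apply: le_trans (nsqD_le hA0 hC).
      have hD : L2 (fun x => \1_B x * (vs n x - us n x)) by apply/L2B'/L2B.
      apply: nsq_le; last apply: aeW => x.
      - apply: (L2_le _ hD) => [|x]; last by rewrite subr0 !normrM normr_id.
        apply: measurable_funB => //; apply: measurable_funM => //.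
        by apply: measurableT_comp => //; apply: measurable_funB; [case: (hvs2 n)|case: (hus2 n)].
      - exact: L2D.
      rewrite subr0 [\1_B x]indicE; case: (x \in B) => /=; last by rewrite !mul0r normr0.
      rewrite !mul1r normr_id le_eqVlt; apply/orP; left; apply/eqP; congr `|_|; ring.
    rewrite [X in _ --> X](_ : _ = 2 * 0 + 2 * 0); last by ring.
    by apply: cvgD; apply: cvgM => //; exact: cvg_cst.
  have hvu n : L2 (fun x => \1_B x * `|vs n x - us n x|).
    have hD : L2 (fun x => \1_B x * (vs n x - us n x)) by apply/L2B'/L2B.
    apply: (L2_le _ hD) => [|x]; last by rewrite !normrM normr_id.
    apply: measurable_funM => //.
    by apply: measurableT_comp => //; apply: measurable_funB; [case: (hvs2 n)|case: (hus2 n)].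
  have hsg n : L2 (fun x => s x * gs n x) by exact: L2s.
  have hsl n : L2 (fun x => (1 - s x) * alip (us n) x) by exact: L2s.
  have hsG : L2 (fun x => s x * G x) by exact: L2s.
  have hsh : L2 (fun x => (1 - s x) * h x) by exact: L2s.
  have hg' n : L2 (g' n) by apply: L2D; [exact: L2D|exact: L2Z].
  have hg : L2 g by exact: L2D.
  have cg' : cvL2 g' g.
    have c1 := cvL2_mul hgs hG (measurable_cutoff cs) (cs1 _ cs) cgs.
    have c2 := cvL2_mul hl hh (measurable_cutoff csC) (cs1 _ csC) ch.
    have c3 := cvL2_lin 1 1 hsg hsG hsl hsh c1 c2.
    have c4 := cvL2_lin 1 k (fun n => L2_lin 1 1 (hsg n) (hsl n)) (L2_lin 1 1 hsG hsh)
      hvu (@L2_0 _ _ _ m) c3 vu.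
    rewrite (_ : g' = (fun n x => 1 * (1 * (s x * gs n x) + 1 * ((1 - s x) * alip (us n) x)) +
      k * (\1_B x * `|vs n x - us n x|))); last by apply/funext => n; apply/funext => x; rewrite !mul1r.
    rewrite (_ : g = (fun x => 1 * (1 * (s x * G x) + 1 * ((1 - s x) * h x)) + k * 0))//.
    by apply/funext => x; rewrite !mul1r mulr0 addr0.
  have cws : cvL2 ws f.
    apply: (@cvL2_squeeze _ _ _ m _ _ (fun n => 2 * nsq (fun x => \1_B x * (vs n x - f x) - 0)
        + 2 * nsq (fun x => us n x - f x))).
      move=> n; have hA : L2 (fun x => \1_B x * (vs n x - f x)) by apply/L2B'/L2B.
      have hA0 : L2 (fun x => \1_B x * (vs n x - f x) - 0) by apply: L2_ext hA => x; rewrite subr0.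
      have hC : L2 (fun x => us n x - f x) by exact: L2B.
      have hsA := L2s _ _ cs hA0; have hsC := L2s _ _ csC hC.
      rewrite (_ : (fun x => ws n x - f x) = (fun x => s x * (\1_B x * (vs n x - f x) - 0) + (1 - s x) * (us n x - f x))).
        apply: (le_trans (nsqD_le hsA hsC)); apply: lerD; rewrite ler_wpM2l//.
          apply: nsq_le => //; apply: aeW => x; rewrite normrM -[leRHS]mul1r ler_wpM2r//.
          exact: cs1.
        apply: nsq_le => //; apply: aeW => x; rewrite normrM -[leRHS]mul1r ler_wpM2r//.
        exact: (cs1 _ csC).
      by apply/funext => x; rewrite subr0 mulrA sB /ws; ring.
    rewrite [X in _ --> X](_ : _ = 2 * 0 + 2 * 0); last by ring.
    by apply: cvgD; apply: cvgM => //; exact: cvg_cst.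
  have hws n : lip_b (ws n : X -> R) /\ L2 (ws n).
    split; first by apply: lip_b_cut hk s01 _ _; [case: (hus n)|case: (hvs n)].
    by apply: L2D; exact: L2s.
  have lws n x : alip (ws n) x <= g' n x.
    have := @alip_cut _ _ s k (us n) (vs n) x0 r r' hk s01 (ltW k0')
      ltac:(by case: (hus n)) ltac:(by case: (hvs n)) rr s0 x.
    move=> /le_trans; apply; rewrite /g' lerD2r lerD2r.
    have [xB|xB] := pselect (B x); first by apply: ler_wpM2l; [case/andP: (s01 x)|exact: le].
    by rewrite -sB indicE memNset// mulr0 !mul0r.
  have := optimal_relax hf ou hws cws hg' hg lws (fun p hp => cvL2_ip hg' hg hp cg').
  rewrite -subr_ge0 /sqnorm -ipB//.
  congr (_ <= inner _ _ _).
  by apply/funext => x; rewrite /g; ring.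
have key2 k : {ae m, forall x : borel X, 0 <= (h x * (tent x0 (r - k.+1%:R^-1) x * (G x - h x)))}.
  have hGh : L2 (fun x => G x - h x) by exact: L2B.
  apply: ae_ge0_cutoff; first by apply: L2_mul => //; apply: L2s => //; exact: tent_cutoff.
  move=> s cs.
  rewrite (_ : I _ = ip h (fun x => tent x0 (r - k.+1%:R^-1) x * s x * (G x - h x))).
    apply: (key (r - k.+1%:R^-1)); first by rewrite ltrBlDr ltrDl.
      by apply: cutoff_mul => //; exact: tent_cutoff.
    by move=> x /tent0 ->; rewrite mul0r.
  by apply: eq_Rintegral => x _; ring.
have := ae_foralln key2; apply: filterS3 h0 G0 => x h0x G0x kx xB.
have [k hk] : exists k : nat, k.+1%:R^-1 < r - dist x0 x.
  have [|N hN] := @invSn_lt R (r - dist x0 x); first by move: xB; rewrite ballEmdist /= subr_gt0.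
  by exists N; exact: hN.
have tp : 0 < tent x0 (r - k.+1%:R^-1) x by apply: tent_gt0; move: hk; rewrite !ltrBrDr addrC.
(* Where [h] vanishes, the sign of [G] is used instead. *)
move: (h0x); rewrite le_eqVlt => /predU1P[<-|hp]; first exact: G0x.
by have := kx k; rewrite pmulr_rge0// pmulr_rge0// subr_ge0.
Qed.

Lemma ae_balls (P : X -> Prop) x0 :
  (forall r, {ae m, forall x : borel X, ball x0 r x -> P x}) -> {ae m, forall x : borel X, P x}.
Proof.
move=> h; have := ae_foralln (fun n : nat => h n%:R).
apply: filterS => x hx; apply: (hx (Num.truncn (dist x0 x)).+1).
by rewrite ballEmdist /=; exact: truncnS_gt.
Qed.

Lemma H12_lin a b f g : H12 m f -> H12 m g -> H12 m (fun x => a * f x + b * g x).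
Proof.
move=> hf hg; have [us [hus cus hh ch _]] := slope_optimal hf.
have [vs [hvs cvs hk ck _]] := slope_optimal hg.
have hf2 := H12_L2 hf; have hg2 := H12_L2 hg.
have hl n : L2 (alip (us n)) by case: (hus n).
have kl n : L2 (alip (vs n)) by case: (hvs n).
have h2 : L2 (fun x => a * f x + b * g x) by exact: L2_lin.
split; first exact/Lfun2E.
apply: (@le_lt_trans _ _ (2^-1 * nsq (fun x => `|a| * slope m f x + `|b| * slope m g x))%:E);
  last exact: ltry.
apply: (@Ch_le _ _ _ _ (fun n x => a * us n x + b * vs n x)
  (fun n x => `|a| * alip (us n) x + `|b| * alip (vs n) x)) => //.
- by move=> n; case: (lipL2_lin a b (hus n) (hvs n)).
- by apply: (cvL2_lin a b _ hf2 _ hg2 cus cvs) => n; [case: (hus n)|case: (hvs n)].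
- by move=> n; exact: L2_lin.
- exact: L2_lin.
- exact: (cvL2_lin `|a| `|b| hl hh kl hk ch ck).
- by move=> n x; apply: alip_lin; apply: lip_b_lipf; [case: (hus n)|case: (hvs n)].
Qed.

Lemma slope_ge0 f : H12 m f -> {ae m, forall x : borel X, 0 <= slope m f x}.
Proof. by move=> /slope_optimal [us /optimal_ge0]. Qed.

Lemma slope_L2 f : H12 m f -> L2 (slope m f).
Proof. by move=> /slope_optimal [us []]. Qed.

Lemma slope_nsq f : H12 m f -> nsq (slope m f) = 2 * cheeger m f.
Proof. by move=> /slope_optimal [us []]. Qed.

Lemma slope_lin a b f g : H12 m f -> H12 m g ->
  {ae m, forall x : borel X, slope m (fun x => a * f x + b * g x) x <=
    `|a| * slope m f x + `|b| * slope m g x}.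
Proof.
move=> hf hg; have [us [hus cus hh ch _]] := slope_optimal hf.
have [vs [hvs cvs hk ck _]] := slope_optimal hg.
have hf2 := H12_L2 hf; have hg2 := H12_L2 hg.
have hl n : L2 (alip (us n)) by case: (hus n).
have kl n : L2 (alip (vs n)) by case: (hvs n).
have hu2 n : L2 (us n) by case: (hus n).
have hv2 n : L2 (vs n) by case: (hvs n).
have hw n := lipL2_lin a b (hus n) (hvs n).
have cw := cvL2_lin a b hu2 hf2 hv2 hg2 cus cvs.
apply: (@ae_balls _ point) => r.
apply: (@slope_le_local _ (fun n x => a * us n x + b * vs n x)
  (fun n x => `|a| * alip (us n) x + `|b| * alip (vs n) x)) => //.
- exact: H12_lin.
- by move=> n; case: (hw n).
- apply: (@cvL2_squeeze _ _ _ m _ _ (fun n => nsq (fun x => a * us n x + b * vs n x - (a * f x + b * g x)))) => //.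
  move=> n; have hB : L2 (fun x => a * us n x + b * vs n x - (a * f x + b * g x)).
    by apply: L2B; exact: L2_lin.
  have mi : measurable_fun setT (\1_(ball point r) : borel X -> R).
    by apply: measurable_indic; exact: measurable_mball.
  have le x : `|\1_(ball point r) x * (a * us n x + b * vs n x - (a * f x + b * g x)) - 0| <=
    `|a * us n x + b * vs n x - (a * f x + b * g x)|.
    rewrite subr0 normrM -[leRHS]mul1r ler_wpM2r// indicE.
    by case: (_ \in _); rewrite /= ?normr0 ?normr1.
  apply: nsq_le => //; last exact: aeW.
  apply: (L2_le _ hB) => //; apply: measurable_funB => //.
  by apply: measurable_funM => //; case: hB.
- by move=> n; exact: L2_lin.
- exact: L2_lin.
- exact: (cvL2_lin `|a| `|b| hl hh kl hk ch ck).
- by move=> n x _; apply: alip_lin; apply: lip_b_lipf; [case: (hus n)|case: (hvs n)].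
- apply: filterS2 (slope_ge0 hf) (slope_ge0 hg) => x f0 g0 _.
  by rewrite addr_ge0// mulr_ge0.
Qed.

(** An optimal sequence of [g] approximates [f] on the ball, which is all that
    [slope_le_local] requires. *)
Lemma slope_local f g x0 r : H12 m f -> H12 m g -> (forall x, ball x0 r x -> f x = g x) ->
  {ae m, forall x : borel X, ball x0 r x -> slope m f x = slope m g x}.
Proof.
suff le f' g' : H12 m f' -> H12 m g' -> (forall x, ball x0 r x -> f' x = g' x) ->
    {ae m, forall x : borel X, ball x0 r x -> slope m f' x <= slope m g' x}.
  move=> hf hg fg; have h1 := le f g hf hg fg.
  have h2 := le g f hg hf (fun x xB => esym (fg x xB)).
  apply: filterS2 h1 h2 => x k1 k2 xB; apply/eqP.
  by rewrite eq_le k1//; exact: k2.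
move=> hf hg fg; have [us [hus cus hh ch _]] := slope_optimal hg.
have hu2 n : L2 (us n) by case: (hus n).
have hf2 := H12_L2 hf; have hg2 := H12_L2 hg.
apply: (@slope_le_local _ us (fun n => alip (us n))) => //.
- by move=> n; case: (hus n).
- apply: (@cvL2_squeeze _ _ _ m _ _ (fun n => nsq (fun x => us n x - g' x))) => //.
  move=> n; have hB : L2 (fun x => us n x - g' x) by exact: L2B.
  have mi : measurable_fun setT (\1_(ball x0 r) : borel X -> R).
    by apply: measurable_indic; exact: measurable_mball.
  have le x : `|\1_(ball x0 r) x * (us n x - f' x) - 0| <= `|us n x - g' x|.
    rewrite subr0 indicE; have [xB|xB] := pselect (ball x0 r x).
      by rewrite mem_set// mul1r fg.
    by rewrite memNset// mul0r normr0.
  apply: nsq_le => //; last exact: aeW.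
  apply: (L2_le _ hB) => //; apply: measurable_funB => //.
  by apply: measurable_funM => //; apply: measurable_funB; [case: (hu2 n)|case: hf2].
- by move=> n; case: (hus n).
- by apply: filterS (slope_ge0 hg) => x.
Qed.

Section locally_finite.
Hypothesis fin : finite_on_bounded.

Lemma L2_indic_ball x0 r : L2 (\1_(ball x0 r)).
Proof.
have mB := measurable_mball x0 r.
split; first exact: measurable_indic.
apply/integrableP; split.
  by apply/measurable_EFinP/measurable_funM; exact: measurable_indic.
rewrite (_ : (fun x => _) = (fun x => (\1_(ball x0 r : set (borel X)) x)%:E)).
  rewrite integral_indic// setIT; apply: fin => //; by exists x0, r.
apply/funext => x /=; rewrite indicE.
by case: (x \in _); rewrite /= ?mulr1 ?mulr0 ?normr1 ?normr0.
Qed.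

Lemma L2_bounded u x0 r (C : R) : measurable_fun setT u ->
  (forall x, `|u x| <= C) -> (forall x, ~ ball x0 r x -> u x = 0) -> L2 u.
Proof.
move=> mu uC u0; apply: (L2_le mu (L2Z C (L2_indic_ball x0 r))) => x.
rewrite indicE; have [xB|xB] := pselect (ball x0 r x).
  by rewrite mem_set// mulr1 (le_trans (uC x))// ler_norm.
by rewrite u0 ?normr0.
Qed.

Lemma lipL2_bounded u x0 r : lip_b (u : X -> R) -> (forall x, r <= dist x0 x -> u x = 0) ->
  lipL2 m u.
Proof.
move=> lu u0; have [/bounded_fun_normP [C hC] hl] := lu.
have [k k0 hk] := lipf_pos hl.
split => //.
  apply: (@L2_bounded _ x0 r C) => //; first exact: measurable_lipf.
  by move=> x; rewrite ballEmdist /= => /negP; rewrite -leNgt; exact: u0.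
apply: (@L2_bounded _ x0 (r + 1) k); first exact: measurable_alip.
  by move=> x; rewrite ger0_norm ?alip_ge0//; exact: alip_le_k (ltW k0) hk x.
move=> x; rewrite ballEmdist /= => /negP; rewrite -leNgt => xr.
apply/eqP; rewrite eq_le alip_ge0 andbT.
apply: (@alip_le _ _ _ _ _ 1) => // y z; rewrite !ballEmdist /= => xy xz.
have h1 := metric_triangle x0 y x; have h2 := metric_triangle x0 z x.
rewrite (metric_sym y x) in h1; rewrite (metric_sym z x) in h2.
by rewrite !u0 ?subrr ?normr0 ?mul0r//; lra.
Qed.

(** A 1-Lipschitz function of [H12] is bounded on balls, where it coincides with a
    truncation of slope at most 1. *)
Lemma slope_lip_le1 v : k_lipschitz 1 (v : X -> R) -> H12 m v ->
  {ae m, forall x : borel X, slope m v x <= 1}.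
Proof.
move=> lv hv; have hv2 := H12_L2 hv; apply: (@ae_balls _ point) => r.
have [r0|r0] := leP r 0.
  apply: aeW => x; rewrite ballEmdist /= => h; have := mdist_ge0 (point : X) x; lra.
pose C := `|v point| + r.
have C0 : 0 <= C by rewrite addr_ge0// ltW.
pose t x := Num.max (- C) (Num.min C (v x)).
have tC x : `|t x| <= C.
  by rewrite ler_norml /t le_max lexx/= ge_max ge_min lexx/= andbT; lra.
have tv x : ball point r x -> t x = v x.
  rewrite ballEmdist /= => px.
  have : `|v x| <= C.
    rewrite -[v x](subrK (v point)) addrC (le_trans (ler_normD _ _))// lerD2l.
    by rewrite (le_trans (lv _ _))// mul1r metric_sym ltW.
  rewrite ler_norml /t => /andP[h1 h2].
  by rewrite (min_idPr h2) (max_idPr h1).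
have lt : k_lipschitz 1 (t : X -> R).
  apply: k_lipschitz1_max; first exact: k_lipschitz1_cst.
  by apply: k_lipschitz1_min => //; exact: k_lipschitz1_cst.
have lbt : lip_b (t : X -> R) by split; [apply/bounded_fun_normP; exists C|exists 1].
have mt : measurable_fun setT (t : borel X -> R) by apply: measurable_lipf; exists 1.
have ht2 : L2 t.
  apply: (L2_le mt hv2) => x.
  have := ler_norm (v x); have := ler_norm (- v x); rewrite normrN ler_norml /t.
  rewrite /Num.max /Num.min => h1 h2.
  by do 2 case: ifP => //; move=> *; apply/andP; split; lra.
have := @slope_le_local v (fun=> t) (fun=> \1_(ball point r)) (\1_(ball point r)) point r hv
  (fun=> conj lbt ht2) _ (fun=> L2_indic_ball _ _) (L2_indic_ball _ _) (@cvL2_cst _ _ _ m _).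
have -> : (fun (n : nat) (x : borel X) => \1_(ball point r) x * (t x - v x)) = (fun _ _ => 0).
  apply/funext => _; apply/funext => x; rewrite indicE.
  have [xB|xB] := pselect (ball point r x); last by rewrite memNset// mul0r.
  by rewrite tv// subrr mulr0.
move=> /(_ (@cvL2_cst _ _ _ m _)).
have h x : ball point r x -> alip t x <= \1_(ball point r) x.
  by move=> xB; rewrite indicE mem_set//; apply: alip_le_k.
move=> /(_ (fun=> h)) [|N [mN N0 hN]].
  by apply: aeW => x xB; rewrite indicE ler0n.
exists N; split => //; apply: subset_trans hN; apply: subsetC => x /= hx xB.
by rewrite (le_trans (hx xB))// indicE; case: (_ \in _).
Qed.

End locally_finite.
End local.

(** * The scalar product of gradients *)

Section grad.
Context {R : realType} {X : completeMetricType R}.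
Variable m : {measure set (borel X) -> \bar R}.
Implicit Types (f g h u v w : borel X -> R) (us vs ws gs : nat -> borel X -> R).
Local Notation L1 u := (m.-integrable setT (EFin \o u)).
Local Notation I u := (Rintegral m setT u).
Local Notation L2 := (square_integrable m).
Local Notation nsq := (sqnorm m).
Local Notation ip := (inner m).
Local Notation cvL2 := (cvgL2 m).
Local Notation slope := (slope m).
Local Notation cheeger := (cheeger m).

Lemma L1_le_ae u v : measurable_fun setT u -> L1 v ->
  {ae m, forall x, `|u x| <= v x} -> L1 u.
Proof.
move=> mu hv uv; have mv := L1_measurable hv.
apply: (@L1_ae_eq _ _ _ m (fun x => Num.max (- `|v x|) (Num.min `|v x| (u x)))) => //.
  apply: filterS uv => x; rewrite ler_norml => /andP[h1 h2].
  have vx : v x <= `|v x| by exact: ler_norm.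
  by rewrite (min_idPr (le_trans h2 vx)); apply/max_idPr; lra.
have mn : measurable_fun setT (fun x => `|v x|) by exact: measurableT_comp.
apply: (L1_le _ (L1_norm hv)) => [|x].
  apply: measurable_maxr; first exact: (measurable_funN mn).
  exact: measurable_minr.
rewrite ler_norml le_max lexx/= ge_max ge_min lexx andbT/=.
by have := normr_ge0 (v x); lra.
Qed.

Lemma H12D a f g : H12 m f -> H12 m g -> H12 m (fun x => f x + a * g x).
Proof.
move=> hf hg; have := H12_lin 1 a hf hg.
by congr (H12 m _); apply/funext => x; rewrite mul1r.
Qed.

Lemma H12B f g : H12 m f -> H12 m g -> H12 m (fun x => f x - g x).
Proof.
move=> hf hg; have := H12D (-1) hf hg.
by congr (H12 m _); apply/funext => x; rewrite mulN1r.
Qed.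

Lemma cheegerZ a f : H12 m f -> cheeger (fun x => a * f x) <= a ^+ 2 * cheeger f.
Proof.
move=> hf; have hZ : H12 m (fun x => a * f x).
  have := H12_lin a 0 hf hf; congr (H12 m _).
  by apply/funext => x; rewrite mul0r addr0.
have le : {ae m, forall x : borel X, slope (fun x => a * f x) x <= `|a| * slope f x}.
  have := slope_lin a 0 hf hf.
  rewrite (_ : (fun x => a * f x + 0 * f x) = (fun x => a * f x)).
    by apply: filterS => x; rewrite normr0 mul0r addr0.
  by apply/funext => x; rewrite mul0r addr0.
have h2 := slope_L2 hf.
have : nsq (slope (fun x => a * f x)) <= nsq (fun x => `|a| * slope f x).
  apply: nsq_le; [exact: slope_L2|exact: L2Z|].
  apply: filterS2 (slope_ge0 hZ) le => x h1 h3.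
  by rewrite (ger0_norm h1) ger0_norm ?(le_trans h1 h3).
rewrite nsqZ// !slope_nsq// real_normK ?num_real//; lra.
Qed.

Definition slope_quot f v (e : R) x : R :=
  (slope (fun y => f y + e * v y) x ^+ 2 - slope f x ^+ 2) / (2 * e).

(** Sublinearity of the slope and convexity of the square. *)
Lemma slope_convex f v a b t : H12 m f -> H12 m v -> 0 <= t <= 1 ->
  {ae m, forall x : borel X, slope (fun y => f y + ((1 - t) * a + t * b) * v y) x ^+ 2 <=
    (1 - t) * slope (fun y => f y + a * v y) x ^+ 2 +
    t * slope (fun y => f y + b * v y) x ^+ 2}.
Proof.
move=> hf hv /andP[t0 t1]; have ha := H12D a hf hv; have hb := H12D b hf hv.
have hc := H12D ((1 - t) * a + t * b) hf hv.
have := slope_lin (1 - t) t ha hb.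
rewrite (_ : (fun x : X => (1 - t) * (f x + a * v x) + t * (f x + b * v x)) =
  (fun y => f y + ((1 - t) * a + t * b) * v y)); last first.
  by apply/funext => y; ring.
have p := ae_and (slope_ge0 ha) (slope_ge0 hb).
apply: filterS3 p (slope_ge0 hc) => x [a0 b0] c0.
rewrite !ger0_norm ?subr_ge0//.
set A := slope _ x in a0 *; set B := slope _ x in b0 *; set C := slope _ x in c0 *.
move=> le; apply: (@le_trans _ _ (((1 - t) * A + t * B) ^+ 2)).
  by rewrite ler_sqr// qualifE/= (le_trans c0).
have -> : (1 - t) * A ^+ 2 + t * B ^+ 2 =
  ((1 - t) * A + t * B) ^+ 2 + t * (1 - t) * (A - B) ^+ 2 by ring.
by rewrite lerDl; apply: mulr_ge0; rewrite ?sqr_ge0// mulr_ge0// subr_ge0.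
Qed.

(** Difference quotients of the convex function [e |-> slope (f + e * v) ^+ 2]; the middle
    inequality is midpoint convexity at 0. *)
Lemma slope_quot_mono f v d e : H12 m f -> H12 m v -> 0 < d -> d <= e ->
  {ae m, forall x : borel X, [/\ slope_quot f v (- e) x <= slope_quot f v (- d) x,
    slope_quot f v (- d) x <= slope_quot f v d x & slope_quot f v d x <= slope_quot f v e x]}.
Proof.
move=> hf hv d0 de; have e0 : 0 < e by lra.
pose t := d / e; have t01 : 0 <= t <= 1.
  by rewrite divr_ge0 ?(ltW d0) ?(ltW e0)//= ler_pdivrMr// mul1r.
have te : t * e = d by rewrite mulfVK// gt_eqF.
have h1 := slope_convex 0 e hf hv t01.
have h2 := slope_convex 0 (- e) hf hv t01.
have h01 : 0 <= (2^-1 : R) <= 1 by apply/andP; split; lra.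
have h3 := slope_convex (- d) d hf hv h01.
rewrite (_ : (1 - t) * 0 + t * e = d) in h1; last by rewrite mulr0 add0r.
rewrite (_ : (1 - t) * 0 + t * - e = - d) in h2; last by rewrite mulr0 add0r mulrN te.
rewrite (_ : (1 - 2^-1) * - d + 2^-1 * d = 0) in h3; last by field.
rewrite (_ : (fun y => f y + 0 * v y) = f) in h1 h2 h3; last first.
  by apply/funext => y; rewrite mul0r addr0.
apply: filterS3 h1 h2 h3 => x; rewrite /slope_quot.
set S := slope f x; set A := slope _ x; set B := slope _ x; set C := slope _ x; set D := slope _ x.
move=> h1 h2 h3.
have ed : (2 * d)^-1 = (2 * e)^-1 / t by rewrite /t; field; rewrite !gt_eqF.
have t0 : 0 < t by rewrite divr_gt0.
have ie : 0 < (2 * e)^-1 by rewrite invr_gt0 mulr_gt0.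
have id' : 0 < (2 * d)^-1 by rewrite invr_gt0 mulr_gt0.
rewrite !mulrN !invrN !mulrN; split.
- rewrite lerN2 ed mulrA ler_pdivrMr// mulrAC ler_pM2r//; lra.
- by rewrite -mulNr ler_pM2r//; lra.
- by rewrite ed mulrA ler_pdivrMr// mulrAC ler_pM2r//; lra.
Qed.

Lemma slope_quot_L1 f v e : H12 m f -> H12 m v -> L1 (slope_quot f v e).
Proof.
move=> hf hv; have h1 := slope_L2 (H12D e hf hv); have h2 := slope_L2 hf.
have := L1Z (2 * e)^-1 (L1B h1.2 h2.2).
by apply: eq_integrable => // x _; rewrite /slope_quot /=; congr (_%:E); rewrite mulrC.
Qed.

Lemma I_slope_quot f v e : H12 m f -> H12 m v ->
  I (slope_quot f v e) = (cheeger (fun y => f y + e * v y) - cheeger f) / e.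
Proof.
move=> hf hv; have h1 := slope_L2 (H12D e hf hv); have h2 := slope_L2 hf.
rewrite (_ : I _ = I (fun x => (2 * e)^-1 * (slope (fun y => f y + e * v y) x *
   slope (fun y => f y + e * v y) x - slope f x * slope f x))); last first.
  by apply: eq_Rintegral => x _; rewrite /slope_quot mulrC.
rewrite (@RintegralZl _ _ _ m _ _ _ measurableT (L1B h1.2 h2.2)) (RintegralB measurableT)//;
  [|exact: h1.2|exact: h2.2].
rewrite -/(inner m (slope (fun y => f y + e * v y)) (slope (fun y => f y + e * v y))).
rewrite -/(inner m (slope f) (slope f)) -!/(sqnorm _ _) slope_nsq; last exact: H12D.
by rewrite slope_nsq// -mulrBr invfM mulrACA mulVf ?pnatr_eq0// mul1r mulrC.
Qed.

Section quadratic.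
Hypothesis quad : Ch_quadratic m.

Lemma cheeger_parallelogram f g : H12 m f -> H12 m g ->
  cheeger (fun x => f x + g x) + cheeger (fun x => f x - g x) = 2 * cheeger f + 2 * cheeger g.
Proof.
move=> hf hg; have := quad hf.1 hg.1.
have hD : H12 m (fun x => f x + g x).
  have := H12D 1 hf hg; congr (H12 m _); by apply/funext => x; rewrite mul1r.
have hB : H12 m (fun x => f x - g x) by exact: H12B.
rewrite -(cheegerE hf) -(cheegerE hg) -(cheegerE hD) -(cheegerE hB) -!EFinM -!EFinD => -[].
by [].
Qed.

(** The parallelogram law makes the second difference of [Ch] at [f] in direction [v] equal to
    [2 e^2 Ch(v)], so that left and right derivatives cannot differ. *)
Lemma I_slope_quot_gap f v e : H12 m f -> H12 m v -> 0 < e ->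
  I (fun x => slope_quot f v e x - slope_quot f v (- e) x) <= 2 * e * cheeger v.
Proof.
move=> hf hv e0; rewrite (RintegralB measurableT); [|exact: slope_quot_L1..].
rewrite !I_slope_quot//.
have hZ : H12 m (fun x => e * v x).
  have := H12_lin e 0 hv hv; congr (H12 m _).
  by apply/funext => x; rewrite mul0r addr0.
have := cheeger_parallelogram hf hZ.
rewrite (_ : (fun x => f x - e * v x) = (fun x => f x + - e * v x)); last first.
  by apply/funext => x; rewrite mulNr.
have := cheegerZ e hv; rewrite invrN mulrN opprK -mulrDl ler_pdivrMr//.
lra.
Qed.

(** Monotone limits along [e = 1 / (n + 1)]. *)
Lemma slope_quot_lim f v : H12 m f -> H12 m v -> exists h, L1 h /\
  forall e, 0 < e -> {ae m, forall x : borel X, slope_quot f v (- e) x <= h x <= slope_quot f v e x}.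
Proof.
move=> hf hv; pose qn n := slope_quot f v n.+1%:R^-1.
have mqn n : measurable_fun setT (qn n) by apply: L1_measurable; exact: slope_quot_L1.
pose h x := fine (limn_esup (fun n => (qn n x)%:E)).
have mh : measurable_fun setT h.
  apply: measurableT_comp => //; apply: measurable_fun_limn_esup => n.
  exact/measurable_EFinP.
have sq e : 0 < e -> {ae m, forall x : borel X, forall n,
    n.+1%:R^-1 <= e -> slope_quot f v (- e) x <= qn n x <= slope_quot f v e x}.
  move=> e0; apply: ae_foralln => n.
  have [ne|ne] := leP n.+1%:R^-1 e; last by apply: aeW.
  apply: filterS (slope_quot_mono hf hv (invSn_gt0 n) ne) => x [h1 h2 h3] _.
  by rewrite h3 (le_trans h1).
have dec : {ae m, forall x : borel X, forall n, qn n.+1 x <= qn n x}.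
  apply: ae_foralln => n.
  have le : n.+2%:R^-1 <= n.+1%:R^-1 :> R by rewrite lef_pV2 ?qualifE/= ?ltr0n// ler_nat.
  by apply: filterS (slope_quot_mono hf hv (invSn_gt0 n.+1) le) => x [].
have ch : {ae m, forall x : borel X, qn n x @[n --> \oo] --> h x}.
  apply: filterS2 dec (sq 1 ltr01) => x dx sx.
  have cq : cvgn (qn ^~ x).
    apply: nonincreasing_is_cvgn; first exact/nonincreasing_seqP.
    exists (slope_quot f v (-1) x) => _ [n _ <-].
    have [|//] := andP (sx n _); by rewrite invf_le1 ?ler1n.
  have : (qn n x)%:E @[n --> \oo] --> (limn (qn ^~ x))%:E by exact: cvg_EFinr cq.
  by move=> /cvg_limn_einf_sup [_ E]; rewrite /h E.
have bd e : 0 < e -> {ae m, forall x : borel X, slope_quot f v (- e) x <= h x <= slope_quot f v e x}.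
  move=> e0; apply: filterS2 ch (sq e e0) => x cx sx.
  have [N hN] := invSn_lt e0.
  rewrite -(cvg_lim _ cx)//; apply/andP; split.
    by apply: limr_ge; [exact: cvgP cx|exists N => // n /= /hN /ltW /sx /andP[]].
  by apply: limr_le; [exact: cvgP cx|exists N => // n /= /hN /ltW /sx /andP[]].
exists h; split => //.
have i1 := L1_norm (slope_quot_L1 1 hf hv); have i2 := L1_norm (slope_quot_L1 (- 1) hf hv).
apply: (L1_le_ae mh (L1D i1 i2)); apply: filterS (bd 1 ltr01) => x /andP[h1 h2].
have := ler_norm (slope_quot f v 1 x); have := ler_norm (- slope_quot f v (- 1) x); rewrite normrN.
have := normr_ge0 (slope_quot f v 1 x); have := normr_ge0 (slope_quot f v (-1) x).
by rewrite ler_norml => *; apply/andP; split; lra.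
Qed.

Lemma slope_quot_lim_dist f v h e : H12 m f -> H12 m v -> L1 h ->
  {ae m, forall x : borel X, slope_quot f v (- `|e|) x <= h x <= slope_quot f v `|e| x} -> e != 0 ->
  I (fun x => `|slope_quot f v e x - h x|) <= 2 * `|e| * cheeger v.
Proof.
move=> hf hv hh bd e0; have ep : 0 < `|e| by rewrite normr_gt0.
apply: le_trans (I_slope_quot_gap hf hv ep); apply: I_le_ae.
- by apply: L1_norm; apply: L1B => //; exact: slope_quot_L1.
- by apply: L1B; exact: slope_quot_L1.
apply: filterS2 bd (slope_quot_mono hf hv ep (lexx _)) => x /andP[h1 h2] [_ h3 _].
have [ee|ee] := lerP 0 e.
  by rewrite ger0_norm in h1 h2 h3 *; rewrite ?ler_norml; try (apply/andP; split); lra.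
by rewrite ltr0_norm// ?opprK in h1 h2 h3 *; rewrite ?ler_norml; try (apply/andP; split); lra.
Qed.

Lemma is_grad_prodP f v h : H12 m f -> H12 m v ->
  is_grad_prod m f v h <-> L1 h /\
  (forall e, 0 < e -> exists2 d, 0 < d & forall t, t != 0 -> `|t| < d ->
     I (fun x => `|slope_quot f v t x - h x|) < e).
Proof.
move=> hf hv; split.
  move=> [/Lfun1_integrable hh /fine_cvgP [_ c]]; split => // e e0.
  move/cvgrPdist_lt : c => /(_ e e0) [d /= d0 hd]; exists d => // t t0 td.
  have := hd t; rewrite /= sub0r normrN => /(_ td t0).
  rewrite sub0r normrN Lnorm1E /=; last by apply: L1B => //; exact: slope_quot_L1.
  by apply: le_lt_trans; exact: ler_norm.
move=> [hh c]; split; first exact/Lfun1_integrable.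
rewrite (_ : (fun e => _) = (fun e => (I (fun x => `|slope_quot f v e x - h x|))%:E)); last first.
  by apply/funext => t; rewrite -Lnorm1E//; apply: L1B => //; exact: slope_quot_L1.
apply/fine_cvgP; split; first exact: nearW.
apply/cvgrPdist_lt => e e0; have [d d0 hd] := c e e0.
exists d => // t /=; rewrite sub0r normrN => td t0.
rewrite sub0r normrN ger0_norm; first exact: hd.
by apply: Rintegral_ge0 => x _.
Qed.

(** The limit exists by [slope_quot_lim], and is unique in L^1, so that the representative
    chosen by [grad_prod] inherits the bounds. *)
Lemma grad_prod_squeeze f v : H12 m f -> H12 m v -> L1 (grad_prod m f v) /\
  forall e, 0 < e -> {ae m, forall x : borel X,
    slope_quot f v (- e) x <= grad_prod m f v x <= slope_quot f v e x}.
Proof.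
move=> hf hv; have [h [hh bd]] := slope_quot_lim hf hv.
have c0 := cheeger_ge0 m v.
have gh : is_grad_prod m f v h.
  apply/is_grad_prodP => //; split => // e e0.
  exists (e / (2 * (cheeger v + 1))); first by rewrite divr_gt0// mulr_gt0//; lra.
  move=> t t0; rewrite ltr_pdivlMr ?mulr_gt0//; last lra.
  have tp : 0 < `|t| by rewrite normr_gt0.
  have := slope_quot_lim_dist hf hv hh (bd _ tp) t0; nra.
have : is_grad_prod m f v (grad_prod m f v).
  by apply: (@xgetPex _ (cst 0) [set h | is_grad_prod m f v h]); exists h.
move=> /(is_grad_prodP _ hf hv) [hG cG]; split => // e e0.
have /(is_grad_prodP _ hf hv) [_ ch] := gh.
suff : {ae m, forall x : borel X, `|grad_prod m f v x - h x| = 0}.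
  by apply: filterS2 (bd e e0) => x le /eqP; rewrite normr_eq0 subr_eq0 => /eqP ->.
have hB := L1_norm (L1B hG hh).
apply: I_eq0_ae => //; apply/ler_addgt0Pr => eps eps0; rewrite add0r.
have [d1 d10 h1] := cG (eps / 2) ltac:(lra); have [d2 d20 h2] := ch (eps / 2) ltac:(lra).
pose t := Num.min d1 d2 / 2.
have t0 : 0 < t by rewrite divr_gt0// lt_min d10.
have [td1 td2] : `|t| < d1 /\ `|t| < d2.
  have [m1 m2] : Num.min d1 d2 <= d1 /\ Num.min d1 d2 <= d2 by rewrite !ge_min !lexx orbT.
  by rewrite (ger0_norm (ltW t0)); rewrite /t in t0 *; split; lra.
have k1 := h1 t (lt0r_neq0 t0) td1; have k2 := h2 t (lt0r_neq0 t0) td2.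
have i1 := L1_norm (L1B (slope_quot_L1 t hf hv) hG); have i2 := L1_norm (L1B (slope_quot_L1 t hf hv) hh).
apply: (@le_trans _ _ (I (fun x => `|slope_quot f v t x - grad_prod m f v x| + `|slope_quot f v t x - h x|))).
  apply: I_le_ae => //; first exact: L1D.
  by apply: aeW => x; rewrite -(distrC (grad_prod m f v x)) ler_distD.
by rewrite (RintegralD measurableT)//; lra.
Qed.

Lemma ler_lim_invSn (a b c : R) (N : nat) :
  (forall n, (N <= n)%N -> a <= b + c * n.+1%:R^-1) -> a <= b.
Proof.
move=> h; apply/ler_addgt0Pr => e e0.
have [|M hM] := @invSn_lt R (e / (`|c| + 1)).
  by rewrite divr_gt0// ltr_wpDl.
have := hM (maxn N M) (leq_maxr _ _); have := h _ (leq_maxl N M).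
rewrite ltr_pdivlMr ?ltr_wpDl// => le lt.
apply: (le_trans le); rewrite lerD2l.
have p0 := invSn_gt0 (R := R) (maxn N M).
apply: (le_trans (ler_wpM2r (ltW p0) (ler_norm c))).
by move: (_^-1) lt p0 => p lt p0; lra.
Qed.

(** Sublinearity bounds the quotients at [1 / (n + 1)] and [- 1 / (n + 1)] by
    [slope f * slope v] up to an error of order [1 / n]. *)
Lemma grad_prod_le f v : H12 m f -> H12 m v ->
  {ae m, forall x : borel X, `|grad_prod m f v x| <= slope f x * slope v x}.
Proof.
move=> hf hv; have [_ sq] := grad_prod_squeeze hf hv.
have h1 : {ae m, forall x : borel X, forall n, slope_quot f v (- n.+1%:R^-1) x <=
    grad_prod m f v x <= slope_quot f v n.+1%:R^-1 x}.
  by apply: ae_foralln => n; apply/sq; exact: invSn_gt0.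
have h2 a : {ae m, forall x : borel X, 0 <= slope (fun y => f y + a * v y) x <= slope f x + `|a| * slope v x}.
  have := slope_lin 1 a hf hv.
  rewrite (_ : (fun y => 1 * _ + _) = (fun y => f y + a * v y)).
    by apply: filterS2 (slope_ge0 (H12D a hf hv)) => x ->; rewrite normr1 mul1r.
  by apply/funext => y; rewrite mul1r.
have h3 : {ae m, forall x : borel X, forall n,
    0 <= slope (fun y => f y + n.+1%:R^-1 * v y) x <= slope f x + `|n.+1%:R^-1| * slope v x /\
    0 <= slope (fun y => f y + - n.+1%:R^-1 * v y) x <= slope f x + `|- n.+1%:R^-1| * slope v x}.
  by apply: ae_foralln => n; exact: ae_and.
apply: filterS3 h1 h3 (ae_and (slope_ge0 hf) (slope_ge0 hv)) => x h1 h3 [S0 V0].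
rewrite ler_norml; set S := slope f x in h3 S0 *; set V := slope v x in h3 V0 *.
apply/andP; split.
  rewrite lerNl; apply: (@ler_lim_invSn _ _ (V ^+ 2) 0%N) => n _.
  have /andP[k1 _] := h1 n; have [_ /andP[k2 k3]] := h3 n.
  move: k1; rewrite /slope_quot -/S; set A := slope _ x in k2 k3 *.
  have e0 := invSn_gt0 (R := R) n; set e := n.+1%:R^-1 in e0 k3 *.
  rewrite normrN gtr0_norm// in k3.
  rewrite mulrN invrN mulrN lerNl => /le_trans; apply.
  rewrite ler_pdivrMr ?mulr_gt0//.
  have : A ^+ 2 <= (S + e * V) ^+ 2 by rewrite ler_sqr// qualifE/= ?(le_trans k2).
  have : 0 <= e ^+ 2 * V ^+ 2 by rewrite mulr_ge0 ?sqr_ge0.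
  by lra.
apply: (@ler_lim_invSn _ _ (V ^+ 2) 0%N) => n _.
have /andP[_ k1] := h1 n; have [/andP[k2 k3] _] := h3 n.
move: k1; rewrite /slope_quot -/S; set A := slope _ x in k2 k3 *.
have e0 := invSn_gt0 (R := R) n; set e := n.+1%:R^-1 in e0 k3 *.
rewrite gtr0_norm// in k3.
move=> /le_trans; apply; rewrite ler_pdivrMr ?mulr_gt0//.
have : A ^+ 2 <= (S + e * V) ^+ 2 by rewrite ler_sqr// qualifE/= ?(le_trans k2).
have : 0 <= e ^+ 2 * V ^+ 2 by rewrite mulr_ge0 ?sqr_ge0.
by lra.
Qed.

(** If [v] is a multiple [c * w] on a ball then [f - e * v] is there a combination of [f]
    and [w - f], whose slope is controlled by sublinearity. *)
Lemma grad_prod_ge_ball f v w c (x0 : X) r : H12 m f -> H12 m v -> H12 m w -> 0 < c ->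
  (forall x, ball x0 r x -> v x = c * w x) ->
  {ae m, forall x : borel X, ball x0 r x ->
    c * (slope f x ^+ 2 - slope f x * slope (fun y => w y - f y) x) <= grad_prod m f v x}.
Proof.
move=> hf hv hw c0 vw; have [_ sq] := grad_prod_squeeze hf hv.
have hB : H12 m (fun x => w x - f x) by exact: H12B.
have h1 : {ae m, forall x : borel X, forall n, slope_quot f v (- n.+1%:R^-1) x <=
    grad_prod m f v x <= slope_quot f v n.+1%:R^-1 x}.
  by apply: ae_foralln => n; apply/sq; exact: invSn_gt0.
have h2 : {ae m, forall x : borel X, forall n, ball x0 r x ->
    0 <= slope (fun y => f y + - n.+1%:R^-1 * v y) x <=
    `|1 - n.+1%:R^-1 * c| * slope f x + n.+1%:R^-1 * c * slope (fun y => w y - f y) x}.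
  apply: ae_foralln => n.
  have e0 := invSn_gt0 (R := R) n; set e := n.+1%:R^-1 in e0 *.
  have k1 := slope_lin (1 - e * c) (- (e * c)) hf hB.
  have hv' := H12D (- e) hf hv.
  have fg y : ball x0 r y -> f y + - e * v y = (1 - e * c) * f y + - (e * c) * (w y - f y).
    by move=> yB; rewrite vw//; ring.
  have k2 := slope_local hv' (H12_lin (1 - e * c) (- (e * c)) hf hB) fg.
  apply: filterS3 k1 k2 (slope_ge0 hv') => x k1 k2 -> xB /=.
  rewrite k2//; apply: (le_trans k1).
  by rewrite normrN (@gtr0_norm _ (e * c)) ?mulr_gt0.
apply: filterS3 h1 h2 (ae_and (slope_ge0 hf) (slope_ge0 hB)) => x h1 h2 [S0 r0] xB.
set S := slope f x in h2 S0 *; set rr := slope _ x in r0 *.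
have [N hN] := invSn_lt (ltac:(by rewrite invr_gt0) : 0 < c^-1).
apply: (@ler_lim_invSn _ _ (c ^+ 2 * (S ^+ 2 + rr ^+ 2)) N) => k /hN kN.
have /andP[k1 _] := h1 k; have /andP[k2 k3] := h2 k xB.
rewrite -lerBlDr; apply: le_trans k1.
rewrite /slope_quot -/S; set A := slope _ x in k2 k3 *.
have e0 := invSn_gt0 (R := R) k; set e := k.+1%:R^-1 in e0 kN k3 *.
have ec : e * c < 1 by rewrite -ltr_pdivlMr// div1r.
have ec0 : 0 < e * c by rewrite mulr_gt0.
rewrite ger0_norm in k3; last lra.
rewrite mulrN invrN mulrN -mulNr ler_pdivlMr ?mulr_gt0// opprB.
have : A ^+ 2 <= ((1 - e * c) * S + e * c * rr) ^+ 2.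
  by rewrite ler_sqr// qualifE/= ?(le_trans k2).
set a := e * c in ec ec0 *.
have -> : (c * (S ^+ 2 - S * rr) - c ^+ 2 * (S ^+ 2 + rr ^+ 2) * e) * (2 * e) =
  2 * a * (S ^+ 2 - S * rr) - 2 * a ^+ 2 * (S ^+ 2 + rr ^+ 2) by rewrite /a; ring.
have : 0 <= a ^+ 2 * (S + rr) ^+ 2 by rewrite mulr_ge0 ?sqr_ge0.
by lra.
Qed.

(** In [Ch(us n - f) = 2 Ch(us n) + 2 Ch(f) - Ch(us n + f)], the energies of [us n] converge to
    that of [f], and the lower limit of the last term is at least [Ch(2 f) = 4 Ch(f)]. *)
Lemma optimal_cvg_slope f us h : H12 m f -> optimal m f us h ->
  cvL2 (fun n => slope (fun x => us n x - f x)) (fun=> 0).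
Proof.
have aux1 (x a b c : R) : a < c / 4 -> b < c / 4 -> x <= 2 * a + 2 * b -> x < c by lra.
(* The final arithmetic: [P], [Q] stand for the energies of [us n + f] and [us n - f], [U], [F], [C]
   for those of [us n], [f] and [2 f], and [W] for twice an approximate energy of [us n + f]. *)
have aux2 (P Q U F N W C e : R) : P + Q = 2 * U + 2 * F -> U <= 2^-1 * N ->
  0 < e -> N < 2 * F + e / 8 -> W < 2 * P + e / 8 -> 4 * F <= C -> 2 * C - e / 8 < W ->
  2 * Q < e by lra.
move=> hf ou; have [hus cus hh ch nh] := ou; have hf2 := H12_L2 hf.
have hu2 n : L2 (us n) by case: (hus n).
have hla n : L2 (alip (us n)) by case: (hus n).
have hu n : H12 m (us n) by case: (H12_lipL2 (hus n)).
have hB n : H12 m (fun x => us n x - f x) by exact: H12B.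
have hD n : H12 m (fun x => us n x + f x).
  have := H12D 1 (hu n) hf; congr (H12 m _); by apply/funext => x; rewrite mul1r.
have h2f : H12 m (fun x => 2 * f x).
  have := H12_lin 2 0 hf hf; congr (H12 m _); by apply/funext => x; rewrite mul0r addr0.
have c2f : 4 * cheeger f <= cheeger (fun x => 2 * f x).
  have := cheegerZ 2^-1 h2f.
  rewrite (_ : (fun x => _) = f); last by apply/funext => x; rewrite mulrA mulVf// mul1r.
  have -> : (2^-1 : R) ^+ 2 = 4^-1 by field.
  lra.
apply/cvL2P => e e0.
have [de de0 low] := cheeger_lower h2f (ltac:(lra) : 0 < e / 8).
move/cvL2P : (cus) => /(_ (de / 4) ltac:(lra)) [N1 hN1].
have [N2 hN2] : exists N, forall n, (N <= n)%N -> nsq (alip (us n)) < 2 * cheeger f + e / 8.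
  have := cvL2_nsq hla hh ch; rewrite nh => /cvgrPdist_lt /(_ (e / 8) ltac:(lra)) [N _ hN].
  by exists N => n /hN /=; rewrite ltr_norml => /andP[]; lra.
exists (maxn N1 N2) => n; rewrite geq_max => /andP[/hN1 n1 /hN2 n2].
rewrite (_ : (fun x => _ - 0) = slope (fun x => us n x - f x)); last first.
  by apply/funext => x; rewrite subr0.
rewrite slope_nsq//.
have par := cheeger_parallelogram (hu n) hf.
have [_ cu] := H12_lipL2 (hus n).
have [w [hw w1 w2]] := cheeger_approx (hD n) (ltac:(lra) : 0 < e / 8) (ltac:(lra) : 0 < de / 4).
have [_ hw2 _] := hw.
have : nsq (fun x => w x - 2 * f x) < de.
  have := nsqD_le (L2B hw2 (H12_L2 (hD n))) (L2B (hu2 n) hf2).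
  rewrite (_ : (fun x => _ + _) = (fun x => w x - 2 * f x)); first exact: aux1.
  by apply/funext => x; ring.
by move=> /(low w hw) lw; exact: (aux2 _ _ _ _ _ _ _ e par cu e0 n2 w2 c2f lw).
Qed.

End quadratic.
End grad.

(** * The slope as a countable supremum *)

Section mcshane.
Context {R : realType} {X : completeMetricType R}.
Implicit Types (phi u v : X -> R) (x y z : X).
Local Notation dist := (@mdist R X).

(** McShane extension, truncated by a cone to have bounded support. *)
Lemma mcshane phi (x0 : X) (r C : R) : 0 < r -> (forall x, `|phi x| <= C) ->
  lip_on phi (ball x0 r) 1 ->
  exists v, [/\ k_lipschitz 1 v, lip_b v, forall x, ball x0 r x -> v x = phi x &
    forall x, C + r <= dist x0 x -> v x = 0].
Proof.
move=> r0 hC hphi; have C0 : 0 <= C by rewrite (le_trans _ (hC x0)).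
pose S x := [set phi y + dist x y | y in ball x0 r].
have hS x : has_inf (S x).
  split; first by exists (phi x0 + dist x x0), x0 => //; exact: ballxx.
  exists (- C) => _ [y _ <-]; have := hC y; rewrite ler_norml => /andP[h _].
  by have := mdist_ge0 x y; lra.
pose e x := inf (S x).
have le x y : k_lipschitz 1 e.
  apply: k_lipschitz1P => {}x {}y; rewrite lerBlDl -lerBlDr.
  apply: lb_le_inf; first by case: (hS y).
  move=> _ [z zB <-]; rewrite lerBlDr.
  apply: (@le_trans _ _ (phi z + dist x z)); first by apply: (ge_inf (hS x).2); exists z.
  by rewrite -addrA lerD2l addrC metric_triangle.
have ephi x : ball x0 r x -> e x = phi x.
  move=> xB; apply/eqP; rewrite eq_le; apply/andP; split.
    by apply: (ge_inf (hS x).2); exists x => //; rewrite mdistxx addr0.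
  apply: lb_le_inf; first by case: (hS x).
  move=> _ [z zB <-]; have := hphi x z xB zB; rewrite mul1r ler_norml => /andP[_ ?]; lra.
pose t x := Num.max 0 (C + r - dist x0 x).
have lt : k_lipschitz 1 t.
  apply: k_lipschitz1_max; first exact: k_lipschitz1_cst.
  apply: k_lipschitz1P => x y.
  by have := metric_triangle x0 x y; lra.
have t0 x : 0 <= t x by rewrite le_max lexx.
have tM x : t x <= C + r.
  by rewrite ge_max; have := mdist_ge0 x0 x; move=> ?; apply/andP; split; lra.
pose v x := Num.max (- t x) (Num.min (e x) (t x)).
have lv : k_lipschitz 1 v.
  apply: k_lipschitz1_max; first exact: k_lipschitz1N.
  by apply: k_lipschitz1_min => //; exact: le.
have vt x : `|v x| <= t x.
  rewrite ler_norml le_max lexx/= ge_max ge_min lexx orbT andbT.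
  by have := t0 x; lra.
exists v; split => //.
- split; last by exists 1.
  by apply/bounded_fun_normP; exists (C + r) => x; rewrite (le_trans (vt x)).
- move=> x xB; rewrite /v ephi//.
  have Ct : C <= t x.
    by rewrite le_max; apply/orP; right; move: xB; rewrite ballEmdist /= => xB; lra.
  have := hC x; rewrite ler_norml => /andP[h1 h2].
  by rewrite (min_idPl (le_trans h2 Ct)); apply/max_idPr; lra.
- move=> x xr; have tx : t x = 0 by apply/max_idPl; lra.
  by apply/eqP; rewrite -normr_le0 -tx.
Qed.

Lemma dense_seq : separable_space X -> exists D : nat -> X,
  forall x (r : R), 0 < r -> exists i, ball (D i) r x.
Proof.
move=> [A /countable_injP [f finj] dA].
have ex i : exists x, (exists2 a, A a & f a = i) -> A x /\ f x = i.
  by have [[a Aa fa]|h] := pselect (exists2 a, A a & f a = i); [exists a|exists point].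
have [D hD] := choice ex; exists D => x r r0.
have [|y [yB Ay]] := dA (ball x r) (ex_intro _ x (ballxx x r0)).
  apply: openP => y; rewrite ballEmdist /= => xy.
  exists (r - dist x y); split; first by rewrite subr_gt0.
  by move=> z; rewrite !ballEmdist /= => yz; have := metric_triangle x y z; lra.
exists (f y); have [AD fD] := hD (f y) (ex_intro2 _ _ y Ay erefl).
have -> : D (f y) = y by apply: finj; rewrite ?inE.
exact: ball_sym.
Qed.

End mcshane.

Lemma grid (R : realType) (a e : R) : 0 <= a -> 0 < e ->
  exists j k, a < j.+1%:R / k.+1%:R < a + e.
Proof.
move=> a0 e0; have [k hk] := invSn_lt e0.
have {}hk := hk k (leqnn k).
have k0 : 0 < k.+1%:R :> R by rewrite ltr0n.
exists (Num.truncn (a * k.+1%:R)), k.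
have /andP[h1 h2] := truncn_itv (mulr_ge0 a0 (ltW k0)).
rewrite ltr_pdivlMr// h2/= ltr_pdivrMr// mulrDl -natr1.
have : 1 < e * k.+1%:R by rewrite -ltr_pdivrMr// div1r.
lra.
Qed.

Section family.
Context {R : realType} {X : completeMetricType R}.
Variable m : {measure set (borel X) -> \bar R}.
Implicit Types (f g h u v w : borel X -> R) (us vs ws gs : nat -> borel X -> R).
Local Notation L1 u := (m.-integrable setT (EFin \o u)).
Local Notation I u := (Rintegral m setT u).
Local Notation L2 := (square_integrable m).
Local Notation nsq := (sqnorm m).
Local Notation cvL2 := (cvgL2 m).
Local Notation slope := (slope m).
Hypothesis quad : Ch_quadratic m.
Hypothesis fin : finite_on_bounded m.
Hypothesis sep : separable_space X.

Lemma grad_prod_lip_le f v : H12 m f -> k_lipschitz 1 (v : X -> R) -> H12 m v ->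
  {ae m, forall x : borel X, `|grad_prod m f v x| <= slope f x}.
Proof.
move=> hf lv hv; have s0 := slope_ge0 hf.
apply: filterS3 s0 (slope_lip_le1 fin lv hv) (grad_prod_le quad hf hv) => x s0 v1 le.
by rewrite (le_trans le)// -[leRHS]mulr1 ler_wpM2l.
Qed.

(** A McShane extension of [u / L]. When [u] is not [L]-Lipschitz on the ball, [v] is 0 and the
    last clause is void; in this form the choice of [v] is uniform in the data. *)
Lemma local_test u (x0 : X) (r L : R) : lip_b (u : X -> R) -> 0 < r -> 0 < L ->
  exists v : X -> R, [/\ k_lipschitz 1 v, H12 m v &
    lip_on u (ball x0 r) L -> forall x, ball x0 r x -> v x = L^-1 * u x].
Proof.
move=> [/bounded_fun_normP [C hC] _] r0 L0.
have H v : lip_b v -> (exists s, forall x, s <= mdist x0 x -> v x = 0) -> H12 m v.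
  by move=> lv [s hs]; have [] := H12_lipL2 (lipL2_bounded fin lv hs).
have [lu|nlu] := pselect (lip_on u (ball x0 r) L); last first.
  exists (fun=> 0); split => //; first exact: k_lipschitz1_cst.
  by apply: H; [exact: lip_b0|exists 0].
have [| |v [v1 v2 v3 v4]] := @mcshane _ _ (fun x => L^-1 * u x) x0 r (L^-1 * C) r0.
- by move=> x; rewrite normrM gtr0_norm ?invr_gt0// ler_wpM2l// invr_ge0 ltW.
- move=> y z yB zB; rewrite -mulrBr normrM gtr0_norm ?invr_gt0// mul1r.
  by rewrite -ler_pdivlMl ?invr_gt0// invrK lu.
by exists v; split => //; apply: H => //; exists (L^-1 * C + r).
Qed.

(** The test functions are those of [local_test] for the members [us n] of an optimal
    sequence, the grid of constants [(j + 1) / (k + 1)], and balls of radius [1 / (l + 1)] around the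
    points of a dense sequence. *)
Lemma slope_countable_sup f : H12 m f -> exists vs : nat -> X -> R,
  (forall i, k_lipschitz 1 (vs i) /\ H12 m (vs i)) /\
  {ae m, forall x : borel X, forall e, 0 < e -> exists i, slope f x - e < grad_prod m f (vs i) x}.
Proof.
move=> hf; have [us ou] := slope_optimal hf; have [hus cus hS cS _] := ou.
have cr := optimal_cvg_slope quad hf ou.
have hf2 := H12_L2 hf.
have hla n : L2 (alip (us n)) by case: (hus n).
have hu n : H12 m (us n) by case: (H12_lipL2 (hus n)).
have hB n : H12 m (fun x => us n x - f x) by exact: H12B.
pose r n := slope (fun x => us n x - f x).
have hr n : L2 (r n) by exact: slope_L2.
have [D hD] := dense_seq sep.
pose Lip (j k : nat) : R := j.+1%:R / k.+1%:R.
have L0 j k : 0 < Lip j k by rewrite divr_gt0 ?ltr0n.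
pose rad (l : nat) : R := l.+1%:R^-1.
have exV (idx : nat * nat * nat * nat * nat) : exists v : X -> R,
    [/\ k_lipschitz 1 v, H12 m v &
      let: (n, j, k, i, l) := idx in
      lip_on (us n) (ball (D i) (rad l)) (Lip j k) ->
      forall x, ball (D i) (rad l) x -> v x = (Lip j k)^-1 * us n x].
  case: idx => -[[[n j] k] i] l; apply: local_test => //; first by case: (hus n).
  exact: invSn_gt0.
have [V hV] := choice exV.
pose vs (i : nat) := V (odflt (0%N, 0%N, 0%N, 0%N, 0%N) (unpickle i)).
have hvs i : k_lipschitz 1 (vs i) /\ H12 m (vs i).
  by rewrite /vs; case: (hV (odflt (0%N, 0%N, 0%N, 0%N, 0%N) (unpickle i))).
exists vs; split => //.
have low : {ae m, forall x : borel X, forall n j k i l,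
    lip_on (us n) (ball (D i) (rad l)) (Lip j k) -> ball (D i) (rad l) x ->
    (Lip j k)^-1 * (slope f x ^+ 2 - slope f x * r n x) <=
      grad_prod m f (V (n, j, k, i, l)) x}.
  apply: ae_foralln => n; apply: ae_foralln => j; apply: ae_foralln => k.
  apply: ae_foralln => i; apply: ae_foralln => l.
  have [lu|nlu] := pselect (lip_on (us n) (ball (D i) (rad l)) (Lip j k)); last by apply: aeW.
  have [_ hv vE] := hV (n, j, k, i, l).
  have L0' : 0 < (Lip j k)^-1 by rewrite invr_gt0.
  have := grad_prod_ge_ball quad hf hv (hu n) L0' (vE lu).
  by apply: filterS => x h _ xB; exact: h.
(* One sequence for both quantities, so that a single subsequence serves both. *)
pose W n x := `|alip (us n) x - slope f x| + `|r n x|.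
have [phi cphi] : exists phi : nat -> nat,
    {ae m, forall x : borel X, W (phi n) x @[n --> \oo] --> (0 : R)}.
  have mW n : L2 (fun x => `|alip (us n) x - slope f x|).
    have hE : L2 (fun x => alip (us n) x - slope f x) by exact: L2B.
    by apply: (L2_le _ hE) => [|x]; [apply: measurableT_comp => //; case: hE|rewrite normr_id].
  have mr n : L2 (fun x => `|r n x|).
    by apply: (L2_le _ (hr n)) => [|x]; [apply: measurableT_comp => //; case: (hr n)|rewrite normr_id].
  have hW n : L2 (W n) by exact: L2D.
  apply: (cvL2_ae_subseq hW (@L2_0 _ _ _ m)).
  apply: (@cvL2_squeeze _ _ _ m _ _ (fun n => 2 * nsq (fun x => alip (us n) x - slope f x)
    + 2 * nsq (fun x => r n x - 0))).
    move=> n; rewrite (_ : (fun x => W n x - 0) = W n); last by apply/funext => x; rewrite subr0.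
    rewrite (_ : (fun x => r n x - 0) = r n); last by apply/funext => x; rewrite subr0.
    apply: (le_trans (nsqD_le (mW n) (mr n))).
    apply: lerD; apply: ler_wpM2l => //; apply: nsq_le => //; try exact: L2B;
      by apply: aeW => x; rewrite normr_id.
  rewrite [X in _ --> X](_ : _ = 2 * 0 + 2 * 0); last by ring.
  by apply: cvgD; apply: cvgM => //; exact: cvg_cst.
have bnd : {ae m, forall x : borel X, forall i, `|grad_prod m f (vs i) x| <= slope f x}.
  by apply: ae_foralln => i; have [? ?] := hvs i; exact: grad_prod_lip_le.
apply: filterS3 low (ae_and bnd (slope_ge0 hf)) cphi => x lowx [bx S0] cW e e0.
set S := slope f x in lowx bx S0 *.
move: S0; rewrite le_eqVlt => /predU1P[S0|S0].
  (* Where the slope vanishes, so does every [grad_prod]. *)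
  exists 0%N; have := bx 0%N; rewrite -S0 normr_le0 => /eqP ->; lra.
(* With these bounds [(S - e) * (S + 2 * eta) < S ^+ 2 - S * eta]. *)
pose eta := Num.min (S / 2) (e / 3).
have eta0 : 0 < eta by rewrite lt_min !divr_gt0.
have [etaS etae] : eta <= S / 2 /\ eta <= e / 3 by rewrite !ge_min !lexx orbT.
move/cvgrPdist_lt : cW => /(_ eta eta0) [N0 _ /(_ N0 (leqnn N0))] /=.
set n := phi N0; rewrite sub0r normrN ger0_norm; last by rewrite addr_ge0.
move=> Wn; have n1 := normr_ge0 (alip (us n) x - slope f x); have n2 := normr_ge0 (r n x).
have la_x : alip (us n) x < S + eta.
  by have := ler_norm (alip (us n) x - slope f x); rewrite /W -/S in Wn n1 *; lra.
have r_x : r n x < eta.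
  by have := ler_norm (r n x); rewrite /W in Wn; lra.
have fu : lipf (us n : X -> R) by case: (hus n) => /lip_b_lipf.
have [j [k /andP[aL La]]] := grid (alip_ge0 (us n) x) eta0.
rewrite -/(Lip j k) in aL La; have Lp := L0 j k.
have [s [s0 hs]] := alip_lt fu aL.
have [l hl] := invSn_lt (ltac:(by rewrite divr_gt0) : 0 < s / 2).
have {}hl : rad l < s / 2 by exact: hl.
have [i xi] := hD x (rad l) (invSn_gt0 l).
have lu : lip_on (us n) (ball (D i) (rad l)) (Lip j k).
  move=> y z; rewrite !ballEmdist /= => yi zi.
  move: xi; rewrite ballEmdist /= => xi.
  have h1 := metric_triangle x (D i) y; have h2 := metric_triangle x (D i) z.
  rewrite (metric_sym x (D i)) in h1 h2.
  by apply: hs; rewrite ballEmdist /=; lra.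
exists (pickle (n, j, k, i, l)); rewrite /vs pickleK.
have := lowx n j k i l lu xi; apply: lt_le_trans.
rewrite ltr_pdivlMl// mulrC.
have [Se|Se] := lerP (S - e) 0.
  apply: (@le_lt_trans _ _ 0); first by rewrite mulr_le0_ge0// ltW.
  rewrite expr2 -mulrBr mulr_gt0//; lra.
apply: (@lt_trans _ _ ((S - e) * (S + 2 * eta))); first by rewrite ltr_pM2l//; lra.
have h1 : S * r n x < S * eta by rewrite ltr_pM2l.
have h2 : 3 * (S * eta) <= S * e by have := ler_wpM2l (ltW S0) etae; lra.
have h3 : 0 < e * eta by rewrite mulr_gt0.
by lra.
Qed.

Lemma slope_ess_sup f : H12 m f ->
  is_ess_sup_family m
    [set EFin \o grad_prod m f v | v in [set v : X -> R | k_lipschitz 1 v /\ H12 m v]]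
    (EFin \o slope f).
Proof.
move=> hf; split.
- by apply/measurable_EFinP; case: (slope_L2 hf).
- move=> _ [v [lv hv] <-]; apply: filterS (grad_prod_lip_le hf lv hv) => x h /=.
  by rewrite lee_fin (le_trans (ler_norm _)).
move=> s' ms' ub; have [vs [hvs sup]] := slope_countable_sup hf.
have h : {ae m, forall x : borel X, forall i, ((grad_prod m f (vs i) x)%:E <= s' x)%E}.
  by apply: ae_foralln => i; apply: ub; exists (vs i) => //; exact: hvs.
apply: filterS2 sup h => x sup h /=; apply/lee_addgt0Pr => e e0.
have [i hi] := sup e e0.
apply: (@le_trans _ _ ((grad_prod m f (vs i) x)%:E + e%:E)%E); last exact: leeD2r.
by rewrite -EFinD lee_fin; lra.
Qed.

End family.

(** * The duality formula *)

Section duality.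
Context {R : realType} {X : completeMetricType R}.
Variable m : {measure set (borel X) -> \bar R}.
Implicit Types (w gam : X -> R).
Local Notation L1 u := (m.-integrable setT (EFin \o u)).
Local Notation I u := (Rintegral m setT u).
Local Notation dist := (@mdist R X).

Lemma C_bs_measurable w : C_bs w -> measurable_fun setT (w : borel X -> R).
Proof. by move=> [cw _ _]; exact: continuous_measurable. Qed.

Lemma L1_C_bs (u : borel X -> R) w : L1 u -> C_bs w -> L1 (fun x => u x * w x).
Proof.
move=> hu cw; have [_ /bounded_fun_normP [C hC] _] := cw.
apply: (L1_le _ (L1Z C (L1_norm hu))).
  by apply: measurable_funM; [exact: L1_measurable hu|exact: C_bs_measurable].
by move=> x; rewrite normrM mulrC ler_wpM2r.
Qed.

Lemma C_bs_cutoff w s : C_bs w -> cutoff s -> C_bs (fun x => w x * s x).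
Proof.
move=> [cw /bounded_fun_normP [C hC] bw] [ls s01]; split.
- by move=> x; apply: cvgM; [exact: cw|exact: lipf_continuous].
- apply/bounded_fun_normP; exists C => x; rewrite normrM -[leRHS]mulr1.
  by apply: ler_pM => //; case/andP: (s01 x) => *; rewrite ger0_norm.
case: bw => x0 [r sub]; exists x0, r; apply: subset_trans sub.
by apply: closure_subset => x /=; apply: contra_neq => ->; rewrite mul0r.
Qed.

Lemma C_bs0 : C_bs ((fun=> 0) : X -> R).
Proof.
split; first by move=> x; exact: cvg_cst.
  by apply/bounded_fun_normP; exists 0 => x; rewrite normr0.
exists point, 1; rewrite (_ : [set x | _] = set0) ?closure0//.
by apply/seteqP; split => x //=; rewrite eqxx.
Qed.

Section maxima.
Variable q : nat -> borel X -> R.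
Hypothesis hq : forall i, L1 (q i).

Fixpoint run_max (n : nat) (x : borel X) : R :=
  if n is k.+1 then Num.max (run_max k x) (q k x) else 0.

Lemma run_max_ge0 n x : 0 <= run_max n x.
Proof. by elim: n => //= n IH; rewrite le_max IH. Qed.

Lemma run_max_ge n i x : (i < n)%N -> q i x <= run_max n x.
Proof.
elim: n => //= n IH; rewrite ltnS leq_eqVlt => /predU1P[->|/IH h].
  by rewrite le_max lexx orbT.
by rewrite le_max h.
Qed.

Lemma run_max_le n x c : 0 <= c -> (forall i, q i x <= c) -> run_max n x <= c.
Proof. by move=> c0 h; elim: n => //= n IH; rewrite ge_max IH h. Qed.

Lemma L1_max u v : L1 u -> L1 v -> L1 (fun x => Num.max (u x) (v x)).
Proof.
move=> hu hv; apply: (L1_le _ (L1D (L1_norm hu) (L1_norm hv))).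
  by apply: measurable_maxr; [exact: L1_measurable hu|exact: L1_measurable hv].
move=> x; have := ler_norm (u x); have := ler_norm (v x).
have := ler_norm (- u x); have := ler_norm (- v x); rewrite !normrN.
have := normr_ge0 (u x); have := normr_ge0 (v x).
by case: (leP (u x) (v x)) => ? *; rewrite ler_norml; apply/andP; split; lra.
Qed.

Lemma L1_run_max n : L1 (run_max n).
Proof.
elim: n => [|n IH]; last exact: L1_max.
by have := @integrable0 _ _ R m setT.
Qed.

(** A maximum of finitely many integrands is tested up to [e] by distributing the weight
    [gam] between them: the last integrand receives the share [s * gam], where the cutoff
    [s] nearly realises the integral of the positive part of [(q n - run_max n) * gam]. *)
Lemma run_max_split n gam e : C_bs gam -> (forall x, 0 <= gam x) -> 0 < e ->
  exists w : nat -> X -> R, [/\ forall i, C_bs (w i),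
    forall x, \sum_(i < n) `|w i x| <= gam x &
    I (fun x => run_max n x * gam x) - e <= \sum_(i < n) I (fun x => q i x * w i x)].
Proof.
elim: n gam e => [|n IH] gam e cg g0 e0.
  exists (fun _ _ => 0); split; [by move=> i; exact: C_bs0| |].
    by move=> x; rewrite big_ord0.
  rewrite big_ord0 /= (_ : I _ = 0); first lra.
  by rewrite /Rintegral (eq_integral (cst 0%E)) ?integral0// => x _; rewrite mul0r.
have hphi : L1 (fun x => (q n x - run_max n x) * gam x).
  by apply: L1_C_bs => //; apply: L1B => //; exact: L1_run_max.
have [s cs hs] := cutoff_pos_part hphi (ltac:(lra) : 0 < e / 2).
have [_ s01] := cs.
have cgs := C_bs_cutoff cg cs; have cgC := C_bs_cutoff cg (cutoffC cs).
have [|w [cw sw iw]] := IH (fun x => gam x * (1 - s x)) (e / 2) cgC _ ltac:(lra).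
  by move=> x; rewrite mulr_ge0// subr_ge0; case/andP: (s01 x).
exists (fun i => if i == n then (fun x => gam x * s x) else w i); split.
- by move=> i; case: ifP.
- move=> x; rewrite big_ord_recr /= eqxx.
  rewrite (eq_bigr (fun i : 'I_n => `|w i x|)); last first.
    by move=> i _; rewrite ltn_eqF.
  have := sw x; rewrite ger0_norm; first lra.
  by rewrite mulr_ge0//; case/andP: (s01 x).
rewrite big_ord_recr /= eqxx.
rewrite (eq_bigr (fun i : 'I_n => I (fun x => q i x * w i x))); last first.
  by move=> i _; rewrite ltn_eqF.
have i1 := L1_C_bs (L1_run_max n) cgC.
have i2 := L1_C_bs (hq n) cgs.
have i3 : L1 (fun x => Num.max ((q n x - run_max n x) * gam x) 0).
  by apply: L1_max => //; have := @integrable0 _ _ R m setT.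
have i4 := L1_cutoff_mul hphi cs.
have i5 := L1_C_bs (L1_run_max n) cg.
have E1 : I (fun x => Num.max (run_max n x) (q n x) * gam x) =
    I (fun x => run_max n x * gam x) + I (fun x => Num.max ((q n x - run_max n x) * gam x) 0).
  rewrite -(RintegralD measurableT)//; apply: eq_Rintegral => x _.
  have [le|lt] := leP (run_max n x) (q n x).
    rewrite (max_idPl _); first by ring.
    by rewrite mulr_ge0// subr_ge0.
  rewrite (max_idPr _); first by rewrite addr0.
  by rewrite mulr_le0_ge0// subr_le0 ltW.
have E2 : I (fun x => run_max n x * (gam x * (1 - s x))) + I (fun x => q n x * (gam x * s x)) =
    I (fun x => run_max n x * gam x) + I (fun x => (q n x - run_max n x) * gam x * s x).
  rewrite -!(RintegralD measurableT)//; apply: eq_Rintegral => x _; ring.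
rewrite E1.
move: hs iw E2.
set A := I (fun x => Num.max _ _); set B := I (fun x => _ * s x); set C := I (fun x => run_max n x * gam x).
set D := I (fun x => run_max n x * (gam x * (1 - s x))); set G := I (fun x => q n x * _).
by lra.
Qed.

End maxima.

(** The inf-convolutions of [g] with steeper and steeper cones, cut off by tents on growing
    balls. *)
Lemma C_bs_approx (g : X -> R) : (forall x, 0 <= g x) -> lower_semicontinuous (EFin \o g) ->
  exists gam : nat -> X -> R, [/\ forall n, C_bs (gam n), forall n x, 0 <= gam n x,
    forall n x, gam n x <= g x & forall x, gam n x @[n --> \oo] --> g x].
Proof.
move=> g0 lsc.
have t01 n x : 0 <= tent (point : X) n%:R x <= 1 by have [_] := tent_cutoff (point : X) n%:R.
have ic0 n x := inf_conv_ge0 n x g0; have icle n x := inf_conv_le n x g0.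
exists (fun n x => inf_conv g n x * tent (point : X) n%:R x); split.
- move=> n; have [lt _] := tent_cutoff (point : X) n%:R; split.
  + move=> x; apply: cvgM; first by apply: lipf_continuous; exists n%:R; exact: inf_conv_lip.
    exact: lipf_continuous.
  + apply/bounded_fun_normP; exists n%:R => x; case/andP: (t01 n x) => t0 t1.
    rewrite ger0_norm ?mulr_ge0// -[leRHS]mulr1; apply: ler_pM => //.
    by apply: (le_trans (icle _ _)); rewrite ge_min lexx orbT.
  exists point, (n%:R + 1) => x /(_ _ (nbhsx_ballx x 1 ltr01)) [y [/= ny]].
  rewrite !ballEmdist /= => xy.
  have : dist point y < n%:R.
    by rewrite ltNge; apply/negP => /tent0 E; move: ny; rewrite E mulr0 eqxx.
  by have := metric_triangle (point : X) y x; rewrite (metric_sym y x); lra.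
- by move=> n x; rewrite mulr_ge0//; case/andP: (t01 n x).
- move=> n x; case/andP: (t01 n x) => t0 t1.
  rewrite -[leRHS]mulr1; apply: ler_pM => //.
  by apply: (le_trans (icle _ _)); rewrite ge_min lexx.
move=> x; rewrite -[X in _ --> X]mulr1; apply: cvgM.
  apply: inf_conv_cvg => // a ax; have [V /nbhs_ballP [r /= r0 rV] hV] := lsc x a ltac:(by rewrite lte_fin).
  by exists r; split => // y /rV /hV; rewrite lte_fin.
apply: cvg_near_cst; exists (Num.truncn (dist point x)).+2 => // n /= hn.
have : dist point x < (Num.truncn (dist point x)).+1%:R by exact: truncnS_gt.
have : (Num.truncn (dist point x)).+2%:R <= n%:R :> R by rewrite ler_nat.
rewrite -natr1 => h1 h2; rewrite /tent (min_idPl _); last lra.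
by apply/max_idPr.
Qed.

Local Notation slope := (slope m).
Hypothesis quad : Ch_quadratic m.
Hypothesis fin : finite_on_bounded m.
Hypothesis sep : separable_space X.

(** One inequality is the pointwise bound [grad_prod_lip_le]. For the other, the running maxima
    of the sequence of [slope_countable_sup], weighted by [C_bs_approx], converge to the left-hand
    integrand almost everywhere. *)
Lemma slope_duality f (g : X -> R) : H12 m f -> (forall x, 0 <= g x) ->
  lower_semicontinuous (EFin \o g) ->
  (\int[m]_x (slope f x * g x)%:E)%E
    = ereal_sup
        [set s | exists (n : nat) (v w : 'I_n -> X -> R),
          [/\ forall k, k_lipschitz 1 (v k) /\ H12 m (v k),
              forall k, C_bs (w k),
              forall x, \sum_(k < n) `|w k x| <= g x &
              s = (\sum_(k < n) \int[m]_x (grad_prod m f (v k) x * w k x)%:E)%E]].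
Proof.
move=> hf g0 lsc.
have mg : measurable_fun setT (g : borel X -> R).
  by apply: lsc_measurable => c; move/lower_semicontinuousP : lsc; exact.
have ms : measurable_fun setT (slope f : borel X -> R) by case: (slope_L2 hf).
have s0 := slope_ge0 hf.
have mA : measurable_fun setT (fun x : borel X => `|slope f x|) by exact: measurableT_comp.
have mSg : measurable_fun setT (fun x : borel X => (`|slope f x| * g x)%:E).
  by apply/measurable_EFinP; exact: measurable_funM.
have p0 x : (0 <= (`|slope f x| * g x)%:E)%E by rewrite lee_fin mulr_ge0.
have hG v : H12 m v -> L1 (grad_prod m f v).
  by move=> hv; have [] := grad_prod_squeeze quad hf hv.
rewrite (_ : (\int[m]_x (slope f x * g x)%:E)%E = (\int[m]_x (`|slope f x| * g x)%:E)%E); last first.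
  apply: ae_eq_integral => //; first by apply/measurable_EFinP; exact: measurable_funM.
  by apply: filterS s0 => x h _ /=; rewrite ger0_norm.
apply/eqP; rewrite eq_le; apply/andP; split; last first.
  apply: ge_ereal_sup => _ [n [v [w [hv hw sw ->]]]].
  have iw k : L1 (fun x => grad_prod m f (v k) x * w k x).
    by apply: L1_C_bs => //; apply: hG; case: (hv k).
  have -> : (\sum_(k < n) \int[m]_x (grad_prod m f (v k) x * w k x)%:E)%E =
      (\int[m]_x (\sum_(k < n) (grad_prod m f (v k) x * w k x)%:E))%E.
    by rewrite integral_sum.
  have mS : measurable_fun setT (fun x : borel X => \sum_(k < n) (grad_prod m f (v k) x * w k x)%:E)%E.
    by apply: emeasurable_sum => k; exact: measurable_int (iw k).
  apply: (le_trans (lee_abs _)); apply: (le_trans (le_abse_integral _ measurableT mS)).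
  apply: ae_ge0_le_integral => //; first exact: measurableT_comp.
  have b : {ae m, forall x : borel X, forall k, `|grad_prod m f (v k) x| <= slope f x}.
    have b i : {ae m, forall x : borel X, forall h : (i < n)%N,
        `|grad_prod m f (v (Ordinal h)) x| <= slope f x}.
      have [h|h] := pselect (i < n)%N; last by apply: aeW.
      have [lk hk] := hv (Ordinal h).
      apply: filterS (grad_prod_lip_le quad fin hf lk hk) => x le h'.
      by rewrite (_ : Ordinal h' = Ordinal h)//; exact: val_inj.
    by apply: filterS (ae_foralln b) => x bx [k hk]; exact: bx.
  apply: filterS2 b s0 => x bx sx _; rewrite sumEFin lee_fin (ger0_norm sx).
  apply: (le_trans (ler_norm_sum _ _ _)).
  apply: (@le_trans _ _ (\sum_(k < n) slope f x * `|w k x|)).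
    by apply: ler_sum => k _; rewrite normrM ler_wpM2r.
  by rewrite -mulr_sumr ler_wpM2l.
set T := ereal_sup _.
have [vs [hvs sup]] := slope_countable_sup quad fin sep hf.
have [gam [cg gam0 gamle gamcv]] := C_bs_approx g0 lsc.
pose q i := grad_prod m f (vs i).
have hq i : L1 (q i) by apply: hG; case: (hvs i).
have iF n : L1 (fun x => run_max q n x * gam n x).
  by apply: L1_C_bs => //; exact: L1_run_max.
have FT n : (\int[m]_x (run_max q n x * gam n x)%:E <= T)%E.
  apply/lee_addgt0Pr => e e0.
  have [w [cw sw iw]] := run_max_split hq n (cg n) (gam0 n) e0.
  apply: (@le_trans _ _ ((\sum_(i < n) I (fun x => q i x * w i x))%:E + e%:E)%E).
    by rewrite -EFin_I// -EFinD lee_fin -lerBlDr.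
  apply: leeD2r; apply: ereal_sup_ubound.
  exists n, (fun i => vs i), (fun i => w i); split => //.
    by move=> x; apply: le_trans (gamle n x).
  rewrite -sumEFin; apply: eq_bigr => i _.
  by rewrite EFin_I//; exact: L1_C_bs.
pose F n x := (run_max q n x * gam n x)%:E.
have mF n : measurable_fun setT (F n) by exact: measurable_int (iF n).
have F0 n x : (0 <= F n x)%E by rewrite lee_fin mulr_ge0 ?run_max_ge0.
apply: (@le_trans _ _ (\int[m]_x limn_einf (F ^~ x))%E); last first.
  apply: (le_trans (fatou m measurableT mF (fun n x _ => F0 n x))).
  by apply: limn_einf_le; exact: nearW.
apply: ae_ge0_le_integral => //.
- by move=> x _; exact: limn_einf_ge0.
- exact: measurable_limn_einf.
have b : {ae m, forall x : borel X, forall i, q i x <= slope f x}.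
  apply: ae_foralln => i; have [? ?] := hvs i.
  have := grad_prod_lip_le quad fin hf; move=> /(_ (vs i)) h.
  by apply: filterS (h _ _) => // x; apply: le_trans; exact: ler_norm.
apply: filterS3 b sup s0 => x bx sx s0x _.
suff c : run_max q n x @[n --> \oo] --> slope f x.
  have : F n x @[n --> \oo] --> (`|slope f x| * g x)%:E.
    by rewrite ger0_norm//; apply: cvg_EFinr; apply: cvgM.
  by move=> /cvg_limn_einf_sup [-> _].
apply/cvgrPdist_lt => e e0; have [i hi] := sx e e0.
exists i.+1 => // n /= ni.
have h1 : run_max q n x <= slope f x by exact: run_max_le.
have h2 : q i x <= run_max q n x by exact: run_max_ge.
by rewrite ger0_norm ?subr_ge0//; move: hi; rewrite -/(q i); lra.
Qed.

End duality.

Theorem proposition4p5 (R : realType) (X : completeMetricType R)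
    (m : {measure set (borel X) -> \bar R}) (K : R) (hX : RCD K m)
    (f : X -> R) (hf : H12 m f) :
  is_ess_sup_family m
    [set EFin \o grad_prod m f v
      | v in [set v : X -> R | k_lipschitz 1 v /\ H12 m v]]
    (EFin \o slope m f)
  /\
  forall g : X -> R, (forall x, 0 <= g x) -> lower_semicontinuous (EFin \o g) ->
    (\int[m]_x (slope m f x * g x)%:E)%E
    = ereal_sup
        [set s | exists (n : nat) (v w : 'I_n -> X -> R),
          [/\ forall k, k_lipschitz 1 (v k) /\ H12 m (v k),
              forall k, C_bs (w k),
              forall x, \sum_(k < n) `|w k x| <= g x &
              s = (\sum_(k < n) \int[m]_x (grad_prod m f (v k) x * w k x)%:E)%E]].
Proof.
have [[sep fin] _ quad _] := hX.
split; first exact: slope_ess_sup.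
by move=> g g0 lsc; exact: slope_duality.
Qed.
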